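(* Let $n\ge 1$ and let $\pi\in\mathfrak{S}_n$ be a permutation. The Gauss diagram $\mathfrak{G}(\pi)$ is realizable if and only if $\pi$ is a meandric permutation.
   Context: Gauss diagrams: a double occurrence word is a finite cyclic word in which every letter that appears occurs exactly twice. Its Gauss diagram (chord diagram) is the oriented circle $S^1$ with the letters of the word placed at distinct points in the cyclic order of the word, each pair of points carrying the same letter being joined by a chord; Gauss diagrams are considered up to orientation-preserving diffeomorphism of $S^1$. A generic plane curve is an immersion $\gamma:S^1\to\mathbb{R}^2$ of an oriented circle whose only self-intersections are transversal double points (finitely many). Its Gauss diagram $\mathfrak{G}(\gamma)$ is obtained by joining by a chord each pair of points of $S^1$ mapped to the same double point. A Gauss diagram $\mathfrak{G}$ is realizable if $\mathfrak{G}=\mathfrak{G}(\gamma)$ for some generic plane curve $\gamma$. The Gauss diagram of a permutation: for $\pi\in\mathfrak{S}_n$, $\mathfrak{G}(\pi)$ is the Gauss diagram of the double occurrence word $$W(\pi)=(0,1,2,\dots,n,\theta_n,0,\pi(1),\pi(2),\dots,\pi(n),\theta_n),$$ where $0$ and $\theta_n$ are extra letters different from $1,\dots,n$ and from each other, and $\theta_n$ is the empty symbol (i.e. is omitted) if and only if $n$ is even. Meanders: a meander of order $n$ is a triple $(\mathcal{D},\{m_0,m_1,p_0,p_1\},\{\mu,\ell\})$ where $\mathcal{D}$ is a 2-dimensional (closed) disk; $m_0,m_1,p_0,p_1$ are four distinct points of $\partial\mathcal{D}$ such that some connected component of $\partial\mathcal{D}\setminus\{m_0,p_0\}$ contains both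 $m_1$ and $p_1$; and $\mu,\ell:[0,1]\to\mathcal{D}$ are smooth proper embeddings with $\mu(0)=m_0$, $\mu(1)=m_1$, $\ell(0)=p_0$, $\ell(1)=p_1$, such that the curves $\mu$ and $\ell$ intersect transversely, in exactly $n$ points. Meandric permutations: label the $n$ intersection points of $\mu$ and $\ell$ by $1,\dots,n$ in the order they are met moving along $\ell$ from $p_0$ to $p_1$. The permutation of the meander is $\pi\in\mathfrak{S}_n$ where $\pi(k)$ is the label of the $k$-th intersection point met moving along $\mu$ from $m_0$ to $m_1$. A permutation is meandric if it is the permutation of some meander of order $n$. *)

(* Defs.v *)
From HB Require Import structures.
From mathcomp Require Import all_boot all_order all_algebra all_fingroup.
From mathcomp Require Import all_classical all_reals all_analysis.

Set Implicit Arguments.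
Unset Strict Implicit.
Unset Printing Implicit Defensive.

Import Order.TTheory GRing.Theory Num.Theory.
Import numFieldNormedType.Exports.

Local Open Scope classical_set_scope.
Local Open Scope ring_scope.

Definition smooth (R : realType) (V : normedModType R) (f : R -> V) : Prop :=
  forall (k : nat) (x : R), derivable (derive1n k f) x 1.

(* The oriented circle is R/Z: its points are represented by real numbers
   modulo Z, and maps on it by their lifts to R. *)
Definition circle_eq (R : realType) (s t : R) : Prop :=
  exists k : int, s - t = k%:~R.

(* The lifts to R of the orientation-preserving diffeomorphisms of R/Z. *)
Definition circle_diffeo (R : realType) (h : R -> R) : Prop :=
  [/\ smooth h,
      forall t : R, h (t + 1) = h t + 1
    & forall t : R, 0 < derive1 h t].

(* A chord diagram [D] on R/Z: [D s t] means that a chord joins the points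
   represented by [s] and [t]. *)
Definition chord_diagram (R : realType) : Type := R -> R -> Prop.

Definition same_diagram (R : realType) (D E : chord_diagram R) : Prop :=
  exists2 h : R -> R, circle_diffeo h
    & forall s t : R, D s t <-> E (h s) (h t).

(* The letter of index [i] of a word of length [N] is placed at [i / N]. *)
Definition word_diagram (R : realType) (w : seq nat) : chord_diagram R :=
  fun s t => exists i j : 'I_(size w),
    [/\ i != j, nth 0%N w i = nth 0%N w j,
        circle_eq s (i%:R / (size w)%:R)
      & circle_eq t (j%:R / (size w)%:R)].
Arguments word_diagram R w : clear implicits.

(* Two tangent lines of the plane, directed by [u] and [v], span it. *)
Definition transverse (R : realType) (u v : R * R) : Prop :=
  forall w : R * R, exists a b : R, w = a *: u + b *: v.

Definition generic_curve (R : realType) (g : R -> R * R) : Prop :=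
  [/\ (forall t : R, g (t + 1) = g t) /\ smooth g,
      forall t : R, derive1 g t != 0,
      forall s t : R, ~ circle_eq s t -> g s = g t ->
        transverse (derive1 g s) (derive1 g t),
      forall s t u : R, g s = g t -> g t = g u ->
        [\/ circle_eq s t, circle_eq t u | circle_eq s u]
    & finite_set [set x | exists s t : R, [/\ ~ circle_eq s t, g s = x & g t = x]]].

Definition curve_diagram (R : realType) (g : R -> R * R) : chord_diagram R :=
  fun s t => ~ circle_eq s t /\ g s = g t.

Definition realizable (R : realType) (D : chord_diagram R) : Prop :=
  exists2 g : R -> R * R, generic_curve g & same_diagram D (curve_diagram g).

(* [i : 'I_n] stands for the letter [i.+1] and [n.+1] for the letter theta_n. *)
Definition theta (n : nat) : seq nat := if odd n then [:: n.+1] else [::].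

Definition perm_word (n : nat) (p : 'S_n) : seq nat :=
  0%N :: [seq (i : 'I_n).+1 | i <- enum 'I_n] ++ theta n ++
  0%N :: [seq (p i).+1 | i <- enum 'I_n] ++ theta n.

Definition perm_diagram (R : realType) (n : nat) (p : 'S_n) : chord_diagram R :=
  word_diagram R (perm_word p).
Arguments perm_diagram R [n] p.

Definition unit_disk (R : realType) : set (R * R) :=
  [set x | x.1 ^+ 2 + x.2 ^+ 2 <= 1].

Definition unit_circle (R : realType) : set (R * R) :=
  [set x | x.1 ^+ 2 + x.2 ^+ 2 = 1].
Arguments unit_disk R : clear implicits.
Arguments unit_circle R : clear implicits.

(* [f] restricts to a smooth proper embedding of [0, 1] in the unit disk; a
   smooth map on [0, 1] is given by a smooth extension of it to R. Since
   [0, 1] is compact, an injective immersion of it is an embedding. *)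
Definition proper_embedding (R : realType) (f : R -> R * R) : Prop :=
  [/\ smooth f,
      forall t : R, 0 <= t <= 1 -> derive1 f t != 0,
      forall s t : R, 0 <= s <= 1 -> 0 <= t <= 1 -> f s = f t -> s = t,
      forall t : R, 0 <= t <= 1 -> unit_disk R (f t)
    & forall t : R, 0 <= t <= 1 -> (unit_circle R (f t) <-> t = 0 \/ t = 1)].

Definition arcs_meet (R : realType) (f g : R -> R * R) : set (R * R) :=
  [set f t | t in `[0, 1]] `&` [set g t | t in `[0, 1]].

(* Every 2-dimensional disk is diffeomorphic to the unit disk, and the notions
   below are invariant under diffeomorphisms, so the disk is the unit disk. *)
Record meander (R : realType) (n : nat) : Type := Meander {
  mdr_m0 : R * R;
  mdr_m1 : R * R;
  mdr_p0 : R * R;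
  mdr_p1 : R * R;
  mdr_mu : R -> R * R;
  mdr_ell : R -> R * R;
  mdr_boundary : [/\ unit_circle R mdr_m0, unit_circle R mdr_m1,
                     unit_circle R mdr_p0 & unit_circle R mdr_p1];
  mdr_distinct : uniq [:: mdr_m0; mdr_m1; mdr_p0; mdr_p1];
  mdr_component : exists2 x, (unit_circle R `\` [set mdr_m0; mdr_p0]) x &
    let C := connected_component (unit_circle R `\` [set mdr_m0; mdr_p0]) x in
    C mdr_m1 /\ C mdr_p1;
  mdr_mu_embedding : proper_embedding mdr_mu;
  mdr_ell_embedding : proper_embedding mdr_ell;
  mdr_mu_ends : mdr_mu 0 = mdr_m0 /\ mdr_mu 1 = mdr_m1;
  mdr_ell_ends : mdr_ell 0 = mdr_p0 /\ mdr_ell 1 = mdr_p1;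
  mdr_transverse : forall s t : R, 0 <= s <= 1 -> 0 <= t <= 1 ->
    mdr_mu s = mdr_ell t ->
    transverse (derive1 mdr_mu s) (derive1 mdr_ell t);
  mdr_order : (arcs_meet mdr_mu mdr_ell #= `I_n)%card
}.

(* [x] lists the points of [A] in the order they are met along [f] on [0, 1]. *)
Definition met_along (R : realType) (n : nat) (f : R -> R * R)
    (A : set (R * R)) (x : 'I_n -> R * R) : Prop :=
  range x = A /\
  exists t : 'I_n -> R,
    [/\ forall i, 0 <= t i <= 1,
        forall i j : 'I_n, (i < j)%N -> t i < t j
      & forall i, f (t i) = x i].

Definition meander_permutation (R : realType) (n : nat) (M : meander R n)
    (p : 'S_n) : Prop :=
  let A := arcs_meet (mdr_mu M) (mdr_ell M) in
  exists x y : 'I_n -> R * R,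
    [/\ met_along (mdr_ell M) A x, met_along (mdr_mu M) A y
      & forall k, y k = x (p k)].

Definition meandric (R : realType) (n : nat) (p : 'S_n) : Prop :=
  exists M : meander R n, meander_permutation M p.
Arguments meandric R [n] p.

(* Main.v *)
From HB Require Import structures.
Require Import Defs.
From mathcomp Require Import all_boot all_order all_algebra all_fingroup.
From mathcomp Require Import all_classical all_reals all_analysis.
From mathcomp Require Import ring lra zify.

Set Implicit Arguments.
Unset Strict Implicit.
Unset Printing Implicit Defensive.

Import Order.TTheory GRing.Theory Num.Theory.
Import numFieldNormedType.Exports.

Local Open Scope classical_set_scope.
Local Open Scope ring_scope.

(** Realizability and meandricity are both equivalent to one combinatorial condition. Put 1, ..., n
    on a line, with 0 and n+1 standing for its two ends, and join [pos p k] to [pos p k.+1] by an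
    edge, on one side of the line for even [k] and on the other for odd [k]. The condition
    [noncrossing] says that no two edges on the same side interlace.

    Necessity. A realizing curve and a meander both give an [arc_system]: a simple arc A, the line,
    and a simple arc B crossing it transversally, with auxiliary paths joining their ends. For a
    curve, A is the pass through the first half of the word and B the pass through the second half;
    both start at the letter 0, to which A returns. For odd n both reach theta; for even n both are
    stopped just before they return to the letter 0, and the two stops are joined by a small chord
    ([short_cut]). For a meander A is [ell], B is [mu], and the auxiliary paths run on the boundary
    circle; the hypothesis on the components of the boundary keeps them apart. Since A closes up to
    a loop, B cannot leave A on one side and come back next from the other, so crossing signs
    alternate ([sig_alternates]) and all edges of one parity are on the same side of A. Two
    interlaced ones would have to meet ([arc_system_noncrossing], from [no_interlaced_arcs]).
    Instead of the Jordan curve theorem, only a parity is used: a winding number mod 2, counted on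
    fine subdivisions, is constant off a loop and changes across it ([loop_crossed_once]).

    Sufficiency. Noncrossing edges can be drawn as nested rectangular brackets, edge k at the height
    [level n (pos p) k]. Joined to the line by a detour around everything, they form a closed
    rectilinear route whose crossings are exactly the letters of the word ([crossing_cases]).
    Smoothed by a flat step function, it is a generic curve with the required diagram
    ([noncrossing_realizable]). The portion of such a route that draws the edges, cut at a large
    circle and rescaled, is the curve of a meander whose line is a diameter
    ([noncrossing_meandric]). *)

(** * Compactness of segments and uniform estimates for paths *)

Section Compactness.
Variable R : realType.
Implicit Types (a b e r s t : R).

(** Compactness in its near-covering form: local thresholds on [r] become one threshold. The uniform
    estimates below come from it. *)
Lemma forall_small_segment a b (P : R -> R -> Prop) :
  (forall s, a <= s <= b -> exists2 e : R, 0 < e &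
     forall r s', 0 < r < e -> `|s' - s| < e -> P r s') ->
  exists2 e : R, 0 < e & forall r s, 0 < r < e -> a <= s <= b -> P r s.
Proof.
move=> H.
have cpt : compact `[a, b]%classic by exact: segment_compact.
have nc : near_covering `[a, b]%classic by apply/compact_near_coveringP.
have := nc R (at_right 0) P _.
have hx : forall x, `[a, b]%classic x ->
    \forall x' \near x & i \near (0 : R)^'+, P i x'.
  move=> x /=; rewrite in_itv /= => /H [e e0 He].
  exists (ball x e, [set r | 0 < r < e]) => /=.
    split; first exact: nbhsx_ballx.
    near=> r; apply/andP; split; near: r.
      exact: nbhs_right_gt.
    exact: nbhs_right_lt.
  move=> [y r] /= [By Hr]; apply: He => //.
  by rewrite distrC; move: By; rewrite /ball /=.
move=> /(_ _ hx) [e /= e0 He].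
exists e => // r s /andP[r0 re] sab.
apply: (He r _ r0); last by rewrite set_itvE.
by rewrite /= sub0r normrN gtr0_norm.
Unshelve. all: by end_near. Qed.

Definition cts_at (V : normedModType R) (f : R -> V) t :=
  forall e, 0 < e -> exists2 d : R, 0 < d &
    forall t', `|t' - t| < d -> `|f t' - f t| < e.

Lemma cts_atP (V : normedModType R) (f : R -> V) t :
  {for t, continuous f} <-> cts_at f t.
Proof.
split.
  move=> /cvgrPdist_lt H e /H [d /= d0 Hd]; exists d => // t' tt'.
  by rewrite distrC; apply: Hd => /=; rewrite distrC.
move=> H; apply/cvgrPdist_lt => e /H [d d0 Hd]; exists d => //= t' tt'.
by rewrite distrC; apply: Hd; rewrite distrC.
Qed.

Definition path01 (f : R -> R * R) := forall t, 0 <= t <= 1 -> cts_at f t.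

Lemma norm_pair1 (u : R * R) : `|u.1| <= `|u|.
Proof. by rewrite prod_normE le_max lexx. Qed.

Lemma norm_pair2 (u : R * R) : `|u.2| <= `|u|.
Proof. by rewrite prod_normE le_max lexx orbT. Qed.

Lemma norm_pair_le (u : R * R) e : (`|u| <= e) = (`|u.1| <= e) && (`|u.2| <= e).
Proof. by rewrite prod_normE ge_max. Qed.

Lemma norm_pair_lt (u : R * R) e : (`|u| < e) = (`|u.1| < e) && (`|u.2| < e).
Proof. by rewrite prod_normE gt_max. Qed.

Lemma norm_pair_ltE (u : R * R) e : `|u| < e -> `|u.1| < e /\ `|u.2| < e.
Proof. by rewrite norm_pair_lt => /andP. Qed.

Lemma norm_pair_leI (u : R * R) e : `|u.1| <= e -> `|u.2| <= e -> `|u| <= e.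
Proof. by rewrite norm_pair_le => -> ->. Qed.

Lemma norm_pair_sum (u : R * R) : `|u| <= `|u.1| + `|u.2|.
Proof. by rewrite norm_pair_le; apply/andP; split; rewrite ?lerDl ?lerDr. Qed.

Lemma unif_cts (V : normedModType R) (f : R -> V) a b :
  (forall t, a <= t <= b -> cts_at f t) ->
  forall e, 0 < e -> exists2 d : R, 0 < d & forall s t,
    a <= s <= b -> `|t - s| < d -> `|f t - f s| < e.
Proof.
move=> fc e e0.
have [s /fc H|d d0 Hd] := @forall_small_segment a b
    (fun r s => forall t, `|t - s| < r -> `|f t - f s| < e).
  have [d d0 Hd] := H (e / 2) ltac:(lra).
  exists (d / 2); first lra.
  move=> r s' /andP[r0 rd] ss' t ts'.
  have h1 := Hd s' ltac:(lra).
  have h2 : `|t - s| < d.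
    by have := ler_distD s' t s; lra.
  have := Hd t h2; have := ler_distD (f s) (f t) (f s'); rewrite (distrC (f s)); lra.
exists (d / 2); first lra.
by move=> s t sab ts; apply: (Hd (d / 2)) => //; lra.
Qed.

(** Near a time where [f] is not [x] the distance to [x] is bounded below; compactness makes the
    bound uniform. This turns the injectivity of an arc at one point into information on a whole
    neighbourhood. *)
Lemma near_value_near_time (f : R -> R * R) a b x d :
  (forall t, a <= t <= b -> cts_at f t) -> 0 < d ->
  exists2 e : R, 0 < e & forall t, a <= t <= b -> `|f t - x| < e ->
    exists t0, [/\ a <= t0 <= b, f t0 = x & `|t - t0| < d].
Proof.
move=> fc d0.
have [s sab|e e0 He] := @forall_small_segment a b (fun r t => a <= t <= b ->
    `|f t - x| < r -> exists t0, [/\ a <= t0 <= b, f t0 = x & `|t - t0| < d]).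
  have [fx|fx] := eqVneq (f s) x.
    by exists d => // r t rd td tab _; exists s.
  have n0 : 0 < `|f s - x| / 2 by rewrite divr_gt0 ?normr_gt0 ?subr_eq0.
  have [e e0 He] := fc _ sab _ n0.
  exists (Num.min e (`|f s - x| / 2)); first by rewrite lt_min e0.
  move=> r t /andP[r0]; rewrite !lt_min => /andP[re rn] /andP[te tn] tab.
  have := He _ te; have := ler_distD (f t) (f s) x.
  rewrite (distrC (f s) (f t)); lra.
exists (e / 2); first lra.
by move=> t tab; apply: (He (e / 2)) => //; lra.
Qed.

Lemma path_dist_gt0 (f g : R -> R * R) a b a' b' :
  (forall t, a <= t <= b -> cts_at f t) ->
  (forall t, a' <= t <= b' -> cts_at g t) ->
  (forall s t, a <= s <= b -> a' <= t <= b' -> f s <> g t) ->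
  exists2 e : R, 0 < e &
    forall s t, a <= s <= b -> a' <= t <= b' -> e <= `|f s - g t|.
Proof.
move=> fc gc fg.
have [s sab|e e0 He] := @forall_small_segment a b (fun r s => a <= s <= b ->
    forall t, a' <= t <= b' -> r <= `|f s - g t|).
  have [e e0 He] := near_value_near_time (f s) gc (@ltr01 R).
  have [d d0 Hd] := fc _ sab (e / 2) ltac:(lra).
  exists (Num.min (e / 2) d); first by rewrite lt_min; apply/andP; split; lra.
  move=> r s'; rewrite !lt_min => /and3P[r0 re rd] /andP[_ sd] sab' t tab.
  have [//|lt] := leP r `|f s' - g t|.
  have := Hd _ sd; have := ler_distD (f s') (g t) (f s).
  rewrite (distrC (g t) (f s')) => h1 h2.
  have [|t0 [t0ab gt0 _]] := He t tab; first lra.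
  by case: (fg s t0).
by exists (e / 2); [lra|move=> s t sab tab; apply: (He (e / 2)) => //; lra].
Qed.

End Compactness.

(** * A discrete winding number modulo 2 *)

Section Parity.
Variable R : realType.
Implicit Types (u v x y : R * R) (C f : R -> R * R).

Definition xsum n (F : nat -> bool) := \big[addb/false]_(i < n) F i.

Lemma xsum0 n (F : nat -> bool) : (forall i, (i < n)%N -> F i = false) ->
  xsum n F = false.
Proof. by move=> H; rewrite /xsum big1 // => i _; apply: H. Qed.

Lemma eq_xsum n (F G : nat -> bool) : (forall i, (i < n)%N -> F i = G i) ->
  xsum n F = xsum n G.
Proof. by move=> H; apply: eq_bigr => i _; apply: H. Qed.

Lemma xsumD n (F G : nat -> bool) :
  xsum n (fun i => F i (+) G i) = xsum n F (+) xsum n G.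
Proof. by rewrite /xsum big_split. Qed.

Lemma xsumS n (F : nat -> bool) :
  xsum n.+1 F = F 0%N (+) xsum n (fun i => F i.+1).
Proof. by rewrite /xsum big_ord_recl. Qed.

Lemma xsum_telescope n (F : nat -> bool) :
  xsum n (fun i => F i (+) F i.+1) = F 0%N (+) F n.
Proof.
rewrite /xsum; elim: n => [|n IH]; first by rewrite big_ord0 addbb.
by rewrite big_ord_recr /= IH -addbA addKb.
Qed.

(* [bc u v] tells that [u] and [v] lie in the closed upper half plane, on
   different sides of the vertical axis. *)
Definition bc u v := [&& 0 <= u.2, 0 <= v.2 & (u.1 < 0) (+) (v.1 < 0)].

(** If an abscissa is at least [w] in absolute value, the four abscissas have the same sign and no
    side counts. If an ordinate is, the four ordinates have the same sign, and the count is either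
    empty or the number of sign changes around a cycle, which is even. *)
Lemma bc_odd_cell u00 u10 u11 u01 (w : R) :
  bc u00 u10 (+) bc u10 u11 (+) bc u11 u01 (+) bc u01 u00 ->
  `|u10 - u00| < w -> `|u11 - u00| < w -> `|u01 - u00| < w -> `|u00| < w.
Proof.
case: u00 u10 u11 u01 => [x0 y0] [x1 y1] [x2 y2] [x3 y3].
rewrite /bc !norm_pair_lt /= => H /andP[a1 b1] /andP[a2 b2] /andP[a3 b3].
have same (z z' : R) : `|z' - z| < w -> w <= `|z| -> (z' < 0) = (z < 0).
  by case: (ltP z' 0); case: (ltP z 0) => // z0 z0'; rewrite !ltr_norml;
     [rewrite ger0_norm //|rewrite ltr0_norm //]; lra.
apply/andP; split; rewrite ltNge; apply/negP => le; move: H.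
  by rewrite (same _ _ a1 le) (same _ _ a2 le) (same _ _ a3 le) addbb !andbF.
rewrite !leNgt (same _ _ b1 le) (same _ _ b2 le) (same _ _ b3 le).
by case: (y0 < 0) => //=; do ![case: (_ < 0)].
Qed.

Definition node N (i : nat) : R := i%:R / N%:R.

Lemma node_itv N i : (0 < N)%N -> (i <= N)%N -> 0 <= node N i <= 1.
Proof.
by move=> N0 iN; rewrite /node divr_ge0 //= ler_pdivrMr ?ltr0n // mul1r ler_nat.
Qed.

Lemma node0 N : node N 0 = 0. Proof. by rewrite /node mul0r. Qed.

Lemma nodeN N : (0 < N)%N -> node N N = 1.
Proof. by move=> N0; rewrite /node divff // pnatr_eq0 -lt0n. Qed.

Lemma nodeS N i : node N i.+1 = node N i + N%:R^-1.
Proof. by rewrite /node -addn1 natrD mulrDl mul1r. Qed.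

(** Parity of the crossings of [C] with the vertical ray going up from [x], seen on [N] equal time
    steps. It is an intersection number modulo 2 that asks for no transversality. *)
Definition hits N C x :=
  xsum N (fun i => bc (C (node N i) - x) (C (node N i.+1) - x)).

(** The dual count: the moving arc is subtracted, so the ray from [x] goes down. *)
Definition hits' N f x :=
  xsum N (fun i => bc (x - f (node N i)) (x - f (node N i.+1))).

(** Stokes modulo 2: summed over the cells, every inner side of the grid occurs twice. *)
Lemma grid_boundary N (h v : nat -> nat -> bool) :
  xsum N (fun i => xsum N (fun j =>
     h i j (+) v i.+1 j (+) h i j.+1 (+) v i j)) =
  xsum N (h^~ 0%N) (+) xsum N (h^~ N) (+) (xsum N (v 0%N) (+) xsum N (v N)).
Proof.
rewrite (@eq_xsum _ _ (fun i => (h i 0 (+) h i N) (+)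
    (xsum N (v i) (+) xsum N (v i.+1)))).
  by rewrite xsumD xsumD (xsum_telescope N (fun i => xsum N (v i))).
move=> i _; rewrite -xsum_telescope -!xsumD.
apply: eq_xsum => j _.
by case: (h i j) (v i j) (h i j.+1) (v i.+1 j) => [] [] [] [].
Qed.

Lemma large_node_step (d : R) : 0 < d ->
  exists N0, forall N, (N0 <= N)%N -> (0 < N)%N /\ N%:R^-1 < d.
Proof.
move=> d0; exists (Num.truncn (d^-1)).+1 => N HN.
have N0 : (0 < N)%N by apply: leq_trans HN.
split=> //; rewrite invf_plt ?posrE ?ltr0n //.
apply: lt_le_trans (truncnS_gt _) _; by rewrite ler_nat.
Qed.

(** The map [C s - f t] sends the unit square to the punctured plane. On a fine grid every cell is
    even, so the boundary of the square is even too. *)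
Lemma even_boundary C f : path01 C -> path01 f ->
  (forall s t, 0 <= s <= 1 -> 0 <= t <= 1 -> C s <> f t) ->
  exists N0, forall N, (N0 <= N)%N ->
    hits N C (f 0) (+) hits N C (f 1) = hits' N f (C 0) (+) hits' N f (C 1).
Proof.
move=> Cc fc Cf.
have [e e0 He] := path_dist_gt0 Cc fc Cf.
have [d1 d10 Hd1] := unif_cts Cc (e := e / 2) ltac:(lra).
have [d2 d20 Hd2] := unif_cts fc (e := e / 2) ltac:(lra).
have [N1 HN1] := large_node_step d10.
have [N2 HN2] := large_node_step d20.
exists (maxn N1 N2) => N; rewrite geq_max => /andP[/HN1[N0 Nd1] /HN2[_ Nd2]].
have := grid_boundary N
  (fun i j => bc (C (node N i) - f (node N j)) (C (node N i.+1) - f (node N j)))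
  (fun i j => bc (C (node N i) - f (node N j)) (C (node N i) - f (node N j.+1))).
rewrite xsum0; last first.
  move=> i iN; apply: xsum0 => j jN; apply/negP => H.
  have bcC u v : bc u v = bc v u.
    by rewrite /bc andbCA addbC.
  have i01 : 0 <= node N i <= 1 by rewrite node_itv // ltnW.
  have j01 : 0 <= node N j <= 1 by rewrite node_itv // ltnW.
  have nn : 0 < N%:R^-1 :> R by rewrite invr_gt0 ltr0n.
  have Ci : `|C (node N i.+1) - C (node N i)| < e / 2.
    by apply: Hd1 => //; rewrite nodeS addrAC subrr add0r gtr0_norm.
  have fj : `|f (node N j.+1) - f (node N j)| < e / 2.
    by apply: Hd2 => //; rewrite nodeS addrAC subrr add0r gtr0_norm.
  have subACA (a b c d : R * R) : (a - b) - (c - d) = (a - c) - (b - d).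
    by rewrite !opprB [LHS]addrACA [RHS]addrACA (addrC (- b)).
  (* The sides of the cell are shorter than [e / 2] and its diagonal shorter than [e], so an odd
     cell would come within [e] of the origin. *)
  have := He _ _ i01 j01; rewrite leNgt => /negP; apply.
  apply: (@bc_odd_cell (C (node N i) - f (node N j)) (C (node N i.+1) - f (node N j))
    (C (node N i.+1) - f (node N j.+1)) (C (node N i) - f (node N j.+1))).
  - move: H; rewrite (bcC (C (node N i) - f (node N j.+1)) (C (node N i.+1) - f (node N j.+1))).
    by rewrite (bcC (C (node N i) - f (node N j.+1)) (C (node N i) - f (node N j))).
  - by rewrite subACA subrr subr0; lra.
  - by rewrite subACA; have := ler_normB (C (node N i.+1) - C (node N i)) (f (node N j.+1) - f (node N j)); lra.
  - by rewrite subACA subrr sub0r normrN; lra.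
rewrite /hits /hits' /= node0 (nodeN N0).
by case: (xsum _ _); case: (xsum _ _); case: (xsum _ _); case: (xsum _ _).
Qed.

(** [C] runs from the left of [f] to its right, below [f 0] and above [f 1]. Only the ray going up
    from [f 1] is hit, and the hits telescope to one change of side. *)
Lemma odd_boundary C f N : (0 < N)%N ->
  (forall t, 0 <= t <= 1 -> (C 0).1 < (f t).1 < (C 1).1) ->
  (forall s, 0 <= s <= 1 -> (f 1).2 < (C s).2 < (f 0).2) ->
  hits N C (f 0) (+) hits N C (f 1) = ~~ (hits' N f (C 0) (+) hits' N f (C 1)).
Proof.
move=> N0 Hx Hy.
have nd i : (i < N)%N -> 0 <= node N i <= 1 by move=> ?; apply: node_itv => //; exact: ltnW.
have nd' i : (i < N)%N -> 0 <= node N i.+1 <= 1 by move=> ?; apply: node_itv.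
have -> : hits N C (f 0) = false.
  apply: xsum0 => i /nd /Hy /andP[_].
  by rewrite /bc /= subr_ge0 leNgt => ->.
have -> : hits' N f (C 0) = false.
  apply: xsum0 => i iN; have := Hx _ (nd _ iN); have := Hx _ (nd' _ iN).
  by rewrite /bc /= !subr_lt0 => /andP[-> _] /andP[-> _]; rewrite !andbF.
have -> : hits' N f (C 1) = false.
  apply: xsum0 => i iN; have := Hx _ (nd _ iN); have := Hx _ (nd' _ iN).
  rewrite /bc /= !subr_lt0 => /andP[_ /ltW +] /andP[_ /ltW +].
  by rewrite !leNgt => /negbTE-> /negbTE->; rewrite !andbF.
rewrite /hits /=.
rewrite (@eq_xsum _ _ (fun i => ((C (node N i) - f 1).1 < 0) (+) ((C (node N i.+1) - f 1).1 < 0))); last first.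
  move=> i iN; rewrite /bc /=.
  by have /andP[/ltW h1 _] := Hy _ (nd _ iN); have /andP[/ltW h2 _] := Hy _ (nd' _ iN); rewrite !subr_ge0 h1 h2.
rewrite xsum_telescope node0 nodeN //= !subr_lt0.
have /andP[-> /ltW] := Hx 1 ltac:(lra).
by rewrite leNgt => /negbTE->.
Qed.

(** A finite chain of paths rather than one path, so that concatenation needs no
    reparametrisation. *)
Inductive joined (S : R * R -> Prop) : R * R -> R * R -> Prop :=
| joined_refl x : joined S x x
| joined_step f y : path01 f -> (forall t, 0 <= t <= 1 -> S (f t)) ->
    joined S (f 1) y -> joined S (f 0) y.

Lemma joined_trans S x y z : joined S x y -> joined S y z -> joined S x z.
Proof. by elim => // f y' fc fS _ IH /IH; apply: joined_step. Qed.

Lemma joined_mono (S S' : R * R -> Prop) x y :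
  (forall z, S z -> S' z) -> joined S x y -> joined S' x y.
Proof.
move=> SS'; elim => [z|f z fc fS _ IH]; first exact: joined_refl.
by apply: joined_step IH => // t /fS /SS'.
Qed.

Lemma joined_path S f : path01 f -> (forall t, 0 <= t <= 1 -> S (f t)) ->
  joined S (f 0) (f 1).
Proof. by move=> fc fS; apply: joined_step fc fS (joined_refl _ _). Qed.

(* A Z/2 winding number: [x |-> xsum m (fun i => hits N (Cs i) x)] is constant
   along paths off the loop, and changes across the loop. *)
Lemma loop_crossed_once (T : R * R -> R * R) (m : nat) (Cs : nat -> R -> R * R) k :
  (forall f t, cts_at f t -> cts_at (T \o f) t) -> injective T ->
  (0 < m)%N ->
  (forall i, (i < m)%N -> path01 (Cs i)) ->
  (forall i, (i < m)%N -> Cs i 1 = Cs i.+1 0) -> Cs m 0 = Cs 0%N 0 ->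
  path01 k ->
  (forall i s t, (0 < i < m)%N -> 0 <= s <= 1 -> 0 <= t <= 1 -> Cs i s <> k t) ->
  (forall t, 0 <= t <= 1 -> (T (Cs 0%N 0)).1 < (T (k t)).1 < (T (Cs 0%N 1)).1) ->
  (forall s, 0 <= s <= 1 -> (T (k 1)).2 < (T (Cs 0%N s)).2 < (T (k 0)).2) ->
  joined (fun x => forall i s, (i < m)%N -> 0 <= s <= 1 -> Cs i s <> x)
    (k 0) (k 1) -> False.
Proof.
move=> Tc Tinj m0 Csc Csj Csl kc Csk Hx Hy J.
pose W N x := xsum m (fun i => hits N (T \o Cs i) (T x)).
(* The counts at the corners cancel around the closed loop, for any arc [f]. *)
have loopE N f : xsum m (fun i => hits' N f (T (Cs i 0)) (+) hits' N f (T (Cs i 1))) = false.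
  rewrite (@eq_xsum _ _ (fun i => hits' N f (T (Cs i 0)) (+) hits' N f (T (Cs i.+1 0)))).
    by rewrite (xsum_telescope _ (fun i => hits' N f (T (Cs i 0)))) Csl addbb.
  by move=> i im; rewrite Csj.
have bounded_choice (P : nat -> nat -> Prop) n :
    (forall i, (i < n)%N -> exists N0, forall N, (N0 <= N)%N -> P i N) ->
    exists N0, forall N, (N0 <= N)%N -> forall i, (i < n)%N -> P i N.
  elim: n => [|n IH] H; first by exists 0%N.
  have [N1 H1] := IH (fun i il => H i (ltnW il)).
  have [N2 H2] := H n (leqnn _).
  exists (maxn N1 N2) => N; rewrite geq_max => /andP[N1N N2N] i.
  rewrite ltnS leq_eqVlt => /orP[/eqP->|]; [exact: H2|exact: H1].
have Wjoined x y : joined (fun x => forall i s, (i < m)%N -> 0 <= s <= 1 -> Cs i s <> x) x y ->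
    exists N0, forall N, (N0 <= N)%N -> W N x = W N y.
  elim => [z|f z fc fS _ [N1 H1]]; first by exists 0%N.
  have [|N2 H2] := bounded_choice (fun i N => hits N (T \o Cs i) (T (f 0)) (+)
     hits N (T \o Cs i) (T (f 1)) = hits' N (T \o f) (T (Cs i 0)) (+) hits' N (T \o f) (T (Cs i 1))) m.
    move=> i im; apply: (@even_boundary (T \o Cs i) (T \o f)).
    - by move=> t t01; apply: Tc; exact: (Csc _ im).
    - by move=> t t01; apply: Tc; exact: fc.
    - by move=> s t s01 t01 /Tinj; exact: fS.
  exists (maxn N1 N2) => N; rewrite geq_max => /andP[/H1<- /H2 H].
  have := loopE N (T \o f); rewrite -(eq_xsum H) xsumD -/(W N (f 0)) -/(W N (f 1)).
  by case: (W N (f 0)); case: (W N (f 1)).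
have [N1 H1] := Wjoined _ _ J.
have [|N2 H2] := bounded_choice (fun i N => (0 < i)%N -> hits N (T \o Cs i) (T (k 0)) (+)
     hits N (T \o Cs i) (T (k 1)) = hits' N (T \o k) (T (Cs i 0)) (+) hits' N (T \o k) (T (Cs i 1))) m.
  move=> [|i] im; first by exists 0%N.
  have [|||N2 H2] := @even_boundary (T \o Cs i.+1) (T \o k).
  - by move=> t t01; apply: Tc; exact: (Csc _ im).
  - by move=> t t01; apply: Tc; exact: kc.
  - by move=> s t s01 t01 /Tinj; exact: Csk.
  by exists N2 => N /H2.
(* A subdivision fine enough both for the chain joining [k 0] to [k 1] and for the arcs of the loop
   against [k]. *)
pose N := (maxn N1 N2).+1.
have := H1 N; rewrite /N leqW ?leq_maxl // => /(_ isT) WE.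
have := H2 N; rewrite /N leqW ?leq_maxr // => /(_ isT) HE.
(* Only the arc of index 0 gives an odd relation; the sum over the loop then makes the winding
   numbers of [k 0] and [k 1] differ. *)
have := @odd_boundary (T \o Cs 0%N) (T \o k) _ (ltn0Sn (maxn N1 N2)) Hx Hy => /= odd.
have := loopE N (T \o k).
case: m m0 {Csc Csj Csl Csk J loopE Wjoined H1 H2} @W WE HE => // m _ W.
rewrite /W -/N !xsumS => WE HE.
rewrite -(@eq_xsum m _ _ (fun i im => HE i.+1 im isT)) xsumD => LE.
have addb_contra (a b c d e g : bool) : a (+) b = ~~ (c (+) d) -> a (+) e = b (+) g ->
  (c (+) d) (+) (e (+) g) = false -> False.
  by case: a b c d e g => [] [] [] [] [] [].
exact: addb_contra odd WE LE.
Qed.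

End Parity.

(** * Differential calculus for plane arcs *)

Section Calculus.
Variable R : realType.
Implicit Types (A : R -> R * R) (f : R -> R).

Lemma derivable_pairP A (t : R) : derivable A t 1 <->
  derivable (fun t => (A t).1) t 1 /\ derivable (fun t => (A t).2) t 1.
Proof.
split.
  move=> /cvg_ex [[l1 l2] Hl]; split; apply/cvg_ex; [exists l1|exists l2].
    exact: (cvg_comp _ _ Hl (@cvg_fst _ _ (nbhs l1) (nbhs l2) _)).
  exact: (cvg_comp _ _ Hl (@cvg_snd _ _ (nbhs l1) (nbhs l2) _)).
move=> [/cvg_ex [l1 H1] /cvg_ex [l2 H2]]; apply/cvg_ex; exists (l1, l2).
exact: (cvg_pair H1 H2).
Qed.

Lemma is_derive_pair A (t : R) (l : R * R) : is_derive t 1 A l <->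
  is_derive t 1 (fun t => (A t).1) l.1 /\ is_derive t 1 (fun t => (A t).2) l.2.
Proof.
split.
  move=> [dA <-]; have [d1 d2] := (derivable_pairP A t).1 dA.
  split; apply: DeriveDef; [exact: d1| |exact: d2|].
    move: dA => /cvg_ex [[l1 l2] Hl].
    rewrite /derive (cvg_lim _ Hl) //=; apply: cvg_lim => //.
    exact: (cvg_comp _ _ Hl (@cvg_fst _ _ (nbhs l1) (nbhs l2) _)).
  move: dA => /cvg_ex [[l1 l2] Hl].
  rewrite /derive (cvg_lim _ Hl) //=; apply: cvg_lim => //.
  exact: (cvg_comp _ _ Hl (@cvg_snd _ _ (nbhs l1) (nbhs l2) _)).
move=> [[d1 e1] [d2 e2]]; apply: DeriveDef; first exact/derivable_pairP.
move: d1 d2 e1 e2 => /cvg_ex [l1 H1] /cvg_ex [l2 H2].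
rewrite /derive (cvg_lim _ H1) // (cvg_lim _ H2) // => e1 e2.
case: l e1 e2 => a b /= <- <-.
have C : (fun h : R => h^-1 *: ((A \o shift t) (h *: (1 : R)) - A t)) @ 0^' --> (l1, l2).
  exact: (cvg_pair H1 H2).
have E := cvg_lim (@norm_hausdorff _ _) C; exact: E.
Qed.

Lemma derive1_pair A (t : R) : derivable A t 1 ->
  derive1 A t = (derive1 (fun t => (A t).1) t, derive1 (fun t => (A t).2) t).
Proof.
move=> dA; have [[d1 e1] [d2 e2]] := (is_derive_pair A t _).1 (derivableP dA).
by rewrite !derive1E e1 e2; case: ('D_1 A t).
Qed.

Definition C1 A := (forall t, derivable A t 1) /\ forall t, cts_at (derive1 A) t.

Lemma smooth_C1 A : smooth A -> C1 A.
Proof.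
move=> sA; split=> t; first exact: (sA 0%N).
apply/cts_atP; apply: differentiable_continuous.
by apply/derivable1_diffP; exact: (sA 1%N).
Qed.

Lemma C1_cts A t : C1 A -> cts_at A t.
Proof.
move=> [dA _]; apply/cts_atP/differentiable_continuous.
by apply/derivable1_diffP; exact: dA.
Qed.

Lemma derivable_increment A t : derivable A t 1 -> forall e, 0 < e ->
  exists2 d : R, 0 < d & forall t', `|t' - t| < d ->
    `|A t' - A t - (t' - t) *: derive1 A t| <= e * `|t' - t|.
Proof.
move=> dA e e0; have [_ D] := derivableP dA.
move: dA => /cvg_ex [l Hl]; have El : derive1 A t = l.
  by rewrite derive1E /derive; apply: cvg_lim.
move/cvgrPdist_lt: Hl => /(_ _ e0) [d /= d0 Hd]; exists d => // t' tt'.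
have [->|neq] := eqVneq t' t; first by rewrite !subrr scale0r subr0 !normr0 mulr0.
have := Hd (t' - t); rewrite /= sub0r normrN subr_eq0 => /(_ tt' neq).
rewrite [(t' - t) *: 1]mulr1 subrK El => /ltW H.
have h0 : t' - t != 0 by rewrite subr_eq0.
have -> : A t' - A t - (t' - t) *: l = - ((t' - t) *: (l - (t' - t)^-1 *: (A t' - A t))).
  by rewrite scalerBr scalerA divff // scale1r opprB.
by rewrite normrN normrZ mulrC ler_wpM2r.
Qed.

Lemma mean_value f a b : (forall t, derivable f t 1) ->
  exists2 c : R, (a <= c <= b) || (b <= c <= a) & f b - f a = derive1 f c * (b - a).
Proof.
move=> df; wlog ab : a b / a < b => [H|].
  case: (ltgtP a b) => [ab|ba|->]; first exact: H.
    have [c cab E] := H b a ba; exists c; first by rewrite orbC.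
    by move: E; lra.
  by exists b; rewrite ?lexx // !subrr mulr0.
have [x _||c cab E] := @MVT_segment R f (derive1 f) a b (ltW ab).
- by rewrite derive1E; apply: DeriveDef.
- apply: continuous_subspaceT => x; apply: differentiable_continuous.
  by apply/derivable1_diffP; exact: df.
by move: cab; rewrite in_itv /= => cab; exists c; rewrite ?cab.
Qed.

(** Strict differentiability: both times may move. It is the mean value theorem on each coordinate,
    which the sup norm keeps separate. *)
Lemma C1_increment A t : C1 A -> forall e, 0 < e ->
  exists2 d : R, 0 < d & forall s s', `|s - t| < d -> `|s' - t| < d ->
    `|A s' - A s - (s' - s) *: derive1 A t| <= e * `|s' - s|.
Proof.
move=> [dA cA] e e0; have [d d0 Hd] := cA t e e0.
exists d => // s s' sd s'd.
have d12 x := (derivable_pairP A x).1 (dA x).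
have [c1 c1s E1] := mean_value s s' (fun x => (d12 x).1).
have [c2 c2s E2] := mean_value s s' (fun x => (d12 x).2).
have near c : (s <= c <= s') || (s' <= c <= s) -> `|c - t| < d.
  move: sd s'd; rewrite !ltr_norml.
  by move=> /andP[? ?] /andP[? ?] /orP[] /andP[? ?]; apply/andP; split; lra.
have [_ /ltW H2] := norm_pair_ltE (Hd _ (near _ c2s)).
have [/ltW H1 _] := norm_pair_ltE (Hd _ (near _ c1s)).
apply: norm_pair_leI.
  have -> : (A s' - A s - (s' - s) *: derive1 A t).1 =
      ((derive1 A c1).1 - (derive1 A t).1) * (s' - s).
    by rewrite (derive1_pair (dA c1)) /=; move: E1; rewrite /GRing.scale /=; lra.
  by rewrite normrM ler_wpM2r.
have -> : (A s' - A s - (s' - s) *: derive1 A t).2 =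
    ((derive1 A c2).2 - (derive1 A t).2) * (s' - s).
  by rewrite (derive1_pair (dA c2)) /=; move: E2; rewrite /GRing.scale /=; lra.
by rewrite normrM ler_wpM2r.
Qed.

End Calculus.

(** * Determinants, elementary paths and the two sides of an arc *)

Section Sides.
Variable R : realType.
Implicit Types (u v w x y p q : R * R) (A f Q Z : R -> R * R).

Definition det u v := u.1 * v.2 - u.2 * v.1.
Definition dot u v := u.1 * v.1 + u.2 * v.2.

Lemma dot_norm_le u v : `|dot u v| <= 2 * `|u| * `|v|.
Proof.
have := ler_normD (u.1 * v.1) (u.2 * v.2); rewrite !normrM /dot => /le_trans; apply.
have : `|u.1| * `|v.1| <= `|u| * `|v| by rewrite ler_pM ?norm_pair1.
by have : `|u.2| * `|v.2| <= `|u| * `|v| by [rewrite ler_pM ?norm_pair2|]; lra.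
Qed.

(** Used whenever a parameter has to be smaller than finitely many bounds at once. *)
Lemma lower_bound_pos (s : seq R) : all (fun a : R => 0 < a) s ->
  exists2 m : R, 0 < m & all (fun a => m < a) s.
Proof.
elim: s => [_|a s IH /= /andP[a0 /IH [m m0 ms]]]; first by exists 1.
exists (Num.min (a / 2) m); first by rewrite lt_min m0 divr_gt0.
rewrite gt_min ltr_pdivrMr // ltr_pMr // ltr1n /=.
by apply: sub_all ms => y my; rewrite gt_min my orbT.
Qed.

Lemma det_norm_le u v : `|det u v| <= 2 * `|u| * `|v|.
Proof.
have := ler_normB (u.1 * v.2) (u.2 * v.1); rewrite !normrM /det => /le_trans; apply.
have : `|u.1| * `|v.2| <= `|u| * `|v| by rewrite ler_pM ?norm_pair1 ?norm_pair2.
by have : `|u.2| * `|v.1| <= `|u| * `|v| by [rewrite ler_pM ?norm_pair2 ?norm_pair1|]; lra.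
Qed.

Lemma scaleE (a b : R) : a *: b = a * b. Proof. by []. Qed.
Lemma fstZ (a : R) u : (a *: u).1 = a * u.1. Proof. by []. Qed.
Lemma sndZ (a : R) u : (a *: u).2 = a * u.2. Proof. by []. Qed.

Lemma detDr u v w : det u (v + w) = det u v + det u w.
Proof. by rewrite /det /=; ring. Qed.
Lemma detBr u v w : det u (v - w) = det u v - det u w.
Proof. by rewrite /det /=; ring. Qed.
Lemma detZr u v (a : R) : det u (a *: v) = a * det u v.
Proof. by rewrite /det fstZ sndZ; ring. Qed.
Lemma detNr u v : det u (- v) = - det u v.
Proof. by rewrite /det /=; ring. Qed.
Lemma det0r u : det u 0 = 0.
Proof. by rewrite -(scale0r 0) detZr mul0r. Qed.
Lemma dotDr u v w : dot u (v + w) = dot u v + dot u w.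
Proof. by rewrite /dot /=; ring. Qed.
Lemma dotBr u v w : dot u (v - w) = dot u v - dot u w.
Proof. by rewrite /dot /=; ring. Qed.
Lemma dotZr u v (a : R) : dot u (a *: v) = a * dot u v.
Proof. by rewrite /dot fstZ sndZ; ring. Qed.

Lemma dot_gt0 u : u != 0 -> 0 < dot u u.
Proof.
case: u => a b; rewrite /dot /= => H.
have : (a != 0) || (b != 0).
  by apply: contraNT H; rewrite negb_or !negbK => /andP[/eqP-> /eqP->].
move=> /orP[] h0; have := sqr_ge0 a; have := sqr_ge0 b; rewrite !expr2.
  by have : 0 < a * a by [rewrite -expr2 exprn_even_gt0|]; lra.
by have : 0 < b * b by [rewrite -expr2 exprn_even_gt0|]; lra.
Qed.

Lemma dot_det_eq0 p u : p != 0 -> dot p u = 0 -> det p u = 0 -> u = 0.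
Proof.
move=> /dot_gt0; case: p u => a b [c d]; rewrite /dot /det /= => D e1 e2.
have h1 : (a * a + b * b) * c = 0.
  have -> : (a * a + b * b) * c = a * (a * c + b * d) - b * (a * d - b * c) by ring.
  by rewrite e1 e2 !mulr0 subr0.
have h2 : (a * a + b * b) * d = 0.
  have -> : (a * a + b * b) * d = b * (a * c + b * d) + a * (a * d - b * c) by ring.
  by rewrite e1 e2 !mulr0 addr0.
move/eqP: h1; move/eqP: h2; rewrite !mulf_eq0 (gt_eqF D) /=.
by move=> /eqP-> /eqP->.
Qed.

Lemma lipschitz_cts_at (V : normedModType R) (f : R -> V) t (K : R) :
  (forall t', `|f t' - f t| <= K * `|t' - t|) -> cts_at f t.
Proof.
move=> H e e0; exists (e / (`|K| + 1)); first by rewrite divr_gt0 // ltr_wpDl.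
move=> t'; rewrite ltr_pdivlMr ?ltr_wpDl // => lt.
apply: le_lt_trans (H t') _; apply: le_lt_trans lt.
rewrite mulrC ler_wpM2l //; have := ler_norm K; lra.
Qed.

Lemma cts_at_comp (V : normedModType R) (f : R -> V) (g : R -> R) t :
  cts_at g t -> cts_at f (g t) -> cts_at (f \o g) t.
Proof.
move=> Hg Hf e /Hf [d d0 Hd]; have [d' d'0 Hd'] := Hg _ d0.
by exists d' => // t' /Hd' /Hd.
Qed.

Lemma cts_atD (V : normedModType R) (f g : R -> V) t :
  cts_at f t -> cts_at g t -> cts_at (fun t => f t + g t) t.
Proof. by move=> /cts_atP Hf /cts_atP Hg; apply/cts_atP; exact: cvgD. Qed.

Lemma cts_atZ (V : normedModType R) (f : R -> V) (r : R) t :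
  cts_at f t -> cts_at (fun t => r *: f t) t.
Proof. by move=> /cts_atP Hf; apply/cts_atP; exact: cvgZr. Qed.

Lemma cts_at_cst (V : normedModType R) (x : V) t : cts_at (fun _ : R => x) t.
Proof.
by apply: (@lipschitz_cts_at _ _ _ 0) => t'; rewrite subrr normr0 mul0r.
Qed.

Definition aff (a b : R) (t : R) := a + t * (b - a).

Lemma cts_at_aff (a b t : R) : cts_at (aff a b) t.
Proof.
apply: (@lipschitz_cts_at _ _ _ `|b - a|) => t'.
by rewrite /aff -normrM le_eqVlt; apply/orP; left; apply/eqP; congr `|_|; ring.
Qed.

Lemma path_aff A (a b : R) : (forall t, cts_at A t) -> path01 (A \o aff a b).
Proof. by move=> cA t _; apply: cts_at_comp => //; exact: cts_at_aff. Qed.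

Definition seg x y (t : R) := x + t *: (y - x).

Lemma path_seg x y : path01 (seg x y).
Proof.
move=> t _; apply: (@lipschitz_cts_at _ _ _ `|y - x|) => t'.
by rewrite /seg opprD addrACA subrr add0r -scalerBl normrZ mulrC.
Qed.

Lemma seg0 x y : seg x y 0 = x. Proof. by rewrite /seg scale0r addr0. Qed.
Lemma seg1 x y : seg x y 1 = y. Proof. by rewrite /seg scale1r addrC subrK. Qed.
Lemma aff0 (a b : R) : aff a b 0 = a. Proof. by rewrite /aff; ring. Qed.
Lemma aff1 (a b : R) : aff a b 1 = b. Proof. by rewrite /aff; ring. Qed.

Lemma aff_itv (a b t : R) : a <= b -> 0 <= t <= 1 -> a <= aff a b t <= b.
Proof. by rewrite /aff => ab /andP[t0 t1]; apply/andP; split; nra. Qed.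

Lemma aff_surj (a b s : R) : a < b -> a <= s <= b ->
  exists2 t : R, 0 <= t <= 1 & s = aff a b t.
Proof.
move=> ab /andP[as_ sb]; exists ((s - a) / (b - a)); last first.
  by rewrite /aff divfK ?subr_eq0 ?gt_eqF //; ring.
have d0 : 0 < b - a by rewrite subr_gt0.
by rewrite divr_ge0 ?subr_ge0 //= ?ler_pdivrMr //=; [rewrite mul1r; lra|lra].
Qed.

Lemma seg_normB x y z (t : R) : 0 <= t <= 1 ->
  `|seg x y t - z| <= (1 - t) * `|x - z| + t * `|y - z|.
Proof.
move=> /andP[t0 t1].
have -> : seg x y t - z = (1 - t) *: (x - z) + t *: (y - z).
  by apply: injective_projections; rewrite /seg /= !scaleE; ring.
apply: le_trans (ler_normD _ _) _.
by rewrite !normrZ (ger0_norm t0) ger0_norm ?subr_ge0.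
Qed.

(** The velocity turned clockwise by a quarter turn, hence pointing to the right of the motion. *)
Definition rgt A (t : R) := ((derive1 A t).2, - (derive1 A t).1).

Lemma det_rgt A t : det (derive1 A t) (rgt A t) = - dot (derive1 A t) (derive1 A t).
Proof. by rewrite /det /dot /rgt /=; ring. Qed.

Lemma dot_rgt A t : dot (derive1 A t) (rgt A t) = 0.
Proof. by rewrite /dot /rgt /=; ring. Qed.

Lemma rgt_eq0 A t : derive1 A t != 0 -> rgt A t != 0.
Proof.
rewrite /rgt; case: (derive1 A t) => a b /=; apply: contra => /eqP[-> /eqP].
by rewrite oppr_eq0 => /eqP->.
Qed.

(* one-sided derivative at [0] *)
Definition leaves f x q := f 0 = x /\ forall e : R, 0 < e ->
  exists2 d : R, 0 < d & forall t, 0 <= t < d -> `|f t - x - t *: q| <= e * t.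

(** Near a regular point the arc is almost straight along its tangent. The last bound, in terms of
    the chord instead of the time, is the one compared with cones around other directions. *)
Lemma C1_local_increment A t (p := derive1 A t) : C1 A -> p != 0 ->
  forall k : R, 0 < k -> exists2 d : R, 0 < d & forall s s',
    `|s - t| < d -> `|s' - t| < d ->
    [/\ `|det p (A s' - A s)| <= k * `|s' - s|,
        `|dot p (A s' - A s) - (s' - s) * dot p p| <= k * `|s' - s| &
        `|det p (A s' - A s)| <= k * `|A s' - A s| ].
Proof.
move=> CA p0 k k0.
have np : 0 < `|p| by rewrite normr_gt0.
(* The last term gives the two bounds in time. The first makes the chord at least [|p| / 2] times
   the time, and then [k / 4] gives the bound in length. *)
pose e := Num.min (Num.min (`|p| / 2) (k / 4)) (k / (2 * `|p|)).
have e0 : 0 < e by rewrite !lt_min; apply/andP; split; [apply/andP; split; lra|rewrite divr_gt0 // mulr_gt0].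
have [e1 e2 e3] : [/\ e <= `|p| / 2, e <= k / 4 & 2 * `|p| * e <= k].
  split; rewrite /e ?ge_min ?lexx ?orbT //.
  by rewrite mulrC -ler_pdivlMr ?mulr_gt0 // !ge_min lexx !orbT.
have [d d0 Hd] := C1_increment t CA e0; exists d => // s s' sd s'd.
have := Hd s s' sd s'd; rewrite -/p.
set w := A s' - A s; set D := s' - s; set rho := w - D *: p => Hr.
have wE : w = D *: p + rho by rewrite /rho addrC subrK.
have dp : det p w = det p rho.
  by rewrite wE detDr detZr; rewrite /det; ring.
have dt : dot p w - D * dot p p = dot p rho by rewrite wE dotDr dotZr; ring.
have D0 : 0 <= `|D| by [].
have b1 : `|det p rho| <= 2 * `|p| * (e * `|D|).
  apply: le_trans (det_norm_le _ _) _; rewrite ler_wpM2l //; lra.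
have b2 : `|dot p rho| <= 2 * `|p| * (e * `|D|).
  apply: le_trans (dot_norm_le _ _) _; rewrite ler_wpM2l //; lra.
have b3 : 2 * `|p| * (e * `|D|) <= k * `|D| by rewrite mulrA ler_wpM2r.
have wn : `|D| * `|p| - e * `|D| <= `|w|.
  have -> : `|D| * `|p| = `|D *: p| by rewrite normrZ.
  have := ler_normB w rho; rewrite {2}wE.
  have -> : w - rho = D *: p by rewrite wE addrK.
  by rewrite -wE; lra.
split; rewrite ?dp ?dt; [exact: le_trans b1 b3|exact: le_trans b2 b3|].
apply: le_trans b1 _.
have h1 : `|D| * (`|p| / 2) <= `|w|.
  have : `|D| * e <= `|D| * (`|p| / 2) by rewrite ler_wpM2l.
  lra.
have h2 : k * (`|D| * (`|p| / 2)) <= k * `|w| by rewrite ler_wpM2l // ltW.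
apply: le_trans _ h2.
have h3 : (`|p| * `|D|) * e <= (`|p| * `|D|) * (k / 4).
  by rewrite ler_wpM2l // mulr_ge0 // ltW.
lra.
Qed.

End Sides.

(** * The two sides of a loop at a regular point are separated *)

Section SideContra.
Variable R : realType.
Implicit Types (u v w x y p q : R * R) (A f Q Z : R -> R * R).

Definition off_loop A (l h : R) Z1 Z2 x :=
  [/\ forall s, l <= s <= h -> A s <> x, forall t, 0 <= t <= 1 -> Z1 t <> x
    & forall t, 0 <= t <= 1 -> Z2 t <> x].

(** Up to scale, coordinates in which the tangent [p] is horizontal and its left is up. *)
Definition frame p u := (dot p u, det p u).

Lemma frame_cts p f (t : R) : cts_at f t -> cts_at (frame p \o f) t.
Proof.
move=> Hf e e0; have k0 : 0 < 2 * `|p| + 1 by apply: ltr_wpDl; rewrite ?mulr_ge0.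
have [d d0 Hd] := Hf (e / (2 * `|p| + 1)) (divr_gt0 e0 k0).
exists d => // t' /Hd; rewrite ltr_pdivlMr // => H.
apply: le_lt_trans H; apply: (@le_trans _ _ (2 * `|p| * `|f t' - f t|)).
  by apply: norm_pair_leI; rewrite /= -?dotBr -?detBr ?dot_norm_le ?det_norm_le.
by rewrite mulrC ler_wpM2l //; lra.
Qed.

Lemma frame_inj p : p != 0 -> injective (frame p).
Proof.
move=> p0 x y [] /eqP; rewrite -subr_eq0 -dotBr => /eqP e1 /eqP.
rewrite -subr_eq0 -detBr => /eqP e2.
by apply/eqP; rewrite -subr_eq0; apply/eqP; apply: dot_det_eq0 e1 e2.
Qed.

Lemma seg_bounds (F : R * R -> R) (a b : R) x y (t : R) : 0 <= t <= 1 ->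
  (forall u v (s : R), F (seg u v s) = F u + s * (F v - F u)) ->
  a < F x < b -> a < F y < b -> a < F (seg x y t) < b.
Proof.
move=> /andP[t0 t1] FE /andP[ax xb] /andP[ay yb]; rewrite FE.
have t1' : 0 <= 1 - t by lra.
case: (lerP (F x) (F y)) => xy.
  have d0 : 0 <= F y - F x by lra.
  by have := mulr_ge0 t0 d0; have := mulr_ge0 t1' d0; lra.
have d0 : 0 <= F x - F y by lra.
by have := mulr_ge0 t0 d0; have := mulr_ge0 t1' d0; lra.
Qed.

Lemma seg_norm_lt x y z (n t : R) : 0 <= t <= 1 -> `|x - z| < n -> `|y - z| < n ->
  `|seg x y t - z| < n.
Proof.
move=> t01; have := seg_normB x y z t01; case/andP: t01 => t0 t1.
set a := `|x - z|; set b := `|y - z| => /le_lt_trans H an bn; apply: H.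
have t1' : 0 <= 1 - t by rewrite subr_ge0.
case: (lerP a b) => ab.
  have d0 : 0 <= b - a by rewrite subr_ge0.
  by have := mulr_ge0 t1' d0; move: bn; clear; lra.
have d0 : 0 <= a - b by rewrite subr_ge0 ltW.
by have := mulr_ge0 t0 d0; move: an; clear; lra.
Qed.

Lemma dot_seg p u v (s : R) : dot p (seg u v s) = dot p u + s * (dot p v - dot p u).
Proof. by rewrite /seg dotDr dotZr dotBr. Qed.

(** In the frame of the tangent at [A c], the segment from [Q e], on the left, down to a point on
    the right can meet the loop only along the short arc [A[c - r, c + r]], which passes below its
    upper end and above its lower end. Hence [loop_crossed_once] applies. *)
Lemma right_side_not_joined A (l h c : R) Z1 Z2 Q q (p := derive1 A c) :
  C1 A -> p != 0 -> l < c < h -> path01 Z1 -> path01 Z2 ->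
  Z1 0 = A h -> Z1 1 = Z2 0 -> Z2 1 = A l ->
  (forall s, l <= s <= h -> A s = A c -> s = c) ->
  (forall t, 0 <= t <= 1 -> Z1 t <> A c) -> (forall t, 0 <= t <= 1 -> Z2 t <> A c) ->
  leaves Q (A c) q -> 0 < det p q ->
  (exists2 e0 : R, 0 < e0 & forall e r, 0 < e < e0 -> 0 < r < e0 ->
     joined (off_loop A l h Z1 Z2) (Q e) (A c + r *: rgt A c)) -> False.
Proof.
move=> CA p0 /andP[lc ch] Z1c Z2c Z1h Z12 Z2l injA Z1A Z2A [Q0 dQ] b0 [e0 e00 J].
have D0 := dot_gt0 p0; have np : 0 < `|p| by rewrite normr_gt0.
pose D := dot p p; pose a : R := `|dot p q|; pose b := det p q.
have a0 : 0 <= a := normr_ge0 _.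
have ab0 : 0 < a + b by rewrite ltr_wpDl.
(* With [e = th * r], the point [Q e] drifts along the tangent by at most [r * D / 4], so it stays
   above the short arc. *)
have [th th0 thE] : exists2 th : R, 0 < th & th * (a + b) = D / 4.
  exists (D / (4 * (a + b))); first by rewrite divr_gt0 // mulr_gt0.
  by field; rewrite gt_eqF.
have [k k0 /= /and3P[/ltW kb /ltW kD _]] := @lower_bound_pos R [:: th * b / 4; D / 4]
  ltac:(by rewrite /= !divr_gt0 // mulr_gt0).
have [d d0 Hd] := C1_local_increment CA p0 k0.
have [d1 d10 Hd1] := dQ (b / (4 * `|p|)) ltac:(by rewrite divr_gt0 // mulr_gt0).
have [n1 n10 Hn1] := near_value_near_time (A c) (a := l) (b := h) (fun t _ => C1_cts t CA) d0.
have [n2 n20 Hn2] := near_value_near_time (A c) Z1c (@ltr01 R).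
have [n3 n30 Hn3] := near_value_near_time (A c) Z2c (@ltr01 R).
have [n n0 /= /and4P[/ltW nn1 /ltW nn2 /ltW nn3 _]] := @lower_bound_pos R [:: n1; n2; n3]
  ltac:(by rewrite /= n10 n20 n30).
pose K := th * (`|q| + b / (4 * `|p|)) + `|rgt A c| + 1.
have qq0 : 0 <= th * (`|q| + b / (4 * `|p|)).
  by apply: mulr_ge0; [exact: ltW|rewrite addr_ge0 // divr_ge0 ?ltW // mulr_gt0].
have K0 : 0 < K by exact: ltr_wpDl (addr_ge0 qq0 (normr_ge0 _)) ltr01.
have cl0 : 0 < c - l by rewrite subr_gt0.
have hc0 : 0 < h - c by rewrite subr_gt0.
have [r r0] := @lower_bound_pos R [:: d; d1 / th; e0; e0 / th; n / K; c - l; h - c]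
  ltac:(by rewrite /= d0 e00 cl0 hc0 (divr_gt0 d10 th0) (divr_gt0 e00 th0) (divr_gt0 n0 K0)).
rewrite /= !ltr_pdivlMr // => /and5P[rd rd1 re re' /and4P[rn rl rh _]].
pose e : R := th * r.
have e_gt0 : 0 < e by rewrite mulr_gt0.
pose u0 := Q e - A c.
have Hu : `|u0 - e *: q| <= b / (4 * `|p|) * e by apply: Hd1; rewrite ltW //= /e mulrC.
have pb : 2 * `|p| * (b / (4 * `|p|) * e) = b * e / 2.
  by field; rewrite gt_eqF.
have h1 : 2 * `|p| * `|u0 - e *: q| <= b * e / 2.
  by rewrite -pb ler_wpM2l // mulr_ge0 // ltW.
have detu : b * e / 2 <= det p u0.
  have := le_trans (det_norm_le p (u0 - e *: q)) h1.
  rewrite detBr detZr -/b ler_norml => /andP[g1 _].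
  by clear -g1; lra.
have dotu : `|dot p u0| <= r * D / 4.
  have := le_trans (dot_norm_le p (u0 - e *: q)) h1; rewrite dotBr dotZr => h2.
  have := ler_normD (dot p u0 - e * dot p q) (e * dot p q).
  rewrite subrK normrM (gtr0_norm e_gt0) -/a => /le_trans; apply.
  have -> : r * D / 4 = r * (th * (a + b)) by rewrite thE mulrA.
  have hb : 0 < th * r * b by rewrite mulr_gt0.
  by move: h2 hb; rewrite /e; clear; lra.
have nu : `|u0| <= r * (th * (`|q| + b / (4 * `|p|))).
  have := ler_normD (u0 - e *: q) (e *: q); rewrite subrK normrZ (gtr0_norm e_gt0).
  by move: Hu; rewrite /e; clear; lra.
have nu' : `|Q e - A c| < n.
  rewrite -/u0; apply: le_lt_trans nu _; apply: le_lt_trans rn.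
  rewrite ler_wpM2l ?(ltW r0) // /K -addrA lerDl.
  by rewrite addr_ge0 ?normr_ge0.
pose x1 := A c + r *: rgt A c.
have x1E : x1 - A c = r *: rgt A c by rewrite /x1 addrC addKr.
have nx1 : `|x1 - A c| < n.
  rewrite x1E normrZ (gtr0_norm r0); apply: le_lt_trans rn.
  by rewrite ler_wpM2l ?(ltW r0) // /K -addrA addrCA lerDl addr_ge0.
pose K0' := seg (Q e) x1.
have nk t : 0 <= t <= 1 -> `|K0' t - A c| < n.
  by move=> t01; apply: seg_norm_lt.
have dk t : 0 <= t <= 1 -> dot p (A c) - r * D / 2 < dot p (K0' t) < dot p (A c) + r * D / 2.
  have rD : 0 < r * D by rewrite mulr_gt0.
  move=> t01; apply: (seg_bounds t01 (dot_seg p)).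
    by move: dotu rD; rewrite ler_norml /u0 dotBr; clear; lra.
  by have := dot_rgt A c; rewrite /x1 dotDr dotZr -/p => ->; move: rD; clear; lra.
have ccd : `|c - c| < d by rewrite subrr normr0.
have crd : `|c - r - c| < d by rewrite addrAC subrr sub0r normrN gtr0_norm.
have crd' : `|c + r - c| < d by rewrite addrAC subrr add0r gtr0_norm.
(* The segment stays in the strip of half-width [r * D / 2] along the tangent, which [A] has left at
   time distance [r] from [c]. *)
have As s : `|s - c| < d -> r <= `|s - c| ->
   (dot p (A s) <= dot p (A c) - r * D / 2) || (dot p (A c) + r * D / 2 <= dot p (A s)).
  move=> sd rs; have [_ H _] := Hd c s ccd sd.
  move: H; rewrite dotBr -/D.
  have D4 : k * `|s - c| <= D / 4 * `|s - c| by rewrite ler_wpM2r.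
  move=> /le_trans /(_ D4); rewrite ler_norml => /andP[g1 g2].
  move: rs g1 g2; have [sc|cs] := lerP (s - c) 0.
    rewrite ler0_norm // => rs g1 g2; apply/orP; left.
    have rs0 : 0 <= - (s - c) - r by rewrite subr_ge0.
    by have := mulr_ge0 rs0 (ltW D0); move: g1 g2; rewrite -/D; clear; lra.
  rewrite gtr0_norm // => rs g1 g2; apply/orP; right.
  have rs0 : 0 <= (s - c) - r by rewrite subr_ge0.
  by have := mulr_ge0 rs0 (ltW D0); move: g1 g2; rewrite -/D; clear; lra.
have farA s t : l <= s <= h -> r <= `|s - c| -> 0 <= t <= 1 -> A s <> K0' t.
  move=> slh rs t01 E; have := nk t t01; rewrite -E => lt.
  have [|t0 [t0lh /(injA _ t0lh) -> sd]] := Hn1 s slh; first exact: lt_le_trans nn1.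
  have := dk t t01; rewrite -E => /andP[g1 g2].
  by have /orP[] := As s sd rs; move: g1 g2; clear; lra.
have farZ Z nz t t' : n <= nz -> (forall t, 0 <= t <= 1 -> `|Z t - A c| < nz ->
      exists t0, [/\ 0 <= t0 <= 1, Z t0 = A c & `|t - t0| < 1]) ->
    (forall t, 0 <= t <= 1 -> Z t <> A c) -> 0 <= t <= 1 -> 0 <= t' <= 1 -> Z t <> K0' t'.
  move=> nnz HZ ZA t01 t'01 E; have := nk t' t'01; rewrite -E => lt.
  have [|t0 [t001 /(ZA _ t001) //]] := HZ t t01; exact: lt_le_trans nnz.
have lcr : l < c - r by rewrite ltrBrDr -ltrBrDl.
have rch : c + r < h by rewrite -ltrBrDl.
have crr : c - r < c + r by move: r0; clear; lra.
(* The loop in five arcs, starting with the short one; the default value closes the cycle at index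
   5. *)
pose Cs i := nth (A \o aff (c - r) (c + r)) [:: A \o aff (c - r) (c + r);
   A \o aff (c + r) h; Z1; Z2; A \o aff l (c - r)] i.
apply: (@loop_crossed_once R (frame p) 5 Cs K0').
- by move=> f t; apply: frame_cts.
- exact: frame_inj.
- by [].
- by move=> [|[|[|[|[|//]]]]] _ //; apply: path_aff => t; exact: C1_cts.
- by move=> [|[|[|[|[|//]]]]] _; rewrite /Cs /= ?aff0 ?aff1 ?Z1h ?Z2l.
- by rewrite /Cs /= ?aff0 ?aff1.
- exact: path_seg.
- move=> [|[|[|[|[|//]]]]] s t //= _ s01 t01.
  + have /andP[s1 s2] := aff_itv (ltW rch) s01.
    apply: farA => //; first by move: s1 s2 lc r0; clear; lra.
    by rewrite ger0_norm; move: s1 r0; clear; lra.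
  + exact: farZ Hn2 Z1A s01 t01.
  + exact: farZ Hn3 Z2A s01 t01.
  + have /andP[s1 s2] := aff_itv (ltW lcr) s01.
    apply: farA => //; first by move: s1 s2 ch r0; clear; lra.
    by rewrite ler0_norm; move: s2 r0; clear; lra.
- move=> t t01; rewrite /Cs /= aff0 aff1; have /andP[k1 k2] := dk t t01.
  have [_ H1 _] := Hd c (c - r) ccd crd.
  have [_ H2 _] := Hd c (c + r) ccd crd'.
  move: H1 H2; rewrite !dotBr -/D.
  rewrite [c - r - c]addrAC subrr sub0r [c + r - c]addrAC subrr add0r.
  rewrite normrN (gtr0_norm r0) !ler_norml => /andP[g1 g2] /andP[g3 g4].
  have rk : r * k <= r * (D / 4) by rewrite ler_wpM2l // ltW.
  have rD : 0 < r * D by rewrite mulr_gt0.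
  by move: k1 k2 g1 g2 g3 g4 rk rD; clear; move=> *; apply/andP; split; lra.
- move=> s s01; rewrite /Cs /= /K0' seg0 seg1.
  have /andP[s1 s2] := aff_itv (ltW crr) s01.
  set z := aff _ _ s in s1 s2 *.
  have zc : `|z - c| <= r by rewrite ler_norml; move: s1 s2; clear; lra.
  have [H _ _] := Hd c z ccd (le_lt_trans zc rd).
  have kr : k * `|z - c| <= k * r by rewrite ler_wpM2l // ltW.
  have := le_trans H kr; rewrite detBr ler_norml => /andP[g1 g2].
  have rk : r * k <= r * (D / 4) by rewrite ler_wpM2l // ltW.
  have rk' : r * k <= r * (th * b / 4) by rewrite ler_wpM2l // ltW.
  have rD : 0 < r * D by rewrite mulr_gt0.
  have rb : 0 < r * (th * b) by rewrite mulr_gt0 // mulr_gt0.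
  rewrite /x1 detDr detZr det_rgt -/p -/D; apply/andP; split.
    by move: g1 rk rD; clear; lra.
  by move: detu g2 rk' rb; rewrite /u0 detBr /e; clear; lra.
- rewrite /K0' seg0 seg1.
  have Jr := J e r ltac:(by rewrite e_gt0 /= /e mulrC) ltac:(by rewrite r0).
  apply: joined_mono Jr => x [fA f1 f2] i s im s01.
  by move: i im => [|[|[|[|[|//]]]]] _ /=; [apply: fA|apply: fA|exact: f1|exact: f2|apply: fA];
     have := aff_itv (ltW crr) s01; have := aff_itv (ltW rch) s01;
     have := aff_itv (ltW lcr) s01; move: lc ch lcr rch crr; clear; lra.
Qed.

End SideContra.

(** * Two obstructions: interlaced arcs and a change of side *)

Section Obstructions.
Variable R : realType.
Implicit Types (u v w x y p q : R * R) (A f P Q Z : R -> R * R).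

(** Continuity of the determinant, with a bound homogeneous in [w] so that it survives rescaling. *)
Lemma open_cone p w0 : 0 < det p w0 -> exists2 k : R, 0 < k &
  exists2 e : R, 0 < e & forall w, `|w - w0| <= e -> w != 0 /\ k * `|w| <= det p w.
Proof.
move=> D0; have w00 : 0 < `|w0|.
  by rewrite normr_gt0; apply: contraTneq D0 => ->; rewrite det0r ltxx.
have p0 : 0 < 2 * `|p| + 1 by apply: ltr_wpDl; rewrite ?mulr_ge0.
have [e e0 /= /and3P[ew /ltW eD _]] := @lower_bound_pos R [:: `|w0|; det p w0 / 2 / (2 * `|p| + 1)]
  ltac:(by rewrite /= w00 !divr_gt0).
have ne0 : 0 < `|w0| + e by rewrite addr_gt0.
have k0 : 0 < det p w0 / 2 / (`|w0| + e) by rewrite !divr_gt0.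
exists (det p w0 / 2 / (`|w0| + e)) => //; exists e => // w we; split.
  apply: contraTneq we => ->; rewrite sub0r normrN -ltNge //.
have nw : `|w| <= `|w0| + e.
  by have := ler_normD (w - w0) w0; rewrite subrK; move: we; clear; lra.
have h1 : det p w0 / 2 / (`|w0| + e) * `|w| <= det p w0 / 2.
  by rewrite mulrAC ler_pdivrMr // ler_wpM2l // ltW // divr_gt0.
apply: le_trans h1 _.
have h2 : `|det p (w - w0)| <= 2 * `|p| * e.
  by apply: le_trans (det_norm_le _ _) _; rewrite ler_wpM2l // mulr_ge0.
move: eD; rewrite ler_pdivlMr // => h3.
by move: h2 h3 e0; rewrite detBr ler_norml; clear; move=> /andP[h1 _] h3 e0; lra.
Qed.

Lemma leaves_cone f x p q : leaves f x q -> 0 < det p q ->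
  exists2 k : R, 0 < k & exists2 d : R, 0 < d &
    forall t, 0 <= t < d -> k * `|f t - x| <= det p (f t - x).
Proof.
move=> [f0 Hf] /open_cone [k k0 [e e0 He]].
have [d d0 Hd] := Hf e e0.
exists k => //; exists d => // t /andP[]; rewrite le_eqVlt => /orP[/eqP<- _|t0 td].
  by rewrite f0 subrr det0r normr0 mulr0.
have ft : f t - x = t *: (t^-1 *: (f t - x)) by rewrite scalerA divff ?scale1r ?gt_eqF.
have [|_ H] := He (t^-1 *: (f t - x)).
  have -> : t^-1 *: (f t - x) - q = t^-1 *: (f t - x - t *: q).
    by rewrite [in RHS]scalerBr scalerA mulVf ?scale1r ?gt_eqF.
  rewrite normrZ gtr0_norm ?invr_gt0 // mulrC ler_pdivrMr //.
  by apply: Hd; rewrite ltW.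
rewrite ft detZr normrZ (gtr0_norm t0) mulrCA; apply: ler_wpM2l => //; exact: ltW.
Qed.

Lemma detNl p u : det (- p) u = - det p u.
Proof. by rewrite /det /=; ring. Qed.

Lemma rgt_cts A (t : R) : C1 A -> cts_at (rgt A) t.
Proof.
move=> [_ cA] e e0; have [d d0 Hd] := cA t e e0; exists d => // t' /Hd.
move=> /norm_pair_ltE[h1 h2].
have -> : rgt A t' - rgt A t = ((derive1 A t' - derive1 A t).2, - (derive1 A t' - derive1 A t).1).
  by apply: injective_projections; rewrite /= ?opprB // opprK addrC.
by rewrite prod_normE gt_max /= normrN h1 h2.
Qed.

Lemma rgt_cone A (b : R) (p := derive1 A b) : C1 A -> p != 0 ->
  exists2 k : R, 0 < k & exists2 d : R, 0 < d & forall s, `|s - b| < d ->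
    rgt A s != 0 /\ det p (rgt A s) <= - (k * `|rgt A s|).
Proof.
move=> CA p0; have : 0 < det (- p) (rgt A b).
  by rewrite detNl det_rgt opprK dot_gt0.
move=> /open_cone [k k0 [e e0 He]]; have [d d0 Hd] := rgt_cts b CA e0.
exists k => //; exists d => // s /Hd /ltW /He [h1]; rewrite detNl => h2.
by split=> //; rewrite lerNr.
Qed.

Lemma off_path f x : path01 f -> (forall t, 0 <= t <= 1 -> f t <> x) ->
  exists2 e : R, 0 < e & forall y t, `|y - x| < e -> 0 <= t <= 1 -> f t <> y.
Proof.
move=> fc fx; have [e e0 He] := near_value_near_time x fc (@ltr01 R).
exists e => // y t yx t01 E; have [|t0 [t001 /(fx _ t001)//]] := He t t01.
by rewrite E.
Qed.

Lemma off_loop_open A Z1 Z2 (l h : R) (S := off_loop A l h Z1 Z2) x :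
  C1 A -> path01 Z1 -> path01 Z2 -> S x ->
  exists2 e : R, 0 < e & forall y, `|y - x| < e -> S y.
Proof.
move=> CA Z1c Z2c [Ax Z1x Z2x].
have [e1 e10 H1] := off_path Z1c Z1x; have [e2 e20 H2] := off_path Z2c Z2x.
have [e3 e30 H3] := near_value_near_time x (a := l) (b := h) (fun t _ => C1_cts t CA) (@ltr01 R).
have [e e0 /= /and4P[l1 l2 l3 _]] := @lower_bound_pos R [:: e1; e2; e3] ltac:(by rewrite /= e10 e20 e30).
exists e => // y yx; split=> [s slh E|t t01|t t01].
- have [|s0 [s0lh /(Ax _ s0lh)//]] := H3 s slh; rewrite E; exact: lt_trans l3.
- by apply: H1 t01; exact: lt_trans l1.
- by apply: H2 t01; exact: lt_trans l2.
Qed.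

(** A chord of [A] near [s] has slope at most [k / 2] with respect to the tangent, while [u] has
    slope at least [k] to the right; so [A s' + u] is not on [A]. The closing paths are at a
    positive distance. *)
Lemma off_loop_right A Z1 Z2 (l h : R) (S := off_loop A l h Z1 Z2) s (k : R) (p := derive1 A s) :
  C1 A -> path01 Z1 -> path01 Z2 -> p != 0 -> 0 < k ->
  (forall s', l <= s' <= h -> A s' = A s -> s' = s) ->
  (forall t, 0 <= t <= 1 -> Z1 t <> A s) -> (forall t, 0 <= t <= 1 -> Z2 t <> A s) ->
  exists2 d : R, 0 < d & forall s' u, `|s' - s| < d -> `|u| < d ->
    u != 0 -> det p u <= - (k * `|u|) -> S (A s' + u).
Proof.
move=> CA Z1c Z2c p0 k0 Ainj Z1A Z2A.
have [e1 e10 H1] := off_path Z1c Z1A; have [e2 e20 H2] := off_path Z2c Z2A.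
have [d d0 Hd] := C1_local_increment CA p0 (k := k / 2) ltac:(by rewrite divr_gt0).
have [e3 e30 H3] := near_value_near_time (A s) (a := l) (b := h) (fun t _ => C1_cts t CA) d0.
have [e e0 /= /and4P[l1 l2 l3 _]] := @lower_bound_pos R [:: e1; e2; e3] ltac:(by rewrite /= e10 e20 e30).
have [d' d'0 Hd'] := C1_cts s CA (e := e / 2) ltac:(by rewrite divr_gt0).
have [m m0 /= /and4P[md md' me _]] := @lower_bound_pos R [:: d; d'; e / 2] ltac:(by rewrite /= d0 d'0 divr_gt0).
exists m => // s' u s's um u0 du.
have near : `|A s' + u - A s| < e.
  have := ler_normD (A s' - A s) u; rewrite addrAC.
  by have := Hd' _ (lt_trans s's md'); move: um me; clear; lra.
split=> [s'' s''lh E|t t01|t t01].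
- have [|s0 [s0lh /(Ainj _ s0lh)-> s''s]] := H3 s'' s''lh; first by rewrite E; exact: lt_trans l3.
  have [_ _] := Hd s' s'' (lt_trans s's md) s''s; rewrite E addrAC subrr add0r -/p => H.
  have : 0 < `|u| by rewrite normr_gt0.
  by move: H; rewrite ler_norml => /andP[g1 _]; move: g1 du k0; clear => *; nra.
- by apply: H1 t01; exact: lt_trans l1.
- by apply: H2 t01; exact: lt_trans l2.
Qed.

(** Pushes the whole arc to its right by one common small [r], which compactness provides. *)
Lemma parallel_joined A (S : R * R -> Prop) (c e : R) : C1 A -> c <= e ->
  (forall s, c <= s <= e -> exists2 d : R, 0 < d & forall r s', 0 < r < d ->
     `|s' - s| < d -> c <= s' <= e -> S (A s' + r *: rgt A s')) ->
  exists2 d : R, 0 < d & forall r, 0 < r < d ->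
    joined S (A e + r *: rgt A e) (A c + r *: rgt A c).
Proof.
move=> CA ce H.
have [s /H [d d0 Hd]|d d0 Hd] := @forall_small_segment R c e
  (fun r s => c <= s <= e -> S (A s + r *: rgt A s)).
  by exists d.
exists d => // r rd.
have -> : A e + r *: rgt A e = ((fun t => A t + r *: rgt A t) \o aff e c) 0 by rewrite /= aff0.
have -> : A c + r *: rgt A c = ((fun t => A t + r *: rgt A t) \o aff e c) 1 by rewrite /= aff1.
apply: joined_path.
  apply: path_aff => t; apply: cts_atD; first exact: C1_cts.
  by apply: cts_atZ; exact: rgt_cts.
move=> t t01 /=; have : c <= aff e c t <= e.
  move: ce t01; rewrite /aff; clear => ce /andP[t0 t1].
  have ce0 : 0 <= e - c by rewrite subr_ge0.
  have t1' : 0 <= 1 - t by rewrite subr_ge0.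
  by have := mulr_ge0 t0 ce0; have := mulr_ge0 t1' ce0 => *; apply/andP; split; lra.
by move=> ace; apply: (Hd r).
Qed.

Lemma rgt_right_of_cone A (s : R) (p := derive1 A s) : C1 A -> p != 0 ->
  exists2 k : R, 0 < k & forall d0 : R, 0 < d0 -> exists2 d : R, 0 < d & forall r s', 0 < r < d -> `|s' - s| < d ->
    [/\ `|s' - s| < d0, `|r *: rgt A s'| < d0, r *: rgt A s' != 0 &
        det p (r *: rgt A s') <= - (k * `|r *: rgt A s'|)].
Proof.
move=> CA p0; have [k k0 [d d1 Hd]] := rgt_cone CA p0.
exists k => // d0 d00.
have [d' d'0 Hd'] := rgt_cts s CA (@ltr01 R).
pose n := `|rgt A s| + 1; have n0 : 0 < n by rewrite /n; apply: ltr_wpDl.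
have [m m0 /= /and5P[md md' md0 mn _]] := @lower_bound_pos R [:: d; d'; d0; d0 / n] ltac:(by rewrite /= d1 d'0 d00 divr_gt0).
exists m => // r s' /andP[r0 rm] s's.
have [h1 h2] := Hd s' (lt_trans s's md).
split; first exact: lt_trans md0.
- rewrite normrZ (gtr0_norm r0).
  have h3 : `|rgt A s'| <= n.
    rewrite -[rgt A s'](subrK (rgt A s)); apply: le_trans (ler_normD _ _) _.
    by rewrite addrC lerD2l; apply/ltW/Hd'/(lt_trans s's md').
  apply: le_lt_trans (_ : r * n < _); first by rewrite ler_wpM2l // ltW.
  by rewrite -ltr_pdivlMr //; exact: lt_trans mn.
- by rewrite scaler_eq0 negb_or gt_eqF.
- by rewrite detZr normrZ (gtr0_norm r0) mulrCA -mulrN ler_wpM2l // ltW.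
Qed.


(* [P] and [Q] leave the arc [A[a, d]] on the same side, at [b] and [c]. *)
Lemma no_interlaced_arcs A (a b c d : R) P1 P2 Q1 Q2 q q' :
  C1 A -> (forall s, a <= s <= d -> derive1 A s != 0) -> a < c -> c < b -> b < d ->
  (forall s s', a <= s <= d -> a <= s' <= d -> A s = A s' -> s = s') ->
  path01 P1 -> path01 P2 -> path01 Q1 -> path01 Q2 ->
  P1 1 = P2 0 -> P2 1 = A a -> Q1 1 = Q2 0 -> Q2 1 = A d ->
  (forall t s, 0 <= t <= 1 -> a <= s <= d -> P1 t = A s -> t = 0 \/ s = a) ->
  (forall t s, 0 <= t <= 1 -> a <= s <= d -> P2 t = A s -> s = a) ->
  (forall t s, 0 <= t <= 1 -> a <= s <= d -> Q1 t = A s -> t = 0 \/ s = d) ->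
  (forall t s, 0 <= t <= 1 -> a <= s <= d -> Q2 t = A s -> s = d) ->
  (forall t t', 0 <= t <= 1 -> 0 <= t' <= 1 ->
     [/\ P1 t <> Q1 t', P1 t <> Q2 t', P2 t <> Q1 t' & P2 t <> Q2 t']) ->
  leaves P1 (A b) q -> 0 < det (derive1 A b) q ->
  leaves Q1 (A c) q' -> 0 < det (derive1 A c) q' -> False.
Proof.
move=> CA A0 ac cb bd Ainj P1c P2c Q1c Q2c P12 P2a Q12 Q2d P1A P2A Q1A Q2A PQ lP dP lQ dQ.
have P10 := lP.1; have Q10 := lQ.1.
have [b0 c0] : a <= b <= d /\ a <= c <= d by move: ac cb bd; clear; lra.
have sub s : a <= s <= b -> a <= s <= d by move: bd; clear; lra.
pose S := off_loop A a b P1 P2.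
have Sright s : b < s -> s <= d -> S (A s).
  move=> bs sd; have s0 : a <= s <= d by move: ac cb bs sd; clear; lra.
  split=> [s' s'ab /(Ainj _ _ (sub _ s'ab) s0) E|t t01 E|t t01 /(P2A _ _ t01 s0) E].
  - by move: s'ab bs; rewrite E; clear; lra.
  - have [E'|E'] := P1A _ _ t01 s0 E; last by move: ac cb bs; rewrite E'; clear; lra.
    by move: E; rewrite E' P10 => /(Ainj _ _ b0 s0) E''; move: bs; rewrite E'' ltxx.
  - by move: ac cb bs; rewrite E; clear; lra.
(* At the corner [A b] the loop turns off to the left, so the right of [A] and the continuation of
   [A] past [b] are both free. *)
have [d1 d10 corner] : exists2 d1 : R, 0 < d1 & forall s r, `|s - b| < d1 -> a <= s <= d ->
   0 <= r < d1 -> (0 < r) || (b < s) -> S (A s + r *: rgt A s).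
  have pb := A0 b b0.
  have [k1 k10 [e1 e10 cone1]] := leaves_cone lP dP.
  have [k2 k20 cone2] := rgt_right_of_cone CA pb.
  have [k k0 /= /and3P[kk1 kk2 _]] := @lower_bound_pos R [:: k1; k2] ltac:(by rewrite /= k10 k20).
  have [d2 d20 inc] := C1_local_increment CA pb k0.
  have [n1 n10 H1] := near_value_near_time (A b) (a := a) (b := b) (fun t _ => C1_cts t CA) d20.
  have [n2 n20 H2] := near_value_near_time (A b) P1c e10.
  have [|n3 n30 H3] := @off_path P2 (A b) P2c.
    by move=> t t01 /(P2A _ _ t01 b0) E; move: ac cb; rewrite E; clear; lra.
  have [n n0 /= /and4P[nn1 nn2 nn3 _]] := @lower_bound_pos R [:: n1; n2; n3] ltac:(by rewrite /= n10 n20 n30).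
  have [d3 d30 Hd3] := C1_cts b CA (e := n / 2) ltac:(by rewrite divr_gt0).
  have [d4 d40 Hd4] := cone2 (n / 2) ltac:(by rewrite divr_gt0).
  have [m m0 /= /and4P[md2 md3 md4 _]] := @lower_bound_pos R [:: d2; d3; d4] ltac:(by rewrite /= d20 d30 d40).
  exists m => // s r sm sad /andP[r0 rm] rs.
  pose u := r *: rgt A s.
  have [un u2 u3] : [/\ `|u| < n / 2, det (derive1 A b) u <= - (k2 * `|u|) & u = 0 -> r = 0].
    move: r0; rewrite le_eqVlt /u => /orP[/eqP<-|r0].
      by rewrite scale0r normr0 det0r mulr0 oppr0 divr_gt0.
    have [|_ h1 h2 h3] := Hd4 r s _ (lt_trans sm md4); first by rewrite r0 (lt_trans rm).
    by split=> // E; move: h2; rewrite E eqxx.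
  have near : `|A s + u - A b| < n.
    rewrite addrAC; apply: le_lt_trans (ler_normD _ _) _.
    by have := Hd3 _ (lt_trans sm md3); move: un; clear; lra.
  have u0 : u <> 0 \/ b < s.
    by case/orP: rs => [r0'|]; [left => /u3 E; rewrite E ltxx in r0'|right].
  have b01 : `|b - b| < d2 by rewrite subrr normr0.
  split=> [s' s'ab E|t t01 E|t t01].
  - have [|x [xab /(Ainj _ _ (sub _ xab) b0)-> s'x]] := H1 s' s'ab.
      by rewrite E; exact: lt_trans nn1.
    have [_ _] := inc s s' (lt_trans sm md2) s'x.
    rewrite E addrAC subrr add0r ler_norml => /andP[g1 _].
    have : u = 0.
      apply/eqP; rewrite -normr_le0.
      have g2 : k2 * `|u| <= k * `|u| by move: g1 u2; clear; lra.
      rewrite -(@pmulr_rle0 _ (k2 - k)) ?subr_gt0 // mulrBl subr_le0 //.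
    move=> u00; move: E; rewrite -/u u00 addr0 => /(Ainj _ _ (sub _ s'ab) sad) E.
    by case: u0 => // bs; move: s'ab bs; rewrite E; clear; lra.
  - have [|t0 [t001 /(P1A _ _ t001 b0) t0E tt0]] := H2 t t01; first by rewrite E; exact: lt_trans nn2.
    have t00 : t0 = 0 by case: t0E => // ba; move: ac cb; rewrite ba; clear; lra.
    have te1 : 0 <= t < e1.
      move: t01 tt0; rewrite t00 subr0; clear => /andP[h _].
      by rewrite ger0_norm // => ->; rewrite h.
    have := cone1 t te1; rewrite E addrAC detDr -/u.
    have [_ _] := inc b s b01 (lt_trans sm md2).
    (* [P1 t - A b] is [al + u]. It lies in a cone on the left, while [al] is almost tangent and [u]
       lies in a cone on the right; this forces both [u] and [al + u] to vanish. *)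
    set al := A s - A b; rewrite ler_norml => /andP[_ g1] g2.
    have g3 : `|al| <= `|al + u| + `|u|.
      by have := ler_normB (al + u) u; rewrite addrK.
    have nn : 0 <= `|al + u| /\ 0 <= `|u| by rewrite !normr_ge0.
    have g4 : k * `|al| <= k * (`|al + u| + `|u|) by rewrite ler_wpM2l // ltW.
    have g5 : (k1 - k) * `|al + u| + (k2 - k) * `|u| <= 0.
      by move: g1 g2 g4 u2; clear; lra.
    have g6 : 0 <= (k1 - k) * `|al + u| by apply: mulr_ge0; [rewrite subr_ge0 ltW|exact: nn.1].
    have g7 : 0 <= (k2 - k) * `|u| by apply: mulr_ge0; [rewrite subr_ge0 ltW|exact: nn.2].
    have z1 : u = 0.
      apply/eqP; rewrite -normr_le0 -(@pmulr_rle0 _ (k2 - k)) ?subr_gt0 //.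
      by move: g5 g6; clear; lra.
    have z2 : al + u = 0.
      apply/eqP; rewrite -normr_le0 -(@pmulr_rle0 _ (k1 - k)) ?subr_gt0 //.
      by move: g5 g7; clear; lra.
    case: u0 => // bs; move: z2; rewrite z1 addr0 => /eqP; rewrite subr_eq0 => /eqP.
    by move=> /(Ainj _ _ sad b0) E'; move: bs; rewrite E' ltxx.
  - by apply: H3 t01; exact: lt_trans nn3.
have [b' bb' [b'd b'd1]] : exists2 b' : R, b < b' & b' < d /\ `|b' - b| < d1.
  have [m m0 /= /and3P[m1 m2 _]] := @lower_bound_pos R [:: d1; d - b]
    ltac:(by rewrite /= d10 subr_gt0 bd).
  exists (b + m); first by rewrite ltrDl.
  by rewrite addrAC subrr add0r gtr0_norm // m1 -ltrBrDl m2.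
have cb' : c <= b' by rewrite ltW // (lt_trans cb).
have [s /andP[cs sb']|d2 d20 par] := @parallel_joined A S c b' CA cb'.
  have sad : a <= s <= d by move: ac cs sb' b'd; clear; lra.
  have a_lt_s : a < s by exact: lt_le_trans cs.
  have [sb|bs|->] := ltgtP s b.
  - have [k k0 cone] := rgt_right_of_cone CA (A0 s sad).
    have [|||e e0 He] := @off_loop_right A P1 P2 a b s k CA P1c P2c (A0 s sad) k0.
    + by move=> s' s'ab; apply: Ainj (sub _ s'ab) sad.
    + move=> t t01 E; have [t0|E'] := P1A t s t01 sad E.
        move: E; rewrite t0 P10 => /(Ainj _ _ b0 sad) E'.
        by move: sb; rewrite E' ltxx.
      by move: a_lt_s; rewrite E' ltxx.
    + move=> t t01 /(P2A _ _ t01 sad) E'.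
      by move: a_lt_s; rewrite E' ltxx.
    have [e' e'0 He'] := cone _ e0; exists e' => // r s' rd s's _.
    have [h1 h2 h3 h4] := He' r s' rd s's; exact: He.
  - have [e e0 He] := off_loop_open CA P1c P2c (Sright s bs (le_trans sb' (ltW b'd))).
    have [k k0 cone] := rgt_right_of_cone CA (A0 s sad).
    have [e1 e10 He1] := C1_cts s CA (e := e / 2) ltac:(by rewrite divr_gt0).
    have [e2 e20 He2] := cone (e / 2) ltac:(by rewrite divr_gt0).
    have [m m0 /= /and3P[m1 m2 _]] := @lower_bound_pos R [:: e1; e2] ltac:(by rewrite /= e10 e20).
    exists m => // r s' /andP[r0 rm] s's _; apply: He.
    have [|_ h1 _ _] := He2 r s' _ (lt_trans s's m2); first by rewrite r0 (lt_trans rm).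
    have h2 := He1 s' (lt_trans s's m1).
    by rewrite addrAC; apply: le_lt_trans (ler_normD _ _) _; move: h1 h2; clear; lra.
  - exists d1 => // r s' /andP[r0 rd] s's cs'; apply: corner => //.
    + by move: cs' ac b'd; clear; lra.
    + by rewrite ltW.
    + by rewrite r0.
apply: (@right_side_not_joined R A a b c P1 P2 Q1 q') => //.
- exact: A0.
- by rewrite ac cb.
- by move=> s sab; apply: Ainj (sub _ sab) c0.
- move=> t t01 E; have [t0|E'] := P1A t c t01 c0 E.
    move: E; rewrite t0 P10 => /(Ainj _ _ b0 c0) E'.
    by move: cb; rewrite E' ltxx.
  by move: ac; rewrite E' ltxx.
- move=> t t01 /(P2A _ _ t01 c0) E'.
  by move: ac; rewrite E' ltxx.
have [m m0 /= /and4P[m1 m2 m3 _]] := @lower_bound_pos R [:: 1; d1; d2] ltac:(by rewrite /= ltr01 d10 d20).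
exists m => // e r /andP[e0 em] /andP[r0 rm].
have em1 : e <= 1 by rewrite ltW // (lt_trans em).
(* The route off the loop: along [Q1] and [Q2] to [A d], back along [A] to [A b'] just after the
   corner, then across to the right of [A] and parallel to it past the corner back to [A c]. *)
apply: (@joined_trans _ _ _ (Q1 1)).
  have := @joined_path R S (Q1 \o aff e 1); rewrite /= aff0 aff1; apply.
    move=> t t01; apply: cts_at_comp; first exact: cts_at_aff.
    by apply: Q1c; have /andP[h1 h2] := aff_itv em1 t01; move: h1 h2 e0; clear; lra.
  move=> t t01; have /andP[h1 h2] := aff_itv em1 t01.
  have h01 : 0 <= aff e 1 t <= 1 by move: h1 h2 e0; clear; lra.
  split=> [s sab /esym E|t' t'01|t' t'01] /=; last 2 first.
  - by have [] := PQ t' _ t'01 h01.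
  - by have [] := PQ t' _ t'01 h01.
  have [E'|E'] := Q1A _ s h01 (sub _ sab) E.
    by move: h1 e0; rewrite E'; clear; lra.
  by move: sab bd; rewrite E'; clear; lra.
rewrite Q12; apply: (@joined_trans _ _ _ (Q2 1)).
  apply: joined_path => // t t01; split=> [s sab /esym E|t' t'01|t' t'01]; last 2 first.
  - by have [] := PQ t' _ t'01 t01.
  - by have [] := PQ t' _ t'01 t01.
  by have E' := Q2A _ s t01 (sub _ sab) E; move: sab bd; rewrite E'; clear; lra.
rewrite Q2d; apply: (@joined_trans _ _ _ (A b')).
  have := @joined_path R S (A \o aff d b'); rewrite /= aff0 aff1; apply.
    by apply: path_aff => t; exact: C1_cts.
  move=> t t01; have t01' : 0 <= 1 - t <= 1 by move: t01; clear; lra.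
  have -> : aff d b' t = aff b' d (1 - t) by rewrite /aff; ring.
  have /andP[h1 h2] := aff_itv (ltW b'd) t01'.
  by apply: Sright => //; exact: lt_le_trans h1.
apply: (@joined_trans _ _ _ (A b' + r *: rgt A b')); last by apply: par; rewrite r0 (lt_trans rm).
have := @joined_path R S (fun t => A b' + (r * t) *: rgt A b').
rewrite mulr0 scale0r addr0 mulr1; apply.
  move=> t _; apply: (@lipschitz_cts_at _ _ _ _ (r * `|rgt A b'|)) => t'.
  rewrite opprD addrACA subrr add0r -scalerBl -mulrBr normrZ normrM (gtr0_norm r0).
  by rewrite mulrAC.
move=> t /andP[t0 t1]; apply: corner => //.
- by move: ac cb bb' b'd; clear; lra.
- rewrite mulr_ge0 ?(ltW r0) //=; apply: le_lt_trans (_ : r < _); last exact: lt_trans m2.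
  by rewrite -[leRHS]mulr1 ler_wpM2l // ltW.
- by rewrite bb' orbT.
Qed.

(* [Q] runs from [A c] to [A e] off a loop through the arc [A[l, h]]; it can not
   leave to the left and arrive from the right. *)
Lemma no_side_change A (l c e h : R) Z1 Z2 Q q q' :
  C1 A -> (forall s, c <= s <= e -> derive1 A s != 0) -> l < c -> c < e -> e < h ->
  (forall s s', c <= s <= e -> l <= s' <= h -> A s' = A s -> s' = s) ->
  path01 Z1 -> path01 Z2 -> path01 Q ->
  Z1 0 = A h -> Z1 1 = Z2 0 -> Z2 1 = A l ->
  (forall t s, 0 <= t <= 1 -> c <= s <= e -> Z1 t <> A s) ->
  (forall t s, 0 <= t <= 1 -> c <= s <= e -> Z2 t <> A s) ->
  (forall t s, 0 <= t <= 1 -> l <= s <= h -> Q t = A s -> t = 0 \/ t = 1) ->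
  (forall t t', 0 <= t <= 1 -> 0 <= t' <= 1 -> Z1 t <> Q t' /\ Z2 t <> Q t') ->
  leaves Q (A c) q -> 0 < det (derive1 A c) q ->
  leaves (fun t => Q (1 - t)) (A e) q' -> det (derive1 A e) q' < 0 -> False.
Proof.
move=> CA A0 lc ce eh Ainj Z1c Z2c Qc Z1h Z12 Z2l Z1A Z2A QA ZQ lQ dQ lQ' dQ'.
pose S := off_loop A l h Z1 Z2.
have ce' : c <= c <= e by rewrite lexx ltW.
have ee : c <= e <= e by rewrite lexx ltW.
have [d1 d10 par] := @parallel_joined A S c e CA (ltW ce) ltac:(
  move=> s sce; have [k k0 cone] := rgt_right_of_cone CA (A0 s sce);
  have [d d0 Hd] := @off_loop_right A Z1 Z2 l h s k CA Z1c Z2c (A0 s sce) k0 (fun s' => Ainj s s' sce)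
    (fun t t01 => Z1A t s t01 sce) (fun t t01 => Z2A t s t01 sce);
  have [d' d'0 Hd'] := cone _ d0;
  by exists d' => // r s' rd s's _; have [h1 h2 h3 h4] := Hd' r s' rd s's; apply: Hd).
have [k1 k10 [e1 e10 cone1]] := @leaves_cone _ _ (- derive1 A e) _ lQ' ltac:(by rewrite detNl oppr_gt0).
have [k2 k20 cone2] := rgt_right_of_cone CA (A0 e ee).
have [k k0 /= /and3P[/ltW kk1 /ltW kk2 _]] := @lower_bound_pos R [:: k1; k2] ltac:(by rewrite /= k10 k20).
have [d2 d20 right] := @off_loop_right A Z1 Z2 l h e k CA Z1c Z2c (A0 e ee) k0 (fun s' => Ainj e s' ee)
    (fun t t01 => Z1A t e t01 ee) (fun t t01 => Z2A t e t01 ee).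
have [d3 d30 Hd3] := cone2 _ d20.
have Qe : Q 1 = A e by rewrite -lQ'.1 subr0.
have [d4 d40 Hd4] := Qc 1 ltac:(by rewrite ler01 lexx) d2 d20.
apply: (@right_side_not_joined R A l h c Z1 Z2 Q q) => //.
- exact: A0.
- by rewrite lc (lt_trans ce).
- by move=> s; apply: Ainj.
- by move=> t t01; apply: Z1A.
- by move=> t t01; apply: Z2A.
have half0 : 0 < (2 : R)^-1 by rewrite invr_gt0.
have [m m0 /= /and5P[m1 m2 m3 m4 /andP[m5 _]]] := @lower_bound_pos R [:: 2^-1; d1; d3; d4; e1]
  ltac:(by rewrite /= half0 d10 d30 d40 e10).
exists m => // x r /andP[x0 xm] /andP[r0 rm].
have xm' : x <= 1 - m by move: m1 xm; clear; lra.
have Q01 t : x <= t <= 1 - m -> 0 <= t <= 1 by move: x0 m0; clear; lra.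
(* Follow [Q] until just before its end, where it is in a cone on the right of [A e]; then join the
   parallel curve and follow it back to [A c]. *)
apply: (@joined_trans _ _ _ (Q (1 - m))).
  have := @joined_path R S (Q \o aff x (1 - m)); rewrite /= aff0 aff1; apply.
    move=> t t01; apply: cts_at_comp; first exact: cts_at_aff.
    by apply/Qc/Q01/aff_itv.
  move=> t t01; have h01 := aff_itv xm' t01.
  split=> [s slh /esym E|t' t'01|t' t'01] /=; last 2 first.
  - exact: (ZQ t' _ t'01 (Q01 _ h01)).1.
  - exact: (ZQ t' _ t'01 (Q01 _ h01)).2.
  by have [] := QA _ s (Q01 _ h01) slh E; move: h01 x0 m0; clear; lra.
apply: (@joined_trans _ _ _ (A e + r *: rgt A e)); last by apply: par; rewrite r0 (lt_trans rm).
have m01 : 0 <= 1 - m <= 1 by move: m0 m1; clear; lra.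
pose u := Q (1 - m) - A e; pose v := r *: rgt A e.
have u1 : `|u| < d2.
  by rewrite /u -Qe; apply: Hd4; rewrite addrAC subrr sub0r normrN gtr0_norm.
have u0 : u != 0.
  rewrite subr_eq0; apply/eqP => /(QA _ _ m01) [|E|E].
  - by move: lc ce eh; clear; lra.
  - by move: E m1; clear; lra.
  - by move: E m0; clear; lra.
have u2 : det (derive1 A e) u <= - (k * `|u|).
  have := cone1 m ltac:(by rewrite (ltW m0) m5); rewrite detNl -/u.
  have : k * `|u| <= k1 * `|u| by rewrite ler_wpM2r.
  by clear; lra.
have [_ v1 v0 v2'] := Hd3 r e ltac:(by rewrite r0 (lt_trans rm)) ltac:(by rewrite subrr normr0).
have v2 : det (derive1 A e) v <= - (k * `|v|).
  apply: le_trans v2' _; rewrite lerN2; apply: ler_wpM2r => //.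
rewrite -/v in v1 v0 *; clearbody v => {v2'}.
have := @joined_path R S (seg (Q (1 - m)) (A e + v)); rewrite seg0 seg1; apply.
  exact: path_seg.
move=> t t01; have -> : seg (Q (1 - m)) (A e + v) t = A e + seg u v t.
  by apply: injective_projections; rewrite /seg /u /= !scaleE; ring.
have uE : seg u v t = (1 - t) *: u + t *: v.
  by apply: injective_projections; rewrite /seg /= !scaleE; ring.
case/andP: (t01) => t0 t1; have t1' : 0 <= 1 - t by rewrite subr_ge0.
(* The cone on the right is convex, so the whole connecting segment stays in it. *)
have ndet : det (derive1 A e) (seg u v t) <= - (k * `|seg u v t|).
  rewrite uE detDr !detZr.
  have h1 : `|(1 - t) *: u + t *: v| <= (1 - t) * `|u| + t * `|v|.
    by apply: le_trans (ler_normD _ _) _; rewrite !normrZ (ger0_norm t0) (ger0_norm t1').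
  have h2 := ler_wpM2l (ltW k0) h1.
  have h3 := ler_wpM2l t1' u2; have h4 := ler_wpM2l t0 v2.
  by move: h2 h3 h4; clear; lra.
apply: right => //.
- by rewrite subrr normr0.
- by rewrite -[seg u v t]subr0; apply: seg_norm_lt; rewrite ?subr0.
have nd0 : det (derive1 A e) (seg u v t) < 0.
  rewrite uE detDr !detZr.
  have h1 : det (derive1 A e) u < 0.
    by apply: le_lt_trans u2 _; rewrite oppr_lt0 mulr_gt0 // normr_gt0.
  have h2 : det (derive1 A e) v < 0.
    by apply: le_lt_trans v2 _; rewrite oppr_lt0 mulr_gt0 // normr_gt0.
  move: t1 t1' t0 h1 h2; clear; rewrite le_eqVlt => /orP[/eqP-> _ _ _|t1 _ t0 h1 h2].
    by rewrite subrr mul0r add0r mul1r.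
  by rewrite ltr_wnDr ?mulr_ge0_le0 ?(ltW h2) // pmulr_rlt0 ?subr_gt0.
by apply: contraTneq nd0 => ->; rewrite det0r ltxx.
Qed.

End Obstructions.

(** * Removing the choice of side by reflection *)

Section Signs.
Variable R : realType.
Implicit Types (u v w x y p q : R * R) (A B f P Q Z U V : R -> R * R).

Definition flip u := (u.1, - u.2).

Lemma flipK : involutive flip.
Proof. by case=> a b; rewrite /flip /= opprK. Qed.

Lemma det_flip u v : det (flip u) (flip v) = - det u v.
Proof. by rewrite /det /flip /=; ring. Qed.

Lemma normr_flip u v : `|flip u - flip v| = `|u - v|.
Proof. by rewrite !prod_normE /flip /= -opprD normrN. Qed.

Lemma cts_at_flip f t : cts_at f t -> cts_at (flip \o f) t.
Proof.
by move=> H e /H [d d0 Hd]; exists d => // t' /Hd; rewrite /= normr_flip.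
Qed.

Lemma path_flip f : path01 f -> path01 (flip \o f).
Proof. by move=> Hf t /Hf; exact: cts_at_flip. Qed.

Lemma derive1_flip A : (forall t : R, derivable A t 1) ->
  (forall t : R, derivable (flip \o A) t 1) /\ derive1 (flip \o A) = flip \o derive1 A.
Proof.
move=> dA; have H (t : R) : is_derive t 1 (flip \o A) (flip (derive1 A t)).
  have [[d1 e1] [d2 e2]] := (is_derive_pair A t _).1 (derivableP (dA t)).
  rewrite derive1E.
  apply/is_derive_pair; split; first by split.
  rewrite /flip /=; rewrite -e2; apply: DeriveDef; first exact: derivableN.
  exact: deriveN.
by split=> [t|]; [case: (H t)|apply/funext => t; rewrite derive1E; case: (H t)].
Qed.

Lemma C1_flip A : C1 A -> C1 (flip \o A).
Proof.
move=> [dA cA]; have [h1 h2] := derive1_flip dA.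
split; first exact: h1.
by move=> t; rewrite h2; exact: (cts_at_flip (cA t)).
Qed.

Lemma leaves_flip f x q : leaves f x q -> leaves (flip \o f) (flip x) (flip q).
Proof.
move=> [f0 Hf]; split=> [|e /Hf [d d0 Hd]]; first by rewrite /= f0.
exists d => // t /Hd.
have -> : flip (f t) - flip x - t *: flip q = flip (f t - x - t *: q) - flip 0.
  by apply: injective_projections; rewrite /= ?subr0 // ?oppr0 ?subr0 !scaleE; ring.
by rewrite normr_flip subr0.
Qed.

Lemma flip_neq0 u : u != 0 -> flip u != 0.
Proof.
apply: contra => /eqP E; rewrite -(flipK u) E; apply/eqP.
by apply: injective_projections; rewrite /= ?oppr0.
Qed.

Lemma flip_inj : injective flip.
Proof. exact: can_inj flipK. Qed.

Lemma mulr_gt0_cases (a b : R) : 0 < a * b -> 0 < a /\ 0 < b \/ a < 0 /\ b < 0.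
Proof.
have [a0|a0|<-] := ltgtP 0 a; last by rewrite mul0r ltxx.
  by rewrite pmulr_rgt0 //; left.
by rewrite nmulr_rgt0 //; right.
Qed.

Lemma mulr_lt0_cases (a b : R) : a * b < 0 -> 0 < a /\ b < 0 \/ a < 0 /\ 0 < b.
Proof.
have [a0|a0|<-] := ltgtP 0 a; last by rewrite mul0r ltxx.
  by rewrite pmulr_rlt0 //; left.
by rewrite nmulr_rlt0 //; right.
Qed.

(** If both arcs leave on the right, the reflection [flip] exchanges left and right. *)
Lemma no_interlaced_arcs_signed A (a b c d : R) P1 P2 Q1 Q2 q q' :
  C1 A -> (forall s, a <= s <= d -> derive1 A s != 0) -> a < c -> c < b -> b < d ->
  (forall s s', a <= s <= d -> a <= s' <= d -> A s = A s' -> s = s') ->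
  path01 P1 -> path01 P2 -> path01 Q1 -> path01 Q2 ->
  P1 1 = P2 0 -> P2 1 = A a -> Q1 1 = Q2 0 -> Q2 1 = A d ->
  (forall t s, 0 <= t <= 1 -> a <= s <= d -> P1 t = A s -> t = 0 \/ s = a) ->
  (forall t s, 0 <= t <= 1 -> a <= s <= d -> P2 t = A s -> s = a) ->
  (forall t s, 0 <= t <= 1 -> a <= s <= d -> Q1 t = A s -> t = 0 \/ s = d) ->
  (forall t s, 0 <= t <= 1 -> a <= s <= d -> Q2 t = A s -> s = d) ->
  (forall t t', 0 <= t <= 1 -> 0 <= t' <= 1 ->
     [/\ P1 t <> Q1 t', P1 t <> Q2 t', P2 t <> Q1 t' & P2 t <> Q2 t']) ->
  leaves P1 (A b) q -> leaves Q1 (A c) q' ->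
  0 < det (derive1 A b) q * det (derive1 A c) q' -> False.
Proof.
move=> CA A0 ac cb bd Ainj P1c P2c Q1c Q2c P12 P2a Q12 Q2d P1A P2A Q1A Q2A PQ lP lQ.
move=> /mulr_gt0_cases [[dP dQ]|[dP dQ]].
  exact: (@no_interlaced_arcs R A a b c d P1 P2 Q1 Q2 q q').
have E := (derive1_flip CA.1).2.
apply: (@no_interlaced_arcs R (flip \o A) a b c d (flip \o P1) (flip \o P2)
  (flip \o Q1) (flip \o Q2) (flip q) (flip q')).
- exact: C1_flip.
- by move=> s sd; rewrite E; apply: flip_neq0; exact: A0.
- exact: ac.
- exact: cb.
- exact: bd.
- by move=> s s' h h' /flip_inj; exact: Ainj.
- exact: path_flip.
- exact: path_flip.
- exact: path_flip.
- exact: path_flip.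
- by rewrite /= P12.
- by rewrite /= P2a.
- by rewrite /= Q12.
- by rewrite /= Q2d.
- by move=> t s h h' /flip_inj; exact: P1A.
- by move=> t s h h' /flip_inj; exact: P2A.
- by move=> t s h h' /flip_inj; exact: Q1A.
- by move=> t s h h' /flip_inj; exact: Q2A.
- by move=> t t' h h'; have [h1 h2 h3 h4] := PQ t t' h h'; split=> /flip_inj.
- exact: (leaves_flip lP).
- by rewrite E /= det_flip oppr_gt0.
- exact: (leaves_flip lQ).
- by rewrite E /= det_flip oppr_gt0.
Qed.

(** Reflection fixes the side of departure, and running [Q] backwards fixes the order of [c] and
    [e]. *)
Lemma no_side_change_signed A (l a b h c e : R) Z1 Z2 Q q q' :
  C1 A -> (forall s, a <= s <= b -> derive1 A s != 0) -> l < a -> b < h ->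
  a <= c <= b -> a <= e <= b -> c != e ->
  (forall s s', a <= s <= b -> l <= s' <= h -> A s' = A s -> s' = s) ->
  path01 Z1 -> path01 Z2 -> path01 Q ->
  Z1 0 = A h -> Z1 1 = Z2 0 -> Z2 1 = A l ->
  (forall t s, 0 <= t <= 1 -> a <= s <= b -> Z1 t <> A s) ->
  (forall t s, 0 <= t <= 1 -> a <= s <= b -> Z2 t <> A s) ->
  (forall t s, 0 <= t <= 1 -> l <= s <= h -> Q t = A s -> t = 0 \/ t = 1) ->
  (forall t t', 0 <= t <= 1 -> 0 <= t' <= 1 -> Z1 t <> Q t' /\ Z2 t <> Q t') ->
  leaves Q (A c) q -> leaves (fun t => Q (1 - t)) (A e) q' ->
  det (derive1 A c) q * det (derive1 A e) q' < 0 -> False.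
Proof.
move=> CA A0 la bh; move: c e Q q q'.
suff H c e Q q q' : a <= c -> c < e -> e <= b ->
    (forall s s', a <= s <= b -> l <= s' <= h -> A s' = A s -> s' = s) ->
    path01 Z1 -> path01 Z2 -> path01 Q ->
    Z1 0 = A h -> Z1 1 = Z2 0 -> Z2 1 = A l ->
    (forall t s, 0 <= t <= 1 -> a <= s <= b -> Z1 t <> A s) ->
    (forall t s, 0 <= t <= 1 -> a <= s <= b -> Z2 t <> A s) ->
    (forall t s, 0 <= t <= 1 -> l <= s <= h -> Q t = A s -> t = 0 \/ t = 1) ->
    (forall t t', 0 <= t <= 1 -> 0 <= t' <= 1 -> Z1 t <> Q t' /\ Z2 t <> Q t') ->
    leaves Q (A c) q -> leaves (fun t => Q (1 - t)) (A e) q' ->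
    det (derive1 A c) q * det (derive1 A e) q' < 0 -> False.
  move=> c e Q q q' /andP[ac cb] /andP[ae eb] + Ainj Z1c Z2c Qc Z1h Z12 Z2l Z1A Z2A QA ZQ lQ lQ' d.
  have rev01 (t : R) : 0 <= t <= 1 -> 0 <= 1 - t <= 1 by clear; lra.
  rewrite neq_lt => /orP[ce|ec]; first exact: (H c e Q q q').
  apply: (H e c (fun t => Q (1 - t)) q' q) => //; last by rewrite mulrC.
  - move=> t t01; apply: (@cts_at_comp _ _ Q (fun t => 1 - t)); last exact/Qc/rev01.
    apply: (@lipschitz_cts_at _ _ _ _ 1) => t'; rewrite mul1r distrC.
    by rewrite (_ : 1 - t - (1 - t') = t' - t) //; ring.
  - move=> t s /rev01 t01 slh /(QA _ _ t01 slh) [E|E]; [right|left]; by move: E; clear; lra.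
  - by move=> t t' t01 /rev01 t'01; exact: ZQ.
  - by under eq_fun do rewrite opprB addrC subrK.
move=> ac ce eb Ainj Z1c Z2c Qc Z1h Z12 Z2l Z1A Z2A QA ZQ lQ lQ' dd.
have sub s : c <= s <= e -> a <= s <= b by move: ac eb; clear; lra.
have lc := lt_le_trans la ac; have eh := le_lt_trans eb bh.
move: dd => /mulr_lt0_cases [[dP dQ]|[dP dQ]].
  apply: (@no_side_change R A l c e h Z1 Z2 Q q q') => //.
  - by move=> s /sub; exact: A0.
  - by move=> s s' /sub; exact: Ainj.
  - by move=> t s t01 /sub; exact: Z1A.
  - by move=> t s t01 /sub; exact: Z2A.
have E := (derive1_flip CA.1).2.
apply: (@no_side_change R (flip \o A) l c e h (flip \o Z1) (flip \o Z2) (flip \o Q) (flip q) (flip q')).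
- exact: C1_flip.
- by move=> s /sub sd; rewrite E; apply: flip_neq0; exact: A0.
- exact: lc.
- exact: ce.
- exact: eh.
- by move=> s s' /sub h1 h2 /flip_inj; exact: Ainj.
- exact: path_flip.
- exact: path_flip.
- exact: path_flip.
- by rewrite /= Z1h.
- by rewrite /= Z12.
- by rewrite /= Z2l.
- by move=> t s t01 /sub sab /flip_inj; exact: Z1A.
- by move=> t s t01 /sub sab /flip_inj; exact: Z2A.
- by move=> t s t01 slh /flip_inj; exact: QA.
- by move=> t t' t01 t'01; have [h1 h2] := ZQ t t' t01 t'01; split=> /flip_inj.
- exact: (leaves_flip lQ).
- by rewrite E /= det_flip oppr_gt0.
- exact: (leaves_flip lQ').
- by rewrite E /= det_flip oppr_lt0.
Qed.

Lemma leaves_aff B (a b : R) : derivable B a 1 ->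
  leaves (B \o aff a b) (B a) ((b - a) *: derive1 B a).
Proof.
move=> dB; split=> [|e e0]; first by rewrite /= aff0.
have k0 : 0 < `|b - a| + 1 by apply: ltr_wpDl.
have [d d0 Hd] := derivable_increment dB (divr_gt0 e0 k0).
exists (d / (`|b - a| + 1)) => [|t]; first exact: divr_gt0.
rewrite ltr_pdivlMr // => /andP[t0 td].
have affE : aff a b t - a = t * (b - a) by rewrite /aff addrAC subrr add0r.
have := Hd (aff a b t); rewrite affE normrM (ger0_norm t0) => H.
rewrite /= scalerA; apply: le_trans (H _) _.
  apply: le_lt_trans td; rewrite ler_wpM2l //; by clear; lra.
rewrite mulrCA [leRHS]mulrC ler_wpM2l //.
by rewrite mulrAC ler_pdivrMr // ler_wpM2l ?(ltW e0) //; clear; lra.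
Qed.

End Signs.

(** * Arc systems and the noncrossing condition *)

Section ArcSystem.
Variable R : realType.
Implicit Types (A B U V Z : R -> R * R) (s t : nat -> R) (x y : R).

Definition edge_lo (pos : nat -> nat) i := minn (pos i) (pos i.+1).
Definition edge_hi (pos : nat -> nat) i := maxn (pos i) (pos i.+1).

(** Edge [i] is the piece of the second strand between its [i]-th and next meeting points with the
    line, whose ranks on the line are [pos i] and [pos i.+1]. Equal parity means the same side of
    the line, and the three inequalities say that the two edges interlace. *)
Definition noncrossing n (pos : nat -> nat) := forall i j, (i <= n)%N -> (j <= n)%N ->
  odd i = odd j ->
  ~ [/\ (edge_lo pos i < edge_lo pos j)%N, (edge_lo pos j < edge_hi pos i)%N
      & (edge_hi pos i < edge_hi pos j)%N].

(** What a meander and a realizing curve have in common. [A] is the line and [B] the other strand;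
    the [k]-th crossing along [B] is at time [t k] of [B] and [s (pos k)] of [A]. [U] joins the
    starts of the two arcs and [V] their ends. Prolonged to time [h0] and closed by [Z], [A] is a
    loop which [B], between its first and last crossings, meets only at crossings. *)
Record arc_system n (pos : nat -> nat) A B s t (h0 : R) U V Z : Prop := ArcSystem {
  as_pos0 : pos 0%N = 0%N;
  as_posn : pos n.+1 = n.+1;
  as_pos : forall k, (0 < k <= n)%N -> (0 < pos k <= n)%N;
  as_posI : forall i j, (i <= n.+1)%N -> (j <= n.+1)%N -> pos i = pos j -> i = j;
  as_A1 : C1 A; as_B1 : C1 B;
  as_A0 : forall x, s 0%N <= x <= s n.+1 -> derive1 A x != 0;
  as_s : forall i, (i <= n)%N -> s i < s i.+1;
  as_t : forall i, (i <= n)%N -> t i < t i.+1;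
  as_sh : s n.+1 <= h0;
  as_cross : forall k, (0 < k <= n)%N -> A (s (pos k)) = B (t k);
  as_det : forall k, (0 < k <= n)%N ->
    det (derive1 A (s (pos k))) (derive1 B (t k)) != 0;
  as_AB : forall x y, s 0%N <= x <= s n.+1 -> t 0%N <= y <= t n.+1 -> A x = B y ->
    exists2 k, (k <= n.+1)%N & x = s (pos k) /\ y = t k;
  as_AI : forall x x', s 0%N <= x <= s n.+1 -> s 0%N <= x' <= s n.+1 -> A x = A x' -> x = x';
  as_BI : forall y y', t 0%N <= y <= t n.+1 -> t 0%N <= y' <= t n.+1 -> B y = B y' -> y = y';
  as_Uc : path01 U; as_U0 : U 0 = B (t 0%N); as_U1 : U 1 = A (s 0%N);
  as_UA : forall r x, 0 <= r <= 1 -> s 0%N <= x <= s n.+1 -> U r = A x -> x = s 0%N;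
  as_UB : forall r y, 0 <= r <= 1 -> t 0%N <= y <= t n.+1 -> U r = B y -> y = t 0%N;
  as_Vc : path01 V; as_V0 : V 0 = B (t n.+1); as_V1 : V 1 = A (s n.+1);
  as_VA : forall r x, 0 <= r <= 1 -> s 0%N <= x <= s n.+1 -> V r = A x -> x = s n.+1;
  as_VB : forall r y, 0 <= r <= 1 -> t 0%N <= y <= t n.+1 -> V r = B y -> y = t n.+1;
  as_UV : forall r r', 0 <= r <= 1 -> 0 <= r' <= 1 -> U r <> V r';
  as_Zc : path01 Z; as_Z0 : Z 0 = A h0; as_Z1 : Z 1 = A (s 0%N);
  as_ZA : forall r x, 0 <= r <= 1 -> s 1%N <= x <= s n -> Z r <> A x;
  as_ZB : forall r y, 0 <= r <= 1 -> t 1%N <= y <= t n -> Z r <> B y;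
  as_AI' : forall x x', s 1%N <= x <= s n -> s 0%N <= x' <= h0 -> A x' = A x -> x' = x;
  as_AB' : forall x y, s 0%N <= x <= h0 -> t 1%N <= y <= t n -> A x = B y ->
    exists2 k, (0 < k <= n)%N & x = s (pos k) /\ y = t k
}.

Lemma incr_le n (f : nat -> R) i j : (forall i, (i <= n)%N -> f i < f i.+1) ->
  (i <= j)%N -> (j <= n.+1)%N -> f i <= f j.
Proof.
move=> H; elim: j => [|j IH]; first by rewrite leqn0 => /eqP->.
rewrite leq_eqVlt => /orP[/eqP->//|ij] jn.
by apply: le_trans (IH ij (ltnW jn)) _; apply/ltW/H.
Qed.

Lemma incr_lt n (f : nat -> R) i j : (forall i, (i <= n)%N -> f i < f i.+1) ->
  (i < j)%N -> (j <= n.+1)%N -> f i < f j.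
Proof.
move=> H ij jn; apply: lt_le_trans (H i _) _; first by rewrite -ltnS (leq_trans ij).
exact: incr_le H ij jn.
Qed.

Lemma incr_inj n (f : nat -> R) i j : (forall i, (i <= n)%N -> f i < f i.+1) ->
  (i <= n.+1)%N -> (j <= n.+1)%N -> f i = f j -> i = j.
Proof.
move=> H iN jN E; case: (ltngtP i j) => // [ij|ji].
  by have := incr_lt H ij jN; rewrite E ltxx.
by have := incr_lt H ji iN; rewrite E ltxx.
Qed.

Lemma incr_index n (f : nat -> R) i j : (forall i, (i <= n)%N -> f i < f i.+1) ->
  (i <= n.+1)%N -> f i <= f j -> (i <= j)%N.
Proof.
by move=> H iN fij; rewrite leqNgt; apply/negP => /(incr_lt H) /(_ iN); rewrite ltNge fij.
Qed.

Lemma aff_rev (a b r : R) : aff a b r = aff b a (1 - r).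
Proof. by rewrite /aff; ring. Qed.

Lemma rev01 (r : R) : 0 <= r <= 1 -> 0 <= 1 - r <= 1.
Proof. by clear; lra. Qed.

Lemma aff_eq_start (a b r : R) : a != b -> aff a b r = a -> r = 0.
Proof.
move=> ab /eqP; rewrite /aff eq_sym -subr_eq0 opprD addrA subrr sub0r oppr_eq0 mulf_eq0.
by rewrite subr_eq0 [b == a]eq_sym (negbTE ab) orbF => /eqP.
Qed.

Lemma aff_eq_end (a b r : R) : a != b -> aff a b r = b -> r = 1.
Proof.
rewrite eq_sym aff_rev => ab /(aff_eq_start ab) /eqP.
by rewrite subr_eq0 => /eqP.
Qed.

Lemma edge_itv n pos A B s t h0 U V Z
    (H : arc_system n pos A B s t h0 U V Z) i r :
  (i <= n)%N -> 0 <= r <= 1 ->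
  t i <= aff (t i) (t i.+1) r <= t i.+1.
Proof. by move=> iN r01; apply: aff_itv => //; exact/ltW/(as_t H). Qed.

Lemma edge_itv' n pos A B s t h0 U V Z
    (H : arc_system n pos A B s t h0 U V Z) i y :
  (i <= n)%N -> t i <= y <= t i.+1 -> t 0%N <= y <= t n.+1.
Proof.
move=> iN /andP[h1 h2]; rewrite (le_trans ((incr_le (as_t H)) (leq0n i) _) h1) ?(leq_trans iN) //.
by rewrite (le_trans h2 (incr_le (as_t H) _ _)).
Qed.

(* the edge [i], run from its end [k] in [{i, i+1}] to its other end [k'] *)
Definition edge_ends i k k' := (k == i) && (k' == i.+1) || (k == i.+1) && (k' == i).

Lemma edge_ends_itv n pos A B s t h0 U V Z
    (H : arc_system n pos A B s t h0 U V Z) i k k' r :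
  (i <= n)%N -> edge_ends i k k' -> 0 <= r <= 1 ->
  t i <= aff (t k) (t k') r <= t i.+1.
Proof.
move=> iN /orP[] /andP[/eqP-> /eqP->] r01; first exact: (edge_itv H).
by rewrite aff_rev; apply: (edge_itv H) => //; exact: rev01.
Qed.

Lemma edge_ends_neq n pos A B s t h0 U V Z
    (H : arc_system n pos A B s t h0 U V Z) i k k' :
  (i <= n)%N -> edge_ends i k k' -> t k != t k'.
Proof.
move=> iN /orP[] /andP[/eqP-> /eqP->]; first by rewrite lt_eqF // (as_t H).
by rewrite gt_eqF // (as_t H).
Qed.

Lemma edge_meets n pos A B s t h0 U V Z
    (H : arc_system n pos A B s t h0 U V Z) i k k' r x :
  (i <= n)%N -> edge_ends i k k' -> 0 <= r <= 1 ->
  s 0%N <= x <= s n.+1 -> B (aff (t k) (t k') r) = A x ->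
  r = 0 /\ x = s (pos k) \/ r = 1 /\ x = s (pos k').
Proof.
move=> iN ek r01 xs /esym E; have yt := edge_ends_itv H iN ek r01.
have [m mn [xE yE]] := as_AB H xs (edge_itv' H iN yt) E.
have tt := edge_ends_neq H iN ek.
have mE : (m == k) || (m == k').
  have : (i <= m <= i.+1)%N.
    move: yt; rewrite yE => /andP[h1 h2].
    by apply/andP; split; [apply: (incr_index (as_t H) _ h1); exact: leqW|apply: (incr_index (as_t H) _ h2)].
  by case/orP: ek => /andP[/eqP-> /eqP->]; clear; lia.
case/orP: mE => /eqP mE; rewrite mE in xE yE; [left|right]; split=> //.
  exact: aff_eq_start tt yE.
exact: aff_eq_end tt yE.
Qed.

(** Its sign is the intersection sign of [A] and [B] at the [k]-th crossing. *)
Definition sig (pos : nat -> nat) A B s t k := det (derive1 A (s (pos k))) (derive1 B (t k)).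

Lemma opposite_scalings (d d' : R) (u v u' v' : R * R) : 0 < d -> d' = - d ->
  0 < det u v * det u' v' -> det u (d *: v) * det u' (d' *: v') < 0.
Proof.
move=> d0 ->; rewrite !detZr; move: (det u v) (det u' v') => a b ab.
have -> : d * a * (- d * b) = - (d * d * (a * b)) by ring.
by rewrite oppr_lt0 mulr_gt0 // mulr_gt0.
Qed.

Lemma scaled_dets_gt0 (d d' : R) (u v u' v' : R * R) k :
  0 < (-1) ^+ k * (det u v * det u' v') -> 0 < d * d' * (-1) ^+ k ->
  0 < det u (d *: v) * det u' (d' *: v').
Proof.
rewrite !detZr; move: (det u v) (det u' v') => a b h1 h2.
have := mulr_gt0 h1 h2.
have -> : (-1) ^+ k * (a * b) * (d * d' * (-1) ^+ k) = (-1) ^+ (k + k) * (d * a * (d' * b)).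
  by rewrite exprD; ring.
by rewrite addnn -mul2n exprM sqrrN !expr1n mul1r.
Qed.

(** With two equal consecutive signs, the edge of [B] between the crossings would leave [A] on one
    side and return from the other without meeting the loop in between. *)
Lemma sig_alternates n pos A B s t h0 U V Z
    (H : arc_system n pos A B s t h0 U V Z) (sg := sig pos A B s t) k :
  (0 < k)%N -> (k < n)%N -> sg k * sg k.+1 < 0.
Proof.
move=> k0 kn; have kk : (0 < k <= n)%N by rewrite k0 ltnW.
have kk' : (0 < k.+1 <= n)%N by [].
have kN : (k <= n)%N by rewrite ltnW.
rewrite lt_neqAle mulf_neq0 ?(as_det H) //= leNgt; apply/negP => pos_sig.
have n0 : (0 < n)%N by rewrite (leq_trans _ kn).
have d0 : 0 < t k.+1 - t k by rewrite subr_gt0 (as_t H).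
have spos j : (0 < j <= n)%N -> s 1%N <= s (pos j) <= s n.
  by move=> /(as_pos H) /andP[p0 pn]; rewrite !(incr_le (as_s H)) // ltnW.
have s01 := as_s H (leq0n n).
have snn := as_s H (leqnn n).
have sub x : s 1%N <= x <= s n -> s 0%N <= x <= s n.+1.
  by move: s01 snn; clear; lra.
have r01 : forall r : R, 0 <= r <= 1 -> t 1%N <= aff (t k) (t k.+1) r <= t n.
  move=> r /(edge_itv H kN) /andP[h1 h2].
  by rewrite (le_trans _ h1) ?(le_trans h2) //; apply: (incr_le (as_t H)) => //; rewrite ltnW.
(* The loop is [A] from [s 0] to [h0] followed by [Z]; the second closing path is constant. *)
apply: (@no_side_change_signed R A (s 0%N) (s 1%N) (s n) h0 (s (pos k)) (s (pos k.+1)) Z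
  (fun=> A (s 0%N)) (B \o aff (t k) (t k.+1)) ((t k.+1 - t k) *: derive1 B (t k))
  ((t k - t k.+1) *: derive1 B (t k.+1))).
- exact: as_A1 H.
- by move=> x /sub; exact: (as_A0 H).
- exact: s01.
- exact: lt_le_trans snn (as_sh H).
- exact: spos.
- exact: spos.
- apply/eqP => /(incr_inj (as_s H)) E.
  have /andP[_ p1] := as_pos H kk; have /andP[_ p2] := as_pos H kk'.
  have := as_posI H _ _ (E (leqW p1) (leqW p2)); rewrite (leqW kN) (leqW kn).
  by move=> /(_ isT isT); clear; lia.
- exact: as_AI' H.
- exact: as_Zc H.
- by move=> r _; exact: cts_at_cst.
- by apply: path_aff => y; exact: (C1_cts y (as_B1 H)).
- exact: as_Z0 H.
- exact: as_Z1 H.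
- by [].
- exact: as_ZA H.
- move=> _ x _ xs /(as_AI' H xs) E; have := E ltac:(by rewrite lexx (le_trans (ltW s01)) // (le_trans ((incr_le (as_s H)) _ _) (as_sh H))).
  by move: xs s01 => + + Ex; rewrite -Ex; clear; lra.
- move=> r x r1 xs /esym /(as_AB' H xs (r01 r r1)) [m mn [_ yE]].
  have tt : t k != t k.+1 by rewrite lt_eqF // (as_t H).
  have yt := edge_itv H kN r1.
  have mE : (m == k) || (m == k.+1).
    have : (k <= m <= k.+1)%N.
      case/andP: mn => _ mn; move: yt; rewrite yE => /andP[h1 h2].
      by apply/andP; split; [apply: (incr_index (as_t H) _ h1)|apply: (incr_index (as_t H) _ h2)]; exact: leqW.
    by clear; lia.
  case/orP: mE => /eqP mE; rewrite mE in yE; [left|right].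
    exact: aff_eq_start tt yE.
  exact: aff_eq_end tt yE.
- move=> r r' r1 r1'; split; first exact: (as_ZB H r1 (r01 _ r1')).
  move=> /(as_AB' H _ (r01 _ r1')) [|m mn [xE _]].
    by rewrite lexx (le_trans _ (as_sh H)) // (incr_le (as_s H)).
  have /andP[h _] := spos _ mn; by move: s01 h; rewrite -xE; clear; lra.
- by rewrite (as_cross H kk); exact: (leaves_aff (t k.+1) ((as_B1 H).1 _)).
- rewrite (as_cross H kk').
  rewrite (_ : (fun r => _) = B \o aff (t k.+1) (t k)); last first.
    by apply/funext => r /=; rewrite [in RHS]aff_rev.
  exact: (leaves_aff (t k) ((as_B1 H).1 _)).
- by apply: (opposite_scalings d0 _ pos_sig); rewrite opprB.
Qed.

Lemma sig_parity n pos A B s t h0 U V Z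
    (H : arc_system n pos A B s t h0 U V Z) (sg := sig pos A B s t) i j :
  (0 < i <= n)%N -> (0 < j <= n)%N ->
  0 < (-1) ^+ (i + j) * (sg i * sg j).
Proof.
have alt k : (0 < k)%N -> (k < n)%N -> sg k * sg k.+1 < 0.
  by move=> k0 kn; exact: (sig_alternates H k0 kn).
have nz k : (0 < k <= n)%N -> sg k != 0 by move=> kn; exact: (as_det H kn).
have sq k : (0 < k <= n)%N -> 0 < sg k * sg k.
  by move=> /nz h; rewrite -expr2 exprn_even_gt0 // h orbT.
clearbody sg; clear H.
wlog ij : i j / (i <= j)%N => [W hi hj|].
  have [ij|/ltnW ji] := leqP i j; first exact: W.
  by rewrite addnC [sg i * _]mulrC; exact: W.
elim: j ij => [|j IH]; first by rewrite leqn0 => /eqP->.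
rewrite leq_eqVlt => /orP[/eqP<- hi _|]; first by rewrite addnn -mul2n exprM sqrrN !expr1n mul1r; exact: sq.
rewrite ltnS => ij hi /andP[_ jn]; have jn' : (0 < j <= n)%N by rewrite (ltnW jn) (leq_trans _ ij) //; case/andP: hi.
have h1 := IH ij hi jn'; have h2 := alt _ (proj1 (andP jn')) jn.
have h3 := mulr_gt0 h1 (sq _ jn').
rewrite addnS exprS.
have : 0 < ((-1) ^+ (i + j) * (sg i * sg j)) * (- (sg j * sg j.+1)).
  by rewrite mulr_gt0 // oppr_gt0.
have -> : (-1) ^+ (i + j) * (sg i * sg j) * - (sg j * sg j.+1) =
  (-1 * (-1) ^+ (i + j) * (sg i * sg j.+1)) * (sg j * sg j) by ring.
by rewrite pmulr_lgt0 // sq.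
Qed.

(* the two ends of edge [i]: [pos k'] is the lower and [pos k] the upper one *)
Lemma edge_lo_hi n pos i : (i <= n)%N ->
  (forall i j, (i <= n.+1)%N -> (j <= n.+1)%N -> pos i = pos j -> i = j) ->
  exists k k', [/\ edge_ends i k k', pos k = edge_hi pos i & pos k' = edge_lo pos i].
Proof.
move=> iN posI; rewrite /edge_hi /edge_lo /edge_ends.
case: (ltngtP (pos i) (pos i.+1)) => [h|h|/posI E].
- by exists i.+1, i; rewrite !eqxx orbT.
- by exists i, i.+1; rewrite !eqxx.
- by have := E (leqW iN) iN; lia.
Qed.

Lemma edge_ends_sym i k k' : edge_ends i k k' = edge_ends i k' k.
Proof. by rewrite /edge_ends orbC andbC [X in _ || X]andbC. Qed.

(** Running an edge from its other end reverses the direction of departure and changes the parity of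
    the starting index, so the two signs compensate. *)
Lemma edge_ends_sign n t i k k' j l l' : (forall i, (i <= n)%N -> t i < t i.+1) ->
  (i <= n)%N -> (j <= n)%N -> odd i = odd j -> edge_ends i k k' -> edge_ends j l l' ->
  0 < (t k' - t k) * (t l' - t l) * (-1) ^+ (k + l).
Proof.
move=> tS iN jN ij ek el.
have d1 : 0 < t i.+1 - t i by rewrite subr_gt0 tS.
have d2 : 0 < t j.+1 - t j by rewrite subr_gt0 tS.
have e1 : (-1) ^+ (i + j) = 1 :> R by rewrite -signr_odd oddD ij addbb.
have dd := mulr_gt0 d1 d2.
case/orP: ek => /andP[/eqP-> /eqP->]; case/orP: el => /andP[/eqP-> /eqP->];
  rewrite ?addnS ?addSn ?exprS e1; move: dd; clear; lra.
Qed.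

(** By [sig_parity] and [edge_ends_sign], edges of equal parity leave [A] on the same side, from
    whichever ends they are run. If they interlaced, [no_interlaced_arcs_signed] would apply to
    them. *)
Theorem arc_system_noncrossing n pos A B s t h0 U V Z :
  arc_system n pos A B s t h0 U V Z -> noncrossing n pos.
Proof.
move=> H i j iN jN ij [ab1 ab2 ab3].
have [kb [ka [eP Eb Ea]]] := edge_lo_hi iN (as_posI H).
have [kd [kc [eQ Ed Ec]]] := edge_lo_hi jN (as_posI H).
rewrite -Ea -Eb -Ec -Ed in ab1 ab2 ab3.
have le k i0 k' : (i0 <= n)%N -> edge_ends i0 k k' -> (k <= n.+1)%N /\ (k' <= n.+1)%N.
  by move=> h /orP[] /andP[/eqP-> /eqP->]; split=> //; exact: leqW.
have [kbN kaN] := le _ _ _ iN eP; have [kdN kcN] := le _ _ _ jN eQ.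
have posN k : (k <= n.+1)%N -> (pos k <= n.+1)%N.
  rewrite leq_eqVlt => /orP[/eqP->|]; first by rewrite (as_posn H).
  case: k => [|k] kn; first by rewrite (as_pos0 H).
  by have /andP[_ /leqW] := as_pos H (k := k.+1) kn.
have inner k : (k <= n.+1)%N -> (0 < pos k < n.+1)%N -> (0 < k <= n)%N.
  move=> kn /andP[p0 pn]; rewrite lt0n; apply/andP; split.
    by apply: contraTneq p0 => ->; rewrite (as_pos0 H).
  by rewrite -ltnS ltn_neqAle kn andbT; apply: contraTneq pn => ->; rewrite (as_posn H) ltnn.
have kb_in : (0 < kb <= n)%N.
  by apply: inner => //; have := posN _ kdN; move: ab1 ab2 ab3; clear; lia.
have kc_in : (0 < kc <= n)%N.
  by apply: inner => //; have := posN _ kdN; move: ab1 ab2 ab3; clear; lia.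
have ac : s (pos ka) < s (pos kc) by apply: (incr_lt (as_s H)) => //; exact: posN.
have cb : s (pos kc) < s (pos kb) by apply: (incr_lt (as_s H)) => //; exact: posN.
have bd : s (pos kb) < s (pos kd) by apply: (incr_lt (as_s H)) => //; exact: posN.
have s0a : s 0%N <= s (pos ka) by apply: (incr_le (as_s H)) => //; exact: posN.
have dsn : s (pos kd) <= s n.+1 by apply: (incr_le (as_s H)) => //; exact: posN.
have sub x : s (pos ka) <= x <= s (pos kd) -> s 0%N <= x <= s n.+1.
  by move: s0a dsn; clear; lra.
have tk k : (k <= n.+1)%N -> t 0%N <= t k <= t n.+1.
  by move=> kn; rewrite !(incr_le (as_t H)).
have sk k : (k <= n.+1)%N -> s 0%N <= s k <= s n.+1.
  by move=> kn; rewrite !(incr_le (as_s H)).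
have ij' : i != j by apply/eqP => ij'; move: ab1; rewrite Ea Ec ij' ltnn.
have far : (i.+1 < j)%N || (j.+1 < i)%N.
  by move: ij ij'; clear; lia.
(* no common time on the two edges *)
have tfar y : ~ (t i <= y <= t i.+1 /\ t j <= y <= t j.+1).
  case/orP: far => f [/andP[h1 h2] /andP[h3 h4]].
    by have := incr_lt (as_t H) f (leqW jN); move: h2 h3; clear; lra.
  by have := incr_lt (as_t H) f (leqW iN); move: h1 h4; clear; lra.
have endt i0 k k' : (i0 <= n)%N -> edge_ends i0 k k' -> t i0 <= t k' <= t i0.+1.
  move=> h e; have := edge_ends_itv H h e (r := 1); rewrite aff1; apply.
  by rewrite ler01 lexx.
(* Only the outer ends [ka] and [kd] can be ends of the strand [B]; the edge is then continued to
   the end of [A] by [U] or [V]. *)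
pose P2 := if ka == 0%N then U else fun=> B (t ka).
pose Q2 := if kd == n.+1 then V else fun=> B (t kd).
have ka_in : ka != 0%N -> (0 < ka <= n)%N.
  move=> ka0; rewrite lt0n ka0 -ltnS ltn_neqAle kaN andbT.
  by apply: contraTneq ab1 => ->; rewrite (as_posn H) -leqNgt; exact: posN.
have kd_in : kd != n.+1 -> (0 < kd <= n)%N.
  move=> kd0; have kdn : (kd < n.+1)%N by rewrite ltn_neqAle kd0 kdN.
  rewrite -[(kd <= n)%N]ltnS kdn andbT lt0n.
  by apply: contraTneq ab3 => ->; rewrite (as_pos0 H).
have P2B r y : 0 <= r <= 1 -> t 0%N <= y <= t n.+1 -> P2 r = B y -> y = t ka.
  rewrite /P2; case: eqP => [->|_] r01 y01; first exact: (as_UB H r01 y01).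
  by move/(as_BI H (tk _ kaN) y01) => ->.
have Q2B r y : 0 <= r <= 1 -> t 0%N <= y <= t n.+1 -> Q2 r = B y -> y = t kd.
  rewrite /Q2; case: eqP => [->|_] r01 y01; first exact: (as_VB H r01 y01).
  by move/(as_BI H (tk _ kdN) y01) => ->.
apply: (@no_interlaced_arcs_signed R A (s (pos ka)) (s (pos kb)) (s (pos kc)) (s (pos kd))
  (B \o aff (t kb) (t ka)) P2 (B \o aff (t kc) (t kd)) Q2
  ((t ka - t kb) *: derive1 B (t kb)) ((t kd - t kc) *: derive1 B (t kc))).
- exact: as_A1 H.
- by move=> x /sub; exact: (as_A0 H).
- exact: ac.
- exact: cb.
- exact: bd.
- by move=> x x' /sub h /sub h'; exact: (as_AI H h h').
- by apply: path_aff => y; exact: (C1_cts y (as_B1 H)).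
- rewrite /P2; case: eqP => _; first exact: as_Uc H.
  by move=> r _; exact: cts_at_cst.
- by apply: path_aff => y; exact: (C1_cts y (as_B1 H)).
- rewrite /Q2; case: eqP => _; first exact: as_Vc H.
  by move=> r _; exact: cts_at_cst.
- by rewrite /= aff1 /P2; case: eqP => [->|//]; rewrite (as_U0 H).
- rewrite /P2; case: eqP => [->|/eqP/ka_in h]; first by rewrite (as_U1 H) (as_pos0 H).
  by rewrite (as_cross H h).
- by rewrite /= aff1 /Q2; case: eqP => [->|//]; rewrite (as_V0 H).
- rewrite /Q2; case: eqP => [->|/eqP/kd_in h]; first by rewrite (as_V1 H) (as_posn H).
  by rewrite (as_cross H h).
- by move=> r x r01 /sub xs E; have [[? _]|[_ ?]] := edge_meets H iN eP r01 xs E; [left|right].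
- move=> r x r01 /sub xs; rewrite /P2; case: eqP => [->|/eqP/ka_in h].
    by rewrite (as_pos0 H); exact: (as_UA H r01 xs).
  rewrite -(as_cross H h) => /(as_AI H (sk _ (posN _ kaN)) xs); exact: esym.
- move=> r x r01 /sub xs E; rewrite edge_ends_sym in eQ.
  by have [[? _]|[_ ?]] := edge_meets H jN eQ r01 xs E; [left|right].
- move=> r x r01 /sub xs; rewrite /Q2; case: eqP => [->|/eqP/kd_in h].
    by rewrite (as_posn H); exact: (as_VA H r01 xs).
  rewrite -(as_cross H h) => /(as_AI H (sk _ (posN _ kdN)) xs); exact: esym.
- move=> r r' r01 r01'.
  have yP := edge_ends_itv H iN eP r01.
  have yQ : t j <= aff (t kc) (t kd) r' <= t j.+1.
    by apply: (edge_ends_itv H jN) => //; rewrite edge_ends_sym.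
  have yPt := edge_itv' H iN yP; have yQt := edge_itv' H jN yQ.
  have tka := endt _ _ _ iN eP.
  have tkd : t j <= t kd <= t j.+1 by apply: (endt _ kc _ jN); rewrite edge_ends_sym.
  split=> /=.
  + by move=> /(as_BI H yPt yQt) E; apply: (tfar _ (conj yP _)); rewrite E.
  + by move=> /esym /(Q2B _ _ r01' yPt) E; apply: (tfar _ (conj yP _)); rewrite E.
  + by move=> /(P2B _ _ r01 yQt) E; apply: (tfar _ (conj _ yQ)); rewrite E.
  + rewrite /Q2; case: eqP => [E|_]; last first.
      by move=> /(P2B _ _ r01 (tk _ kdN)) E; apply: (tfar _ (conj tka _)); rewrite -E.
    rewrite /P2; case: eqP => [_|_]; first exact: (as_UV H r01 r01').
    by move=> /esym /(as_VB H r01' (tk _ kaN)) E'; apply: (tfar _ (conj tka _)); rewrite E' -E.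
- by rewrite (as_cross H kb_in); exact: (leaves_aff (t ka) ((as_B1 H).1 _)).
- by rewrite (as_cross H kc_in); exact: (leaves_aff (t kd) ((as_B1 H).1 _)).
have h1 := sig_parity H kb_in kc_in.
have h2 := edge_ends_sign (as_t H) iN jN ij eP (ltac:(by rewrite edge_ends_sym; exact: eQ)).
exact: (scaled_dets_gt0 h1 h2).
Qed.

End ArcSystem.

(** * Combinatorics of the word of a permutation *)

Section Word.
Local Open Scope nat_scope.
Variables (n : nat) (p : 'S_n).

(* Positions on the line: [0] and [n.+1] are the two ends, [pos k.+1] the k-th
   point met along the second strand. *)
Definition pos (k : nat) : nat :=
  if k is k'.+1 then (if insub k' is Some i then (p (i : 'I_n)).+1 else n.+1) else 0.

Arguments pos : simpl never.

(** Half the length of the word: 0, the n letters, and theta when [n] is odd. *)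
Definition half : nat := n.+1 + odd n.

Lemma posS (i : 'I_n) : pos i.+1 = (p i).+1.
Proof. by rewrite /pos insubT //= => lt; congr (p _).+1; apply: val_inj. Qed.

Lemma pos_n : pos n.+1 = n.+1.
Proof. by rewrite /pos insubF // ltnn. Qed.

Lemma pos_itv k : 0 < k <= n -> 0 < pos k <= n.
Proof. by case: k => // k kn; rewrite (posS (Ordinal kn)) /=. Qed.

Lemma pos_inj i j : i <= n.+1 -> j <= n.+1 -> pos i = pos j -> i = j.
Proof.
wlog ij : i j / i <= j => [W|] iN jN E.
  by have [ij|/ltnW ji] := leqP i j; [exact: W|apply/esym; exact: W].
have [//|ij'] := eqVneq i j.
have ltij : i < j by rewrite ltn_neqAle ij' ij.
case: i ltij {ij ij'} iN E => [|i] ltij iN.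
  case: j jN ltij => // j _ _.
  by rewrite /pos; case: insub.
case: j jN ltij => // j jN ltij.
have iN' : i < n by rewrite -ltnS (leq_trans ltij).
rewrite (posS (Ordinal iN')) /=.
have [jn|jn] := ltnP j n.
  by rewrite (posS (Ordinal jn)) => -[/val_inj/perm_inj[->]].
have -> : j = n by apply/eqP; rewrite eqn_leq jn andbT -ltnS.
by rewrite pos_n => -[E]; have := ltn_ord (p (Ordinal iN')); rewrite E ltnn.
Qed.

Lemma half_gt0 : 0 < half. Proof. by []. Qed.

Lemma leq_half k : k < half -> k <= n.+1.
Proof. by rewrite /half; case: (odd n); lia. Qed.

Lemma pos_lt_half k : k < half -> pos k < half.
Proof.
rewrite /half => kh; case: k kh => // k; rewrite addSn !ltnS => kh.
have [kn|kn] := ltnP k n; first by have := @pos_itv k.+1 kn; lia.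
have -> : k = n by move: kh kn; case: (odd n); lia.
by rewrite pos_n; move: kh kn; case: (odd n); lia.
Qed.

Lemma perm_wordE : perm_word p = iota 0 half ++ [seq pos k | k <- iota 0 half].
Proof.
have iE : iota 0 half = 0 :: iota 1 n ++ theta n.
  by rewrite /half addSn /= iotaD /theta add1n; case: (odd n).
rewrite iE /perm_word /= -catA; congr (_ :: _); rewrite map_cat.
have -> : [seq (i : 'I_n).+1 | i <- enum 'I_n] = iota 1 n.
  rewrite -[1]/(1 + 0) iotaDl -val_enum_ord -map_comp.
  by apply: eq_map => i /=; rewrite add1n.
have -> : [seq (p i).+1 | i <- enum 'I_n] = [seq pos k | k <- iota 1 n].
  rewrite -[1]/(1 + 0) iotaDl -val_enum_ord -!map_comp.
  by apply: eq_map => i /=; rewrite -posS add1n.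
by rewrite /theta; case: (odd n) => //=; rewrite pos_n.
Qed.

Lemma size_perm_word : size (perm_word p) = half.*2.
Proof. by rewrite perm_wordE size_cat size_map size_iota addnn. Qed.

Lemma nth_perm_word_lo i : i < half -> nth 0 (perm_word p) i = i.
Proof. by move=> ih; rewrite perm_wordE nth_cat size_iota ih nth_iota. Qed.

Lemma nth_perm_word_hi k : k < half -> nth 0 (perm_word p) (half + k) = pos k.
Proof.
move=> kh; rewrite perm_wordE nth_cat size_iota ifF; last by rewrite ltnNge leq_addr.
by rewrite addKn (nth_map 0) ?size_iota // nth_iota.
Qed.

(** In the first half a letter equals its position; in the second half the letter of rank [k] is
    [pos k]. *)
Lemma perm_word_eq i j : i < half.*2 -> j < half.*2 -> i != j ->
  (nth 0 (perm_word p) i == nth 0 (perm_word p) j) <->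
  (exists2 k, k < half & (i = pos k /\ j = half + k) \/ (j = pos k /\ i = half + k)).
Proof.
move=> iN jN ij.
have hi x : x < half.*2 -> half <= x -> exists2 k, k < half & x = half + k.
  by move=> h1 h2; exists (x - half); [rewrite -addnn in h1; lia|rewrite subnKC].
split=> [/eqP|[k kh [[-> ->]|[-> ->]]]]; last first.
- by rewrite nth_perm_word_hi // nth_perm_word_lo ?pos_lt_half.
- by rewrite nth_perm_word_hi // nth_perm_word_lo ?pos_lt_half.
move: ij; have [ih|/(hi _ iN)[k kh ->]] := ltnP i half; have [jh|/(hi _ jN)[l lh ->]] := ltnP j half.
- by rewrite !nth_perm_word_lo // => /eqP.
- by rewrite nth_perm_word_lo // nth_perm_word_hi // => _ E; exists l => //; left.
- by rewrite nth_perm_word_hi // nth_perm_word_lo // => _ E; exists k => //; right.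
rewrite !nth_perm_word_hi // => + /pos_inj E.
by rewrite (E (leq_half kh) (leq_half lh)) eqxx.
Qed.

End Word.

(** * From a realizing curve to an arc system *)

Section CurveToArcs.
Variable R : realType.
Implicit Types (g : R -> R * R) (h : R -> R) (x y : R).

Lemma derivable_cts_at (V : normedModType R) (f : R -> V) (t : R) :
  derivable f t 1 -> cts_at f t.
Proof.
by move=> df; apply/cts_atP/differentiable_continuous/derivable1_diffP.
Qed.

Lemma derive1_gt0_incr h : (forall t : R, derivable h t 1) ->
  (forall t, 0 < derive1 h t) -> forall x y, x < y -> h x < h y.
Proof.
move=> dh h0 x y xy; have [c _ E] := mean_value x y dh.
by rewrite -subr_gt0 E mulr_gt0 // subr_gt0.
Qed.

Lemma incr_ltE h : (forall x y, x < y -> h x < h y) -> forall x y, (h x < h y) = (x < y).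
Proof.
move=> H x y; apply/idP/idP; last exact: H.
case: (ltgtP x y) => // [yx|->]; last by rewrite ltxx.
by have := H _ _ yx; move=> h1 h2; have := lt_trans h1 h2; rewrite ltxx.
Qed.

Lemma IVT_cts h a b v : a <= b -> (forall t, a <= t <= b -> cts_at h t) ->
  h a <= v <= h b -> exists2 c, a <= c <= b & h c = v.
Proof.
move=> ab hc /andP[av vb].
have [||c cab E] := @IVT R h a b v ab.
- apply: continuous_in_subspaceT => x; rewrite inE /= in_itv /= => xab.
  by apply/cts_atP/hc.
- by rewrite min_l ?max_r ?av ?vb // (le_trans av).
by move: cab; rewrite in_itv /= => cab; exists c.
Qed.

Lemma circle_eq_near x y : circle_eq x y -> `|x - y| < 1 -> x = y.
Proof.
move=> [k E]; rewrite E -intr_norm -[1]/(1%:~R) ltr_int => k1.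
have k0 : k = 0 by apply/eqP; rewrite -normr_eq0; move: k1; clear; lia.
by apply/eqP; rewrite -subr_eq0 E k0.
Qed.

Lemma transverse_det (u v : R * R) : transverse u v -> det u v != 0.
Proof.
move=> H; apply/eqP => D0.
have [a [b E1]] := H (1, 0); have [c [d E2]] := H (0, 1).
have : det (1, 0) (0, 1) = 1 :> R by rewrite /det /=; ring.
rewrite E1 E2; have -> : det (a *: u + b *: v) (c *: u + d *: v) = (a * d - b * c) * det u v.
  by rewrite /det /= !scaleE; ring.
by rewrite D0 mulr0 => /eqP; rewrite eq_sym oner_eq0.
Qed.

Lemma derive1_periodic g : (forall t, g (t + 1) = g t) ->
  forall t, derive1 g (t + 1) = derive1 g t.
Proof.
move=> gp t; rewrite /derive1.
have -> : (fun h : R => h^-1 *: (g (h + (t + 1)) - g (t + 1))) = (fun h : R => h^-1 *: (g (h + t) - g t)).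
  by apply/funext => h; rewrite addrA !gp.
by [].
Qed.

(** The time at which the curve passes the letter in position [i] of the word. *)
Definition tau n h (i : nat) : R := h (i%:R / (half n).*2%:R).

Lemma circle_diffeo_incr h : circle_diffeo h -> forall x y, x < y -> h x < h y.
Proof. by case=> sh _ h0; apply: derive1_gt0_incr => // t; exact: (sh 0%N). Qed.

Lemma tau_lt n h i j : circle_diffeo h -> (i < j)%N -> tau n h i < tau n h j.
Proof.
move=> Dh ij; apply: circle_diffeo_incr => //.
by rewrite ltr_pM2r ?invr_gt0 ?ltr0n // ltr_nat.
Qed.

Lemma tau_period n h : circle_diffeo h -> tau n h (half n).*2 = tau n h 0 + 1.
Proof.
by case=> _ hp _; rewrite /tau divff ?pnatr_eq0 // -[1 in LHS]add0r hp mul0r.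
Qed.

Lemma tau_le n h i j : circle_diffeo h -> (i <= j)%N -> tau n h i <= tau n h j.
Proof. by move=> Dh; rewrite leq_eqVlt => /orP[/eqP->//|/(tau_lt n Dh)/ltW]. Qed.

(** The equality of diagrams read on one half-open period, where times equal on the circle are
    equal. *)
Lemma double_points n (p : 'S_n) g h x y (T := tau n h) : circle_diffeo h ->
  (forall s t : R, perm_diagram R p s t <-> curve_diagram g (h s) (h t)) ->
  T 0%N <= x < T 0%N + 1 -> T 0%N <= y < T 0%N + 1 -> x != y ->
  g x = g y <-> exists2 k, (k < half n)%N &
    (x = T (pos p k) /\ y = T (half n + k)%N) \/ (y = T (pos p k) /\ x = T (half n + k)%N).
Proof.
move=> Dh gh xI yI xy; pose N := (half n).*2.
have N0 : (0 : R) < N%:R by rewrite ltr0n.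
have szE : size (perm_word p) = N by exact: size_perm_word.
have sizeR : (size (perm_word p))%:R = N%:R :> R by rewrite szE.
have nodeN (i : nat) : (i < N)%N -> 0 <= (i%:R / (size (perm_word p))%:R : R) < 1.
  move=> iN; rewrite sizeR; apply/andP; split; first exact: divr_ge0.
  by rewrite ltr_pdivrMr // mul1r ltr_nat.
have h01 : h 1 = h 0 + 1 by case: Dh => _ hp _; rewrite -hp add0r.
have surj z : T 0%N <= z < T 0%N + 1 -> exists2 s, 0 <= s < 1 & z = h s.
  rewrite /T /tau mul0r -h01 => /andP[z0 z1].
  have [||s /andP[s0 s1] E] := @IVT_cts h 0 1 z ler01.
  - by move=> t _; apply: derivable_cts_at; case: Dh => sh _ _; exact: (sh 0%N).
  - by rewrite z0 ltW.
  exists s => //; rewrite s0 lt_neqAle s1 andbT /=.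
  by apply/negP => /eqP s1'; move: z1; rewrite -E s1' ltxx.
have near (a b : R) : 0 <= a < 1 -> 0 <= b < 1 -> `|a - b| < 1.
  by rewrite ltr_norml; clear; lra.
split=> [gxy|[k kh kE]]; last first.
  have [i [j [ij nij xE yE]]] : exists i j : 'I_(size (perm_word p)), [/\ i != j,
      nth 0%N (perm_word p) i = nth 0%N (perm_word p) j, x = T i & y = T j].
    have h1 : (pos p k < size (perm_word p))%N.
      by rewrite size_perm_word -addnn; have := pos_lt_half p kh; clear; lia.
    have h2 : (half n + k < size (perm_word p))%N.
      by rewrite size_perm_word -addnn ltn_add2l.
    have nn : pos p k != (half n + k)%N by rewrite neq_ltn (leq_trans (pos_lt_half p kh)) ?leq_addr.
    have E : nth 0%N (perm_word p) (pos p k) = nth 0%N (perm_word p) (half n + k).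
      by rewrite nth_perm_word_hi // nth_perm_word_lo ?pos_lt_half.
    case: kE => -[E1 E2]; first by exists (Ordinal h1), (Ordinal h2).
    by exists (Ordinal h2), (Ordinal h1); split=> //; rewrite -val_eqE /= eq_sym.
  have [|_ ] := (gh (i%:R / N%:R) (j%:R / N%:R)).1.
    by exists i, j; rewrite sizeR; split=> //; exists 0; rewrite subrr.
  by rewrite -[h (i%:R / _)]/(T i) -[h (j%:R / _)]/(T j) -xE -yE.
have [s sI sE] := surj _ xI; have [t tI tE] := surj _ yI.
have [|i [j [ij nij [k kE] [l lE]]]] := (gh s t).2.
  rewrite -sE -tE; split=> // /circle_eq_near E; move: xy; rewrite E ?eqxx //.
  by move: xI yI; rewrite ltr_norml; clear; lra.
have xE : x = T i.
  rewrite sE /T /tau; congr h; rewrite -/N -sizeR; apply: circle_eq_near; first by exists k.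
  by apply: near => //; apply: nodeN; rewrite -szE.
have yE : y = T j.
  rewrite tE /T /tau; congr h; rewrite -/N -sizeR; apply: circle_eq_near; first by exists l.
  by apply: near => //; apply: nodeN; rewrite -szE.
have iN : (i < N)%N by rewrite -szE.
have jN : (j < N)%N by rewrite -szE.
have [|m mh mE] := (@perm_word_eq n p i j iN jN ij).1; first by rewrite nij eqxx.
by exists m => //; case: mE => -[E1 E2]; [left|right]; rewrite xE yE E1 E2.
Qed.

Section Passes.
Variables (n : nat) (p : 'S_n) (g : R -> R * R) (h : R -> R).
Hypothesis Dh : circle_diffeo h.
Hypothesis gh : forall s t : R, perm_diagram R p s t <-> curve_diagram g (h s) (h t).
Let T := tau n h.
Let m := half n.

Let T0m : T 0%N < T m. Proof. exact: tau_lt. Qed.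
Let Tm1 : T m < T 0%N + 1.
Proof. by rewrite -tau_period //; apply: tau_lt => //; rewrite -addnn -addn1 leq_add2l. Qed.

Lemma tau_pos_lt k : (k < m)%N -> T (pos p k) < T m.
Proof. by move=> km; apply: tau_lt => //; exact: pos_lt_half. Qed.

Let Tmk k : T m <= T (m + k)%N. Proof. by apply: tau_le => //; exact: leq_addr. Qed.

Lemma double_point k : (k < m)%N ->
  T (m + k)%N < T 0%N + 1 /\ g (T (pos p k)) = g (T (m + k)%N).
Proof.
move=> km; have lt : T (m + k)%N < T 0%N + 1.
  by rewrite -tau_period // -addnn; apply: tau_lt => //; rewrite ltn_add2l.
have Tp := tau_pos_lt km; have T0p : T 0%N <= T (pos p k) by exact: tau_le.
split=> //; have [|||_ H] := @double_points n p g h (T (pos p k)) (T (m + k)%N) Dh gh.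
- by rewrite T0p (lt_trans Tp Tm1).
- by rewrite lt (le_trans (ltW T0m) (Tmk k)).
- by rewrite lt_eqF // (lt_le_trans Tp).
by apply: H; exists k => //; left.
Qed.

Lemma first_pass_inj x y : T 0%N <= x < T m -> T 0%N <= y < T m -> g x = g y -> x = y.
Proof.
move=> /andP[x0 xm] /andP[y0 ym] E; apply/eqP; apply/negPn/negP => xy.
have [H _] := @double_points n p g h x y Dh gh ltac:(by rewrite x0 (lt_trans xm))
  ltac:(by rewrite y0 (lt_trans ym)) xy.
have [k _ [[_ E']|[_ E']]] := H E; have := Tmk k; rewrite /T /m -E' leNgt ?xm ?ym //.
Qed.

Lemma second_pass_inj x y : T m <= x < T 0%N + 1 -> T m <= y < T 0%N + 1 -> g x = g y -> x = y.
Proof.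
move=> /andP[x0 xm] /andP[y0 ym] E; apply/eqP; apply/negPn/negP => xy.
have [H _] := @double_points n p g h x y Dh gh ltac:(by rewrite xm (le_trans (ltW T0m)))
  ltac:(by rewrite ym (le_trans (ltW T0m))) xy.
have [k /tau_pos_lt km [[E' _]|[E' _]]] := H E; move: km; rewrite /T /m -E' ltNge ?x0 ?y0 //.
Qed.

Lemma passes_meet x y : T 0%N <= x < T m -> T m <= y < T 0%N + 1 -> g x = g y ->
  exists2 k, (k < m)%N & x = T (pos p k) /\ y = T (m + k)%N.
Proof.
move=> /andP[x0 xm] /andP[y0 ym] E.
have [H _] := @double_points n p g h x y Dh gh ltac:(by rewrite x0 (lt_trans xm))
  ltac:(by rewrite ym (le_trans (ltW T0m))) ltac:(by rewrite lt_eqF // (lt_le_trans xm)).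
have [k km [[E1 E2]|[E' _]]] := H E; first by exists k.
by move: (tau_pos_lt km); rewrite /T /m -E' ltNge y0.
Qed.

End Passes.

(** [A] is the first pass and [B] the second. Both start at the letter 0, so [U] is constant; the
    first pass closes up there at time [T m], so [h0 = T m] and [Z] is constant. Only the last times
    [se], [te] and the path [V] depend on the parity of [n]. *)
Lemma curve_arc_system n (p : 'S_n) g h (se te : R) V (T := tau n h) (m := half n)
    (s := fun k => if (k <= n)%N then T k else se)
    (t := fun k => if (k <= n)%N then T (m + k)%N else te) :
  (0 < n)%N -> generic_curve g -> circle_diffeo h ->
  (forall s t : R, perm_diagram R p s t <-> curve_diagram g (h s) (h t)) ->
  T n < se -> se < T m -> T (m + n)%N < te -> te < T 0%N + 1 ->
  (forall x y, T 0%N <= x <= se -> T m <= y <= te -> g x = g y ->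
     exists2 k, (k <= n.+1)%N & x = s (pos p k) /\ y = t k) ->
  path01 V -> V 0 = g te -> V 1 = g se ->
  (forall r x, 0 <= r <= 1 -> T 0%N <= x <= se -> V r = g x -> x = se) ->
  (forall r y, 0 <= r <= 1 -> T m <= y <= te -> V r = g y -> y = te) ->
  (forall r, 0 <= r <= 1 -> V r <> g (T 0%N)) ->
  arc_system n (pos p) g g s t (T m) (fun=> g (T 0%N)) V (fun=> g (T 0%N)).
Proof.
move=> n0 [[gp gs] g0 gtr _ _] Dh gh Tnse seTm Tmte teT0 E2 Vc V0 V1 VA VB VU.
have gC := smooth_C1 gs.
have m0 : (0 < m)%N by [].
have nm : (n < m)%N by rewrite /m /half addSn ltnS leq_addr.
have Tle i j : (i <= j)%N -> T i <= T j by exact: tau_le.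
have Tlt i j : (i < j)%N -> T i < T j by exact: tau_lt.
have TN : T (m + m)%N = T 0%N + 1 by rewrite addnn; exact: tau_period.
have sE k : (k <= n)%N -> s k = T k by rewrite /s => ->.
have tE k : (k <= n)%N -> t k = T (m + k)%N by rewrite /t => ->.
have sEn : s n.+1 = se by rewrite /s ltnn.
have tEn : t n.+1 = te by rewrite /t ltnn.
have s0 : s 0%N = T 0%N by rewrite sE.
have t0 : t 0%N = T m by rewrite tE // addn0.
have T0m : T 0%N < T m by exact: Tlt.
have DP x y : T 0%N <= x < T 0%N + 1 -> T 0%N <= y < T 0%N + 1 -> x != y -> g x = g y ->
  exists2 k, (k < m)%N & (x = T (pos p k) /\ y = T (m + k)%N) \/ (y = T (pos p k) /\ x = T (m + k)%N).
  by move=> xI yI xy; have [H _] := double_points Dh gh xI yI xy.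
have Tpos k : (k < m)%N -> T (pos p k) < T m by exact: tau_pos_lt.
have Tmk k : T m <= T (m + k)%N by apply/Tle/leq_addr.
have gdiff i j k : (k < m)%N -> i = pos p k -> j = (m + k)%N -> T j < T 0%N + 1 /\ g (T i) = g (T j).
  by move=> km -> ->; exact: (double_point Dh gh).
have AI x x' : T 0%N <= x < T m -> T 0%N <= x' < T m -> g x = g x' -> x = x'.
  exact: (first_pass_inj Dh gh).
have BI x x' : T m <= x < T 0%N + 1 -> T m <= x' < T 0%N + 1 -> g x = g x' -> x = x'.
  exact: (second_pass_inj Dh gh).
have g0m : g (T 0%N) = g (T m).
  by have [] := gdiff 0%N m 0%N m0 (erefl _) (esym (addn0 m)).
have Acl x : T 0%N <= x <= se -> T 0%N <= x < T m by move: seTm; clear; lra.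
have Bcl x : T m <= x <= te -> T m <= x < T 0%N + 1 by move: teT0; clear; lra.
have posk k : (0 < k <= n)%N -> (pos p k <= n)%N by move=> /(pos_itv p) /andP[].
have T0A : T 0%N <= T 0%N < T m by rewrite lexx.
have TmB : T m <= T m < T 0%N + 1 by move: Tmte teT0 (Tmk n); clear; lra.
have Tns x : T 1%N <= x <= T n -> T 0%N < x < T m.
  by move: (Tlt 0%N 1%N (ltn0Sn 0)) (Tlt _ _ nm); clear; lra.
have Tnt x : T (m + 1)%N <= x <= T (m + n)%N -> T m < x < T 0%N + 1.
  by move: (Tlt m (m + 1)%N ltac:(by rewrite addn1)) Tmte teT0; clear; lra.
have crossT k : (0 < k <= n)%N -> (T (pos p k) < T (m + k)%N) /\
   T (m + k)%N < T 0%N + 1 /\ g (T (pos p k)) = g (T (m + k)%N).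
  move=> kn; have km : (k < m)%N by case/andP: kn => _ kn; exact: leq_ltn_trans nm.
  have [h1 h2] := gdiff _ _ k km (erefl _) (erefl _).
  by split; [exact: lt_le_trans (Tpos _ km) (Tmk k)|split].
have ZA x : T 0%N < x < T m -> g (T 0%N) <> g x.
  move=> /andP[h1 h2] /(AI _ _ T0A) E.
  have E1 : T 0%N = x by apply: E; rewrite (ltW h1) h2.
  by move: h1; rewrite E1 ltxx.
have ZB y : T m < y < T 0%N + 1 -> g (T m) <> g y.
  move=> /andP[h1 h2] /(BI _ _ TmB) E.
  have E1 : T m = y by apply: E; rewrite (ltW h1) h2.
  by move: h1; rewrite E1 ltxx.
apply: ArcSystem.
- by [].
- exact: pos_n.
- exact: pos_itv.
- exact: pos_inj.
- exact: gC.
- exact: gC.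
- by move=> x _; exact: g0.
- move=> i iN; rewrite sE //; move: iN; rewrite leq_eqVlt => /orP[/eqP->|iN]; first by rewrite sEn.
  by rewrite sE //; exact: Tlt.
- move=> i iN; rewrite tE //; move: iN; rewrite leq_eqVlt => /orP[/eqP->|iN]; first by rewrite tEn.
  by rewrite tE //; apply: Tlt; rewrite ltn_add2l.
- by rewrite sEn ltW.
- move=> k kn; rewrite sE ?posk // tE; last by case/andP: kn.
  by case: (crossT k kn) => _ [].
- move=> k kn; rewrite sE ?posk // tE; last by case/andP: kn.
  have [h1 [h2 h3]] := crossT k kn.
  apply/transverse_det/gtr => //; move=> /circle_eq_near E.
  have : T (pos p k) = T (m + k)%N.
    apply: E; rewrite ltr_norml; have := Tle 0%N (pos p k) (leq0n _).
    by move: h1 h2; clear; lra.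
  by move: h1; clear; lra.
- by move=> x y; rewrite s0 t0 sEn tEn; exact: E2.
- by move=> x x'; rewrite s0 sEn => /Acl h1 /Acl h2; exact: AI.
- by move=> x x'; rewrite t0 tEn => /Bcl h1 /Bcl h2; exact: BI.
- by move=> r _; exact: cts_at_cst.
- by rewrite t0.
- by rewrite s0.
- by move=> r x _; rewrite s0 sEn => /Acl h1 /(AI _ _ T0A h1).
- by move=> r x _; rewrite t0 tEn g0m => /Bcl h1 /(BI _ _ TmB h1).
- exact: Vc.
- by rewrite tEn.
- by rewrite sEn.
- by move=> r x r01; rewrite s0 sEn; exact: VA.
- by move=> r x r01; rewrite t0 tEn; exact: VB.
- by move=> r r' _ r01 /esym; exact: VU.
- by move=> r _; exact: cts_at_cst.
- exact: g0m.
- by rewrite s0.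
- by move=> r x _; rewrite !sE // => /Tns; exact: ZA.
- by move=> r y _; rewrite !tE // g0m => /Tnt; exact: ZB.
- move=> x x'; rewrite !sE // => /Tns h1 /andP[h2]; rewrite le_eqVlt => /orP[/eqP->|h3].
    by rewrite -g0m => /(ZA _ h1).
  by apply: AI => //; [rewrite h2|move: h1; clear; lra].
- move=> x y; rewrite s0 !tE // => /andP[h1 h2] h3 E.
  have h4 := Tnt y h3.
  have [|||k km [[xE yE]|[yE _]]] := DP x y _ _ _ E.
  + by move: h1 h2 TmB; clear; lra.
  + by move: h4 T0m; clear; lra.
  + by rewrite lt_eqF //; move: h2 h4; clear; lra.
  + have kn : (0 < k <= n)%N.
      have : (m + 1 <= m + k <= m + n)%N; last by rewrite !leq_add2l.
      apply/andP; split; rewrite leqNgt; apply/negP => /Tlt.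
        by rewrite -yE; move: h3; clear; lra.
      by rewrite -yE; move: h3; clear; lra.
    exists k => //; rewrite sE ?posk // tE //; by case/andP: kn.
  + by have := Tpos k km; rewrite -yE; move: h4; clear; lra.
Qed.

(** For odd [n] both passes reach the letter theta, which serves as constant path [V]. *)
Lemma realizable_odd_noncrossing n (p : 'S_n) g h :
  (0 < n)%N -> odd n -> generic_curve g -> circle_diffeo h ->
  (forall s t : R, perm_diagram R p s t <-> curve_diagram g (h s) (h t)) ->
  noncrossing n (pos p).
Proof.
move=> n0 on gg Dh gh; pose T := tau n h; pose m := half n.
have mE : m = n.+2 by rewrite /m /half on addn1.
have Tlt i j : (i < j)%N -> T i < T j by exact: tau_lt.
have lastm : (n.+1 < m)%N by rewrite mE.
have [l1 l2] := double_point Dh gh lastm; rewrite pos_n in l2.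
have Acl x : T 0%N <= x <= T n.+1 -> T 0%N <= x < T m.
  by case/andP=> -> h1; exact: le_lt_trans h1 (Tlt _ _ lastm).
have Bcl x : T m <= x <= T (m + n.+1)%N -> T m <= x < T 0%N + 1.
  by case/andP=> -> h1; exact: le_lt_trans h1 l1.
have seA : T 0%N <= T n.+1 <= T n.+1 by rewrite lexx andbT ltW // Tlt.
have teB : T m <= T (m + n.+1)%N <= T (m + n.+1)%N.
  by rewrite lexx andbT; apply: tau_le => //; exact: leq_addr.
apply: (arc_system_noncrossing (curve_arc_system (se := T n.+1) (te := T (m + n.+1)%N)
  (V := fun=> g (T n.+1)) n0 gg Dh gh _ _ _ _ _ _ _ _ _ _ _)) => //.
- exact: Tlt.
- exact: Tlt.
- by apply: Tlt; rewrite ltn_add2l.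
- move=> x y /Acl xI /Bcl yI /(passes_meet Dh gh xI yI) [k km [xE yE]].
  have kn : (k <= n.+1)%N by rewrite -ltnS -mE.
  exists k => //; rewrite xE yE; split; case: leqP => // h1.
    have -> // : pos p k = n.+1.
    by apply/eqP; rewrite eqn_leq h1 andbT -ltnS -mE; exact: pos_lt_half.
  by have -> : k = n.+1 by apply/eqP; rewrite eqn_leq kn.
- by move=> t _; exact: cts_at_cst.
- by move=> r x _ /Acl h1 /(first_pass_inj Dh gh (Acl _ seA) h1).
- by move=> r y _ /Bcl h1; rewrite l2 => /(second_pass_inj Dh gh (Bcl _ teB) h1).
- move=> r _ /(first_pass_inj Dh gh (Acl _ seA)) E.
  have E' : T n.+1 = T 0%N by apply: E; rewrite lexx; exact: (Tlt 0%N m).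
  by have := Tlt 0%N n.+1 isT; rewrite E' ltxx.
Qed.

End CurveToArcs.

(** * Even order: cutting the corner at the letter 0 *)

Section ShortCut.
Variable R : realType.
Implicit Types (g f : R -> R * R) (u v q : R * R) (x y : R).

Lemma leaves_shift g (a s : R) : derivable g a 1 ->
  leaves (fun t => g (a + s * t)) (g a) (s *: derive1 g a).
Proof.
move=> dg; have := leaves_aff (a + s) dg; rewrite addrAC subrr add0r.
rewrite (_ : g \o aff a (a + s) = fun t => g (a + s * t)) //.
by apply/funext => t /=; rewrite /aff; congr g; ring.
Qed.

Lemma leaves_sub f g (x y : R * R) u v : leaves f x u -> leaves g y v ->
  leaves (fun t => f t - g t) (x - y) (u - v).
Proof.
move=> [f0 Hf] [g0 Hg]; split=> [|e e0]; first by rewrite f0 g0.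
have [d1 d10 H1] := Hf (e / 2) ltac:(by rewrite divr_gt0).
have [d2 d20 H2] := Hg (e / 2) ltac:(by rewrite divr_gt0).
have [d d0 /= /and3P[l1 l2 _]] := @lower_bound_pos R [:: d1; d2] ltac:(by rewrite /= d10 d20).
exists d => // t /andP[t0 td].
have -> : f t - g t - (x - y) - t *: (u - v) = (f t - x - t *: u) - (g t - y - t *: v).
  by apply: injective_projections; rewrite /= !scaleE; ring.
apply: le_trans (ler_normB _ _) _.
have := H1 t ltac:(by rewrite t0 (lt_trans td)); have := H2 t ltac:(by rewrite t0 (lt_trans td)).
by clear; lra.
Qed.

(* Near the double point [x0 = g a = g b = g c] the chord between the two
   incoming branches avoids the two outgoing ones. *)
Lemma short_cut g (a b c : R) (x0 : R * R) (u := derive1 g a) (v := derive1 g b) :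
  C1 g -> a < b -> b < c -> g a = x0 -> g b = x0 -> g c = x0 -> derive1 g c = u ->
  det u v != 0 ->
  (forall x, a <= x <= b -> g x = x0 -> x = a \/ x = b) ->
  (forall x, b <= x <= c -> g x = x0 -> x = b \/ x = c) ->
  exists2 e0 : R, 0 < e0 & forall d, 0 < d < e0 ->
    let V := seg (g (c - d)) (g (b - d)) in
    [/\ forall r, 0 <= r <= 1 -> V r <> x0,
        forall r x, 0 <= r <= 1 -> a <= x <= b - d -> V r = g x -> g x = g (b - d) &
        forall r y, 0 <= r <= 1 -> b <= y <= c - d -> V r = g y -> g y = g (c - d)].
Proof.
move=> Cg ab bc ga gb gc uE; rewrite /= => D0 Ha Hc.
have dg (t : R) : derivable g t 1 by exact: Cg.1.
have la := leaves_shift 1 (dg a); have lb := leaves_shift 1 (dg b).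
have lb' := leaves_shift (-1) (dg b); have lc' := leaves_shift (-1) (dg c).
rewrite -/u ga scale1r in la; rewrite -/v gb scale1r in lb.
rewrite -/v gb scaleN1r in lb'; rewrite uE gc scaleN1r in lc'.
have lW := leaves_sub lc' lb'; rewrite subrr in lW.
have vE : derive1 g b = v := erefl.
clearbody u v; pose D := det u v; have DD : 0 < D * D.
  by rewrite -expr2 exprn_even_gt0 // D0 orbT.
(* The linear form [det P] takes the value [D * D] on both [u] and [v]: the outgoing branches are on
   its positive side, the incoming ones and the chord on its negative side. *)
pose P := D *: (u - v).
have Pu : det P u = D * D by rewrite /P /D /det /= !scaleE; ring.
have Pv : det P v = D * D by rewrite /P /D /det /= !scaleE; ring.
have [k1 k10 [d1 d10 H1]] := leaves_cone la (p := P) ltac:(by rewrite Pu).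
have [k2 k20 [d2 d20 H2]] := leaves_cone lb (p := P) ltac:(by rewrite Pv).
have [k3 k30 [d3 d30 H3]] := leaves_cone lb' (p := - P) ltac:(by rewrite detNl detNr opprK Pv).
have [k4 k40 [d4 d40 H4]] := leaves_cone lc' (p := - P) ltac:(by rewrite detNl detNr opprK Pu).
(* The chord has direction close to [v - u], hence is transverse to both incoming branches. *)
have Wv : det (D *: v) (- u - - v) = D * D by rewrite /D /det /= !scaleE; ring.
have Wu : det (D *: u) (- u - - v) = D * D by rewrite /D /det /= !scaleE; ring.
have [k5 k50 [d5 d50 H5]] := leaves_cone lW (p := D *: v) ltac:(by rewrite Wv).
have [k6 k60 [d6 d60 H6]] := leaves_cone lW (p := D *: u) ltac:(by rewrite Wu).
have aD : 0 < `|D| by rewrite normr_gt0.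
have u0 : u != 0 by apply: contraNneq D0 => ->; rewrite /det /= !mul0r subrr.
have v0 : v != 0 by apply: contraNneq D0 => ->; rewrite det0r.
have u0' : derive1 g c != 0 by rewrite uE.
have v0' : derive1 g b != 0 by rewrite vE.
(* Near the double point the chords of each incoming branch have less than the slope of [W]; the
   factor [|D|] comes from the scaled tangents in [k5] and [k6]. *)
have [d7 d70 H7] := C1_local_increment Cg v0' (k := k5 / 2 / `|D|) ltac:(by rewrite !divr_gt0).
have [d8 d80 H8] := C1_local_increment Cg u0' (k := k6 / 2 / `|D|) ltac:(by rewrite !divr_gt0).
rewrite uE in H8; rewrite vE in H7.
have [m m0 /= /and5P[md1 md2 md7 md8 _]] := @lower_bound_pos R [:: d1; d2; d7; d8]
  ltac:(by rewrite /= d10 d20 d70 d80).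
have [n1 n10 N1] := near_value_near_time x0 (a := a) (b := b) (fun t _ => C1_cts t Cg) m0.
have [n2 n20 N2] := near_value_near_time x0 (a := b) (b := c) (fun t _ => C1_cts t Cg) m0.
have [n n0 /= /and3P[nn1 nn2 _]] := @lower_bound_pos R [:: n1; n2] ltac:(by rewrite /= n10 n20).
have [d9 d90 H9] := C1_cts b Cg n0.
have [d10' d10'0 H10] := C1_cts c Cg n0.
rewrite gb in H9; rewrite gc in H10.
have ba0 : 0 < b - a by rewrite subr_gt0.
have cb0 : 0 < c - b by rewrite subr_gt0.
have [e e0] := @lower_bound_pos R [:: d3; d4; d5; d6; m; d9; d10'; b - a; c - b]
  ltac:(by rewrite /= d30 d40 d50 d60 m0 d90 d10'0 ba0 cb0).
rewrite /= => /and5P[ed3 ed4 ed5 ed6 /and5P[em ed9 ed10 eba /andP[ecb _]]].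
exists e => // d /andP[dd0 de]; set V := seg _ _.
have d_itv x : e < x -> 0 <= d < x by move=> ex; rewrite (ltW dd0) (lt_trans de).
have Eb : b + -1 * d = b - d by rewrite mulN1r.
have Ec : c + -1 * d = c - d by rewrite mulN1r.
have nb : `|g (b - d) - x0| < n.
  by apply: H9; rewrite addrAC subrr sub0r normrN gtr0_norm // (lt_trans de).
have nc : `|g (c - d) - x0| < n.
  by apply: H10; rewrite addrAC subrr sub0r normrN gtr0_norm // (lt_trans de).
have nV r : 0 <= r <= 1 -> `|V r - x0| < n by move=> r01; apply: seg_norm_lt.
have fb : det P (g (b - d) - x0) < 0.
  have := H3 d (d_itv _ ed3); rewrite Eb detNl => H; rewrite -oppr_gt0; apply: lt_le_trans H.
  rewrite mulr_gt0 // normr_gt0 subr_eq0; apply/eqP => /Ha [|E|E].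
  - by move: dd0 de eba; clear; lra.
  - by move: dd0 de eba E; clear; lra.
  - by move: dd0 de eba E; clear; lra.
have fc : det P (g (c - d) - x0) < 0.
  have := H4 d (d_itv _ ed4); rewrite Ec detNl => H; rewrite -oppr_gt0; apply: lt_le_trans H.
  rewrite mulr_gt0 // normr_gt0 subr_eq0; apply/eqP => /Hc [|E|E].
  - by move: dd0 de ecb; clear; lra.
  - by move: dd0 de ecb E; clear; lra.
  - by move: dd0 de ecb E; clear; lra.
have fV r : 0 <= r <= 1 -> det P (V r - x0) < 0.
  move=> /andP[r0 r1]; have -> : V r - x0 = (1 - r) *: (g (c - d) - x0) + r *: (g (b - d) - x0).
    by apply: injective_projections; rewrite /V /seg /= !scaleE; ring.
  rewrite detDr !detZr; move: fb fc r0 r1; move: (det P _) (det P _) => A B; clear => h1 h2 r0 r1.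
  have [->|r0'] := eqVneq r 0; first by rewrite subr0 mul1r mul0r addr0.
  have r1' : 0 <= 1 - r by rewrite subr_ge0.
  by rewrite ltr_wnDl ?mulr_ge0_le0 ?(ltW h2) // pmulr_rlt0 // lt_def r0'.
pose W := g (c - d) - g (b - d).
have HW5 : k5 * `|W| <= D * det v W.
  have := H5 d (d_itv _ ed5); rewrite Eb Ec subr0 -/W.
  by rewrite (_ : det (D *: v) W = D * det v W) // /det /= !scaleE; ring.
have HW6 : k6 * `|W| <= D * det u W.
  have := H6 d (d_itv _ ed6); rewrite Eb Ec subr0 -/W.
  by rewrite (_ : det (D *: u) W = D * det u W) // /det /= !scaleE; ring.
(* A multiple [z] of [W] that is also a chord of the branch would satisfy two incompatible slope
   bounds unless it is zero. *)
have chord (k r : R) q z : 0 < k -> k * `|W| <= D * det q W -> z = r *: W ->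
    `|det q z| <= k / 2 / `|D| * `|z| -> z = 0.
  move=> k0 h1 zE; have [r0|r0] := eqVneq r 0; first by rewrite zE r0 scale0r.
  rewrite zE detZr normrM normrZ mulrCA ler_pM2l ?normr_gt0 // => h2.
  have W0 : `|W| <= 0.
    have h3 : `|D| * `|det q W| <= k / 2 * `|W|.
      by rewrite mulrC -ler_pdivlMr // mulrAC.
    have h4 := ler_norm (D * det q W); rewrite normrM in h4.
    have h5 := le_trans h1 (le_trans h4 h3).
    by rewrite -(pmulr_rle0 _ k0); move: h5; clear; lra.
  by move: W0; rewrite normr_le0 => /eqP->; rewrite scaler0.
split=> [r r01 E|r x r01 xI E|r y r01 yI E].
- by have := fV r r01; rewrite E subrr det0r ltxx.
- have xab : a <= x <= b by move: xI dd0; clear; lra.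
  have [|t0 [t0I gt0 xt0]] := N1 x xab; first by rewrite -E (lt_trans (nV _ r01)).
  have [t0a|t0b] := Ha t0 t0I gt0.
    have xa : 0 <= x - a < d1.
      move: xI xt0 md1; rewrite t0a; clear => /andP[h1 _].
      by rewrite ger0_norm ?subr_ge0 // h1 => /lt_trans; apply.
    have := H1 _ xa; rewrite mul1r subrKC -E => h.
    have := fV r r01; rewrite ltNge => /negP[]; apply: le_trans h.
    by rewrite mulr_ge0 // ltW.
  apply/eqP; rewrite -subr_eq0; apply/eqP; apply: (chord k5 (1 - r) v) => //.
    by rewrite -E /V /W; apply: injective_projections; rewrite /seg /= !scaleE; ring.
  have [_ _] := H7 (b - d) x ltac:(by rewrite addrAC subrr sub0r normrN gtr0_norm // (lt_trans de) // (lt_trans em))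
    ltac:(by rewrite -t0b (lt_trans xt0)).
  by [].
- have ybc : b <= y <= c by move: yI dd0; clear; lra.
  have [|t0 [t0I gt0 yt0]] := N2 y ybc; first by rewrite -E (lt_trans (nV _ r01)).
  have [t0b|t0c] := Hc t0 t0I gt0.
    have yb : 0 <= y - b < d2.
      move: yI yt0 md2; rewrite t0b; clear => /andP[h1 _].
      by rewrite ger0_norm ?subr_ge0 // h1 => /lt_trans; apply.
    have := H2 _ yb; rewrite mul1r subrKC -E => h.
    have := fV r r01; rewrite ltNge => /negP[]; apply: le_trans h.
    by rewrite mulr_ge0 // ltW.
  apply/eqP; rewrite -subr_eq0; apply/eqP; apply: (chord k6 (- r) u) => //.
    by rewrite -E /V /W; apply: injective_projections; rewrite /seg /= !scaleE; ring.
  have [_ _] := H8 (c - d) y ltac:(by rewrite addrAC subrr sub0r normrN gtr0_norm // (lt_trans de) // (lt_trans em))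
    ltac:(by rewrite -t0c (lt_trans yt0)).
  by [].
Qed.

(** Without theta, both passes are stopped a time [d] before they return to the letter 0, and [V] is
    the chord of [short_cut]. *)
Lemma realizable_even_noncrossing n (p : 'S_n) g (h : R -> R) :
  (0 < n)%N -> ~~ odd n -> generic_curve g -> circle_diffeo h ->
  (forall s t : R, perm_diagram R p s t <-> curve_diagram g (h s) (h t)) ->
  noncrossing n (pos p).
Proof.
move=> n0 on gg Dh gh; pose T := tau n h; pose m := half n.
have mE : m = n.+1 by rewrite /m /half (negbTE on) addn0.
have Tlt i j : (i < j)%N -> T i < T j by exact: tau_lt.
have m0 : (0 < m)%N by [].
have nm : (n < m)%N by rewrite mE.
have [_ l2] := double_point Dh gh m0; rewrite addn0 -/(T _) -/m in l2.
have TN : T (m + m)%N = T 0%N + 1 by rewrite addnn; exact: tau_period.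
have T0m : T 0%N < T m by exact: Tlt.
have Tm1 : T m < T 0%N + 1 by rewrite -TN; apply: Tlt; rewrite -[ltnLHS]addn0 ltn_add2l.
have AI x x' : T 0%N <= x < T m -> T 0%N <= x' < T m -> g x = g x' -> x = x'.
  exact: (first_pass_inj Dh gh).
have BI x x' : T m <= x < T 0%N + 1 -> T m <= x' < T 0%N + 1 -> g x = g x' -> x = x'.
  exact: (second_pass_inj Dh gh).
have PM x y : T 0%N <= x < T m -> T m <= y < T 0%N + 1 -> g x = g y ->
    exists2 k, (k < m)%N & x = T (pos p k) /\ y = T (m + k)%N.
  exact: (passes_meet Dh gh).
case: (gg) => [[gp gs] g0 gtr _ _].
have [|||e e0 He] := @short_cut g (T 0%N) (T m) (T 0%N + 1) (g (T 0%N))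
  (smooth_C1 gs) T0m Tm1 (erefl _) (esym l2) (gp _) (derive1_periodic gp _).
- apply/transverse_det/gtr => // /circle_eq_near E.
  have E' : T 0%N = T m by apply: E; rewrite ltr_norml; move: T0m Tm1; clear; lra.
  by move: T0m; rewrite E' ltxx.
- move=> x /andP[x0]; rewrite le_eqVlt => /orP[/eqP->|xm]; first by right.
  by left; apply: AI => //; rewrite ?lexx ?x0.
- move=> x /andP[x0]; rewrite le_eqVlt => /orP[/eqP->|xm]; first by right.
  by rewrite l2; left; apply: BI => //; rewrite ?lexx ?x0.
have [d d0 /= /and4P[de dn dmn _]] := @lower_bound_pos R [:: e; T m - T n; T 0%N + 1 - T (m + n)%N]
  ltac:(by rewrite /= e0 !subr_gt0 Tlt //= -TN Tlt // ltn_add2l).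
have [|V1 V2 V3] := He d; first by rewrite d0.
have Acl x : T 0%N <= x <= T m - d -> T 0%N <= x < T m by move: d0; clear; lra.
have Bcl x : T m <= x <= T 0%N + 1 - d -> T m <= x < T 0%N + 1 by move: d0; clear; lra.
have T0n : T 0%N <= T n by exact: tau_le.
have Tmn : T m <= T (m + n)%N by apply: tau_le => //; exact: leq_addr.
apply: (arc_system_noncrossing (curve_arc_system (se := T m - d) (te := T 0%N + 1 - d)
  (V := seg (g (T 0%N + 1 - d)) (g (T m - d))) n0 gg Dh gh _ _ _ _ _ _ _ _ _ _ _)).
- by move: dn; rewrite -/T; clear; lra.
- by rewrite ltrBlDr ltrDl.
- by move: dmn; rewrite -/T; clear; lra.
- by rewrite ltrBlDr ltrDl.
- move=> x y /Acl xI /Bcl yI /(PM _ _ xI yI) [k km [xE yE]].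
  have kn : (k <= n)%N by rewrite -ltnS -mE.
  have pn : (pos p k <= n)%N by rewrite -ltnS -mE; exact: pos_lt_half.
  by exists k; rewrite ?leqW // kn pn.
- exact: path_seg.
- exact: seg0.
- exact: seg1.
- move=> r x r01 xI E; apply: AI; [exact: Acl|apply: Acl; move: dn T0n; clear; lra|].
  exact: V2 E.
- move=> r y r01 yI E; apply: BI; [exact: Bcl|apply: Bcl; move: dmn Tmn; clear; lra|].
  exact: V3 E.
- exact: V1.
Qed.

Theorem realizable_noncrossing n (p : 'S_n) : (0 < n)%N ->
  realizable (perm_diagram R p) -> noncrossing n (pos p).
Proof.
move=> n0 [g gg [h Dh gh]]; case on : (odd n).
  exact: realizable_odd_noncrossing n0 on gg Dh gh.
by apply: realizable_even_noncrossing n0 _ gg Dh gh; rewrite on.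
Qed.

End ShortCut.

(** * Paths on the unit circle *)

Section CirclePaths.
Variable R : realType.
Implicit Types (q z d u v w : R * R) (r : R).

Lemma unit_circleE q : unit_circle R q <-> dot q q = 1.
Proof. by rewrite /unit_circle /dot /= !expr2. Qed.

(* The second point of the unit circle on the line through [q] directed by [d]. *)
Definition second_point q d := q - (2 * dot q d / dot d d) *: d.

Lemma second_point_circle q d : dot q q = 1 -> d != 0 ->
  dot (second_point q d) (second_point q d) = 1.
Proof.
move=> q1 /dot_gt0; rewrite /second_point; set c := dot d d => c0.
have -> : dot (q - (2 * dot q d / c) *: d) (q - (2 * dot q d / c) *: d) =
    dot q q - 2 * (2 * dot q d / c) * dot q d + (2 * dot q d / c) ^+ 2 * c.
  by rewrite /c /dot /= !scaleE; ring.
by rewrite q1; field; rewrite gt_eqF.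
Qed.

Lemma dot_chord_lt0 q z : dot q q = 1 -> dot z z = 1 -> q != z -> dot q (z - q) < 0.
Proof.
move=> q1 z1; rewrite eq_sym -subr_eq0 => /dot_gt0.
have -> : dot (z - q) (z - q) = dot z z + dot q q - 2 * dot q z.
  by rewrite /dot /=; ring.
by rewrite dotBr q1 z1; lra.
Qed.

Lemma second_point_chord q z : dot q q = 1 -> dot z z = 1 -> q != z ->
  second_point q (z - q) = z.
Proof.
move=> q1 z1 qz; have neg := dot_chord_lt0 q1 z1 qz.
rewrite /second_point; have -> : dot (z - q) (z - q) = - (2 * dot q (z - q)).
  have -> : dot (z - q) (z - q) = dot z z + dot q q - 2 * dot q z by rewrite /dot /=; ring.
  by rewrite dotBr q1 z1; ring.
rewrite invrN mulrN divff; last by apply: mulf_neq0; [rewrite pnatr_eq0|rewrite lt_eqF].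
by rewrite scaleN1r opprK addrC subrK.
Qed.

Lemma second_point_tangent q d : dot q d = 0 -> second_point q d = q.
Proof. by rewrite /second_point => ->; rewrite mulr0 mul0r scale0r subr0. Qed.

Lemma det_second_point q d u : det u (second_point q d - q) =
  - (2 * dot q d / dot d d) * det u d.
Proof. by rewrite /second_point addrAC subrr sub0r detNr detZr mulNr. Qed.

(** Turning a line through [q] from direction [d0] to [d1] moves its second point along the circle:
    a rational motion, without angles. *)
Definition circle_path q d0 d1 r := second_point q (seg d0 d1 r).

Lemma circle_path_path q d0 d1 :
  (forall r, 0 <= r <= 1 -> seg d0 d1 r != 0) -> path01 (circle_path q d0 d1).
Proof.
move=> H r r01; have /dot_gt0 dd := H r r01.
have Hs : cts_at (seg d0 d1) r by exact: path_seg.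
apply/cts_atP; rewrite /circle_path /second_point.
have h1 : {for r, continuous (seg d0 d1)} by apply/cts_atP.
have dotc (f g : R -> R * R) : {for r, continuous f} -> {for r, continuous g} ->
    {for r, continuous (fun x => dot (f x) (g x))}.
  move=> hf hg; rewrite /dot.
  have c1 (k : R -> R * R) : {for r, continuous k} -> {for r, continuous (fun x => (k x).1)}.
    by move=> hk; exact: (cvg_comp _ _ hk (@cvg_fst _ _ (nbhs (k r).1) (nbhs (k r).2) _)).
  have c2 (k : R -> R * R) : {for r, continuous k} -> {for r, continuous (fun x => (k x).2)}.
    by move=> hk; exact: (cvg_comp _ _ hk (@cvg_snd _ _ (nbhs (k r).1) (nbhs (k r).2) _)).
  by apply: cvgD; apply: cvgM; [exact: c1|exact: c1|exact: c2|exact: c2].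
apply: cvgB; first exact: cvg_cst.
apply: cvgZ; last exact: h1.
apply: cvgM; first by apply: cvgM; [exact: cvg_cst|apply: dotc => //; exact: cvg_cst].
by apply: cvgV; [rewrite gt_eqF|exact: dotc].
Qed.

Lemma segE d0 d1 r : seg d0 d1 r = (1 - r) *: d0 + r *: d1.
Proof. by apply: injective_projections; rewrite /seg /= !scaleE; ring. Qed.

Lemma seg_neq0 q d0 d1 r : dot q d0 < 0 -> dot q d1 <= 0 -> (dot q d1 = 0 -> d1 != 0) ->
  0 <= r <= 1 -> seg d0 d1 r != 0 /\ dot q (seg d0 d1 r) <= 0.
Proof.
move=> h0 h1 h2 /andP[r0 r1]; rewrite segE.
have E : dot q ((1 - r) *: d0 + r *: d1) = (1 - r) * dot q d0 + r * dot q d1.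
  by rewrite dotDr !dotZr.
have t0 : 0 <= 1 - r by rewrite subr_ge0.
have le1 : (1 - r) * dot q d0 <= 0 by rewrite mulr_ge0_le0 // ltW.
have le2 : r * dot q d1 <= 0 by rewrite mulr_ge0_le0.
split; last by rewrite E -(addr0 0) lerD.
have [E1|r1'] := eqVneq r 1.
  rewrite E1 subrr scale0r add0r scale1r.
  have [/h2 //|d1'] := eqVneq (dot q d1) 0.
  by apply: contraNneq d1' => ->; rewrite /dot /= !mulr0 addr0.
apply/eqP => E0; have : dot q ((1 - r) *: d0 + r *: d1) = 0.
  by rewrite E0 /dot /= !mulr0 addr0.
have lt1 : (1 - r) * dot q d0 < 0 by rewrite pmulr_rlt0 // subr_gt0 lt_neqAle r1'.
by rewrite E; move: lt1 le2; clear; lra.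
Qed.

Definition perp q := (- q.2, q.1).

Lemma dot_perp q : dot q (perp q) = 0.
Proof. by rewrite /dot /perp /=; ring. Qed.

Lemma perp_neq0 q : dot q q = 1 -> perp q != 0.
Proof.
case: q => a b; rewrite /dot /perp /= => H; apply/eqP => -[/eqP].
rewrite oppr_eq0 => /eqP b0 a0; move: H; rewrite a0 b0 !mulr0 addr0.
by move=> /eqP; rewrite eq_sym oner_eq0.
Qed.

(* a path on the circle from [z] to [q], on a prescribed side of the chord *)
Lemma circle_path_to q z (sgn : R) : dot q q = 1 -> dot z z = 1 -> q != z ->
  exists U : R -> R * R, [/\ path01 U, U 0 = z, U 1 = q &
    forall r, 0 <= r <= 1 -> dot (U r) (U r) = 1 /\ 0 <= sgn * det (z - q) (U r - q)].
Proof.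
move=> q1 z1 qz; have neg := dot_chord_lt0 q1 z1 qz.
(* Of the two tangent directions at [q], the one pointing to the prescribed side; in the limit the
   second point is [q] itself. *)
pose s : R := if 0 <= sgn * det (z - q) (perp q) then 1 else -1.
have s0 : 0 <= sgn * det (z - q) (s *: perp q).
  rewrite detZr /s; case: ifP => h; first by rewrite mul1r.
  by rewrite mulN1r mulrN oppr_ge0 ltW // ltNge h.
have s1 : s != 0 by rewrite /s; case: ifP; rewrite ?oner_eq0 // oppr_eq0 oner_eq0.
have T0 : dot q (s *: perp q) = 0 by rewrite dotZr dot_perp mulr0.
have T1 : s *: perp q != 0 by rewrite scaler_eq0 negb_or s1 perp_neq0.
have H r : 0 <= r <= 1 -> seg (z - q) (s *: perp q) r != 0 /\ dot q (seg (z - q) (s *: perp q) r) <= 0.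
  by apply: seg_neq0 => //; rewrite T0.
exists (circle_path q (z - q) (s *: perp q)); split.
- by apply: circle_path_path => r /H [].
- by rewrite /circle_path seg0 second_point_chord.
- by rewrite /circle_path seg1 second_point_tangent.
move=> r r01; have [h1 h2] := H r r01; split; first exact: second_point_circle.
rewrite /circle_path det_second_point.
have E : det (z - q) (seg (z - q) (s *: perp q) r) = r * det (z - q) (s *: perp q).
  rewrite segE detDr !detZr; have -> : det (z - q) (z - q) = 0 by rewrite /det; ring.
  by rewrite mulr0 add0r.
rewrite E; move: s0; set D := det _ (s *: _) => s0.
have k0 : 0 <= - (2 * dot q (seg (z - q) (s *: perp q) r) /
     dot (seg (z - q) (s *: perp q) r) (seg (z - q) (s *: perp q) r)).
  rewrite -mulNr divr_ge0 //; last exact/ltW/dot_gt0.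
  by rewrite oppr_ge0 mulr_ge0_le0.
rewrite (_ : sgn * _ = (- (2 * dot q (seg (z - q) (s *: perp q) r) /
     dot (seg (z - q) (s *: perp q) r) (seg (z - q) (s *: perp q) r))) * (r * (sgn * D))); last by ring.
by apply: mulr_ge0 => //; apply: mulr_ge0 => //; case/andP: r01.
Qed.

(* a path on the circle joining two points on the same side of a chord from [q] *)
Lemma circle_path_between q d z w (sgn : R) : dot q q = 1 -> dot z z = 1 -> dot w w = 1 ->
  q != z -> q != w -> 0 < sgn * det d (z - q) -> 0 < sgn * det d (w - q) ->
  exists V : R -> R * R, [/\ path01 V, V 0 = z, V 1 = w &
    forall r, 0 <= r <= 1 -> dot (V r) (V r) = 1 /\ 0 < sgn * det d (V r - q)].
Proof.
move=> q1 z1 w1 qz qw zs ws; have negz := dot_chord_lt0 q1 z1 qz.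
have negw := dot_chord_lt0 q1 w1 qw.
have H r : 0 <= r <= 1 -> seg (z - q) (w - q) r != 0 /\ dot q (seg (z - q) (w - q) r) <= 0.
  apply: seg_neq0 => //; first exact: ltW.
  by move=> E; move: negw; rewrite E ltxx.
exists (circle_path q (z - q) (w - q)); split.
- by apply: circle_path_path => r /H [].
- by rewrite /circle_path seg0 second_point_chord.
- by rewrite /circle_path seg1 second_point_chord.
move=> r r01; have [h1 h2] := H r r01; split; first exact: second_point_circle.
rewrite /circle_path det_second_point mulrCA.
have bnd (F : R * R -> R) (a b : R) : (forall u v, F (u + v) = F u + F v) ->
  (forall (c : R) u, F (c *: u) = c * F u) -> 0 < F (z - q) -> 0 < F (w - q) ->
  0 < F (seg (z - q) (w - q) r).
  move=> FD FZ f1 f2; rewrite segE FD !FZ; case/andP: r01 => r0 r1.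
  have [->|r0'] := eqVneq r 0; first by rewrite subr0 mul1r mul0r addr0.
  by rewrite ltr_wpDl ?mulr_ge0 ?subr_ge0 ?(ltW f1) // mulr_gt0 // lt_def r0'.
rewrite mulr_gt0 //.
  rewrite -mulNr divr_gt0 //; last exact: dot_gt0.
  rewrite -mulrN mulr_gt0 //.
  apply: (bnd (fun u => - dot q u)) => //; rewrite ?oppr_gt0 //.
    by move=> u v; rewrite dotDr opprD.
  by move=> c u; rewrite dotZr mulrN.
apply: (bnd (fun u => sgn * det d u)) => //.
  by move=> u v; rewrite detDr mulrDr.
by move=> c u; rewrite detZr mulrCA.
Qed.

(** If [u] is not [q], then [u] and [z] are second points of the same line through [q], and the
    second point does not depend on the length of the direction. *)
Lemma chord_meets_circle q z u : dot q q = 1 -> dot z z = 1 -> q != z ->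
  dot u u = 1 -> det (z - q) (u - q) = 0 -> u = q \/ u = z.
Proof.
move=> q1 z1 qz u1 D0; have [->|uq] := eqVneq u q; first by left.
right; have h1 := second_point_chord q1 z1 qz.
rewrite eq_sym in uq; have h2 := second_point_chord q1 u1 uq.
rewrite -h1 -h2; have dz : z - q != 0 by rewrite subr_eq0 eq_sym.
have cc := dot_gt0 dz; set c := dot (u - q) (z - q) / dot (z - q) (z - q).
have uE : u - q = c *: (z - q).
  apply/eqP; rewrite -subr_eq0; apply/eqP; apply: (dot_det_eq0 dz).
    rewrite dotBr dotZr /c divfK ?gt_eqF //.
    by rewrite /dot [X in X + _ - _]mulrC [X in _ + X - _]mulrC subrr.
  rewrite detBr detZr D0; have -> : det (z - q) (z - q) = 0 by rewrite /det; ring.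
  by rewrite mulr0 subr0.
have c0 : c != 0.
  by apply: contraNneq uq => c0; move: uE; rewrite c0 scale0r => /eqP; rewrite subr_eq0 eq_sym.
rewrite uE /second_point; congr (_ - _).
have -> : dot q (c *: (z - q)) = c * dot q (z - q) by rewrite dotZr.
have -> : dot (c *: (z - q)) (c *: (z - q)) = c * c * dot (z - q) (z - q).
  by rewrite /dot /= !scaleE; ring.
rewrite scalerA; congr (_ *: _); field.
by rewrite c0 gt_eqF.
Qed.

(** The determinant against the chord is continuous and on the circle vanishes only at [m0] and
    [p0], so its sign is constant on a component of the rest. *)
Lemma same_side_of_chord m0 p0 m1 p1 :
  unit_circle R m0 -> unit_circle R p0 -> m0 != p0 ->
  (exists2 x, (unit_circle R `\` [set m0; p0]) x &
    let C := connected_component (unit_circle R `\` [set m0; p0]) x in C m1 /\ C p1) ->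
  0 < det (p0 - m0) (m1 - m0) * det (p0 - m0) (p1 - m0).
Proof.
move=> /unit_circleE cm0 /unit_circleE cp0 mp [x _ /= [Cm Cp]].
set C := connected_component _ x in Cm Cp.
pose F u := det (p0 - m0) (u - m0).
have CF u : C u -> F u != 0.
  move=> /connected_component_sub [/unit_circleE cu nu]; apply/eqP => Fu; apply: nu.
  by case: (chord_meets_circle cm0 cp0 mp cu Fu) => ->; [left|right].
have Fc : continuous F.
  move=> u; rewrite /F /det /=.
  apply: cvgB; (apply: cvgM; [exact: cvg_cst|apply: cvgB; [|exact: cvg_cst]]).
    exact: (@cvg_snd _ _ (nbhs u.1) (nbhs u.2) _).
  exact: (@cvg_fst _ _ (nbhs u.1) (nbhs u.2) _).
have : connected (F @` C).
  apply: connected_continuous_connected; first exact: component_connected.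
  exact: continuous_subspaceT.
move=> /connected_intervalP FI.
have no_sep u v : C u -> C v -> F u < 0 -> 0 < F v -> False.
  move=> Cu Cv Fu Fv; have [|||w Cw Fw] := FI (F u) (F v) _ _ 0.
  - by exists u.
  - by exists v.
  - by rewrite (ltW Fu) (ltW Fv).
  by have := CF w Cw; rewrite Fw eqxx.
rewrite -/(F m1) -/(F p1).
have := CF _ Cm; have := CF _ Cp; rewrite !neq_lt => /orP[p_|p_] /orP[m_|m_].
- by rewrite nmulr_rgt0.
- by case: (no_sep _ _ Cp Cm).
- by case: (no_sep _ _ Cm Cp).
- by rewrite mulr_gt0.
Qed.

End CirclePaths.

(** * From a meander to an arc system *)

Section MeanderToArcs.
Variable R : realType.

(** Extends the crossing times by 0 and 1, the times of the two ends, with the same index shift as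
    [pos]. *)
Definition times n (f : 'I_n -> R) (k : nat) : R :=
  if k is k'.+1 then (if insub k' is Some i then f i else 1) else 0.
Arguments times : simpl never.

Lemma timesS n (f : 'I_n -> R) (i : 'I_n) : times f i.+1 = f i.
Proof. by rewrite /times insubT //= => lt; congr f; apply: val_inj. Qed.

Lemma times_n n (f : 'I_n -> R) : times f n.+1 = 1.
Proof. by rewrite /times insubF // ltnn. Qed.

Lemma times_lt n (f : 'I_n -> R) : (forall i, 0 < f i < 1) ->
  (forall i j : 'I_n, (i < j)%N -> f i < f j) ->
  forall k, (k <= n)%N -> times f k < times f k.+1.
Proof.
move=> f01 fI [|k] kn.
  have [n0|n0] := posnP n.
    by rewrite /times insubF ?n0 // ltr01.
  by rewrite (timesS f (Ordinal n0)); case/andP: (f01 (Ordinal n0)).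
rewrite (timesS f (Ordinal kn)); have [kn'|kn'] := ltnP k.+1 n.
  by rewrite (timesS f (Ordinal kn')); exact: fI.
have -> : k.+1 = n by apply/eqP; rewrite eqn_leq kn.
by rewrite times_n; case/andP: (f01 (Ordinal kn)).
Qed.

Lemma met_along_times n (f : R -> R * R) A (x : 'I_n -> R * R) :
  (forall u v : R, 0 <= u <= 1 -> 0 <= v <= 1 -> f u = f v -> u = v) ->
  ~ A (f 0) -> ~ A (f 1) -> met_along f A x ->
  exists tx : 'I_n -> R, [/\ forall i, 0 < tx i < 1,
    forall i j : 'I_n, (i < j)%N -> tx i < tx j, forall i, f (tx i) = x i & range x = A].
Proof.
move=> fI A0 A1 [xA [tx [t01 tI tE]]]; exists tx; split=> // i.
have Ax : A (x i) by rewrite -xA; exists i.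
case/andP: (t01 i) => h0 h1; rewrite !lt_neqAle h0 h1 !andbT; apply/andP; split; apply/eqP => E.
  by apply: A0; rewrite E tE.
by apply: A1; rewrite -E tE.
Qed.

Lemma det_neq0C (u v : R * R) : det u v != 0 -> det v u != 0.
Proof. by apply: contraNneq => h; apply/eqP; rewrite -oppr0 -h /det; ring. Qed.

(** [A] is [ell], [B] is [mu], and the auxiliary paths run on the circle, which the two arcs meet
    only at their ends. [U] and [V] are disjoint because [V] stays strictly on the side of the chord
    from [m0] to [p0] that contains [m1] and [p1], and [U] on the other. *)
Lemma meandric_noncrossing n (p : 'S_n) : (0 < n)%N ->
  meandric R p -> noncrossing n (pos p).
Proof.
move=> n0 [M [x [y [mx my xy]]]]; move: mx my.
case: M => m0 m1 p0 p1 mu ell [bm0 bm1 bp0 bp1] dist comp [smu mu0 muI mud muc] [sell ell0 ellI elld ellc]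
  [mue0 mue1] [elle0 elle1] tr _ /= mx my.
have bd q (f : R -> R * R) (t : R) : unit_circle R q -> 
    (forall t : R, 0 <= t <= 1 -> (unit_circle R (f t) <-> t = 0 \/ t = 1)) ->
    0 <= t <= 1 -> q = f t -> t = 0 \/ t = 1.
  by move=> cq fc t01 E; apply/fc => //; rewrite -E.
have [d1 d2 d3] : [/\ m0 != m1, m0 != p0 & m0 != p1].
  by move: dist; rewrite /= !inE !negb_or => /andP[/and3P[]].
have [d4 d5 d6] : [/\ m1 != p0, m1 != p1 & p0 != p1].
  by move: dist; rewrite /= !inE !negb_or => /and3P[_ /andP[? ?] /andP[? _]].
have z01 : 0 <= (0 : R) <= 1 by rewrite lexx ler01.
have o01 : 0 <= (1 : R) <= 1 by rewrite lexx ler01.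
have Aell : forall t : R, (t = 0) \/ (t = 1) -> ~ arcs_meet mu ell (ell t).
  move=> t tE [[r r01 E] _]; have cq : unit_circle R (ell t).
    by case: tE => ->; rewrite ?elle0 ?elle1.
  move: r01; rewrite /= in_itv /= => r01.
  have [rE|rE] := bd _ mu r cq muc r01 (esym E); move: E; rewrite rE ?mue0 ?mue1;
    case: tE => ->; rewrite ?elle0 ?elle1 => E.
  - by rewrite E eqxx in d2.
  - by rewrite E eqxx in d3.
  - by rewrite E eqxx in d4.
  - by rewrite E eqxx in d5.
have Amu : forall t : R, (t = 0) \/ (t = 1) -> ~ arcs_meet mu ell (mu t).
  move=> t tE [_ [r r01 E]]; have cq : unit_circle R (mu t).
    by case: tE => ->; rewrite ?mue0 ?mue1.
  move: r01; rewrite /= in_itv /= => r01.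
  have [rE|rE] := bd _ ell r cq ellc r01 (esym E); move: E; rewrite rE ?elle0 ?elle1;
    case: tE => ->; rewrite ?mue0 ?mue1 => E.
  - by rewrite E eqxx in d2.
  - by rewrite E eqxx in d4.
  - by rewrite E eqxx in d3.
  - by rewrite E eqxx in d5.
have [sx [sx01 sxI sxE xA]] := met_along_times ellI (Aell 0 (or_introl erefl)) (Aell 1 (or_intror erefl)) mx.
have [ty [ty01 tyI tyE yA]] := met_along_times muI (Amu 0 (or_introl erefl)) (Amu 1 (or_intror erefl)) my.
have cl (f : 'I_n -> R) i : (forall i, 0 < f i < 1) -> 0 <= f i <= 1.
  by move=> H; case/andP: (H i) => /ltW-> /ltW->.
have xI i j : x i = x j -> i = j.
  rewrite -!sxE => /(ellI _ _ (cl _ _ sx01) (cl _ _ sx01)) E.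
  apply: val_inj; case: (ltngtP i j) => // /sxI; by rewrite E ltxx.
have side := same_side_of_chord bm0 bp0 d2 comp.
have [c1 c2 c3 c4] : [/\ dot m0 m0 = 1, dot p0 p0 = 1, dot m1 m1 = 1 & dot p1 p1 = 1].
  by split; apply/unit_circleE.
pose sg := det (p0 - m0) (m1 - m0).
have sg0 : 0 < sg * det (p0 - m0) (m1 - m0).
  have : sg != 0 by apply: contraTneq side => sg0; rewrite -/sg sg0 mul0r ltxx.
  by rewrite -/sg => h; rewrite -expr2 exprn_even_gt0 // h orbT.
have [V [Vc V0 V1 VE]] := circle_path_between c1 c3 c4 d1 d3 sg0 side.
(* The sign [- sg] keeps [U] away from [m1], [p1] and [V]. For [Z], below, the sign 1 is an
   arbitrary choice of one of the two circle arcs. *)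
have [U' [Uc' U0' U1' UE']] := circle_path_to (- sg) c1 c2 d2.
have [Z [Zc Z0 Z1 ZE]] := circle_path_to 1 c2 c4 d6.
have r1 (r : R) : 0 <= r <= 1 -> 0 <= 1 - r <= 1 by clear; lra.
pose U r := U' (1 - r).
have UE r : 0 <= r <= 1 -> dot (U r) (U r) = 1 /\ sg * det (p0 - m0) (U r - m0) <= 0.
  by move=> /r1 /UE' [h1 h2]; split=> //; rewrite -oppr_ge0 -mulNr.
have Unot r q : 0 <= r <= 1 -> 0 < sg * det (p0 - m0) (q - m0) -> U r <> q.
  by move=> /UE [_ +] + E; rewrite E => h1 h2; move: (le_lt_trans h1 h2); rewrite ltxx.
have Vnot r q : 0 <= r <= 1 -> sg * det (p0 - m0) (q - m0) <= 0 -> V r <> q.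
  by move=> /VE [_ +] + E; rewrite E => h1 h2; move: (lt_le_trans h1 h2); rewrite ltxx.
have m0neg : sg * det (p0 - m0) (m0 - m0) <= 0 by rewrite subrr det0r mulr0.
have p0neg : sg * det (p0 - m0) (p0 - m0) <= 0.
  by have -> : det (p0 - m0) (p0 - m0) = 0 by [rewrite /det; ring|]; rewrite mulr0.
pose s := times sx; pose t := times ty.
have s0 : s 0%N = 0 by []. have t0 : t 0%N = 0 by [].
have s1 : s n.+1 = 1 by exact: times_n. have t1 : t n.+1 = 1 by exact: times_n.
have sS := times_lt sx01 sxI; have tS := times_lt ty01 tyI.
have inner (f : 'I_n -> R) z : (forall i, 0 < f i < 1) -> (forall i j : 'I_n, (i < j)%N -> f i < f j) ->
   times f 1 <= z <= times f n -> 0 < z < 1.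
  move=> f01 fI; have h1 : 0 < times f 1 := times_lt f01 fI (leq0n n); have h2 := times_lt f01 fI (leqnn n).
  by rewrite times_n in h2; move: h1 h2; clear; lra.
have incl (z : R) : 0 < z < 1 -> 0 <= z <= 1 by clear; lra.
have offc (f : R -> R * R) z q : (forall t : R, 0 <= t <= 1 -> (unit_circle R (f t) <-> t = 0 \/ t = 1)) ->
    0 < z < 1 -> dot q q = 1 -> q <> f z.
  move=> fc zI /unit_circleE cq E.
  by have [E'|E'] := bd q f z cq fc (incl _ zI) E; move: zI; rewrite E' ltxx ?andbF.
have crossE k : (0 < k <= n)%N -> exists i : 'I_n, [/\ k = i.+1, s (pos p k) = sx (p i) & t k = ty i].
  case: k => // k kn; exists (Ordinal kn); split=> //.
    by rewrite (posS p (Ordinal kn)) /s timesS.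
  by rewrite /t -(timesS ty (Ordinal kn)).
have AB z w : 0 <= z <= 1 -> 0 <= w <= 1 -> ell z = mu w ->
    exists2 k, (0 < k <= n)%N & z = s (pos p k) /\ w = t k.
  move=> z1 w1 E; have Az : arcs_meet mu ell (ell z).
    by split; [exists w|exists z]; rewrite /= ?in_itv.
  have [k _ yk] : range y (ell z) by rewrite yA.
  exists k.+1; first exact: ltn_ord.
  have [i [[ki] -> ->]] := crossE k.+1 (ltn_ord k).
  have -> : i = k by apply: val_inj.
  split.
    by apply: ellI => //; [exact: cl|rewrite sxE -xy yk].
  by apply: muI => //; [exact: cl|rewrite tyE yk E].
apply: (@arc_system_noncrossing R n (pos p) ell mu s t 1 U V Z); apply: ArcSystem; rewrite ?s0 ?s1 ?t0 ?t1.
- by [].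
- exact: pos_n.
- exact: pos_itv.
- exact: pos_inj.
- exact: smooth_C1.
- exact: smooth_C1.
- exact: ell0.
- exact: sS.
- exact: tS.
- exact: lexx.
- move=> k kn; have [i [_ -> ->]] := crossE k kn.
  by rewrite sxE tyE xy.
- move=> k kn; have [i [_ -> ->]] := crossE k kn.
  have E : mu (ty i) = ell (sx (p i)) by rewrite sxE tyE xy.
  exact: det_neq0C (transverse_det (tr _ _ (cl _ _ ty01) (cl _ _ sx01) E)).
- move=> z w z1 w1 /(AB _ _ z1 w1) [k /andP[_ kn] H]; exists k => //; exact: leqW.
- exact: ellI.
- exact: muI.
- move=> r r01; apply: (@cts_at_comp _ _ U' (fun r => 1 - r)); last exact/Uc'/r1.
  apply: (@lipschitz_cts_at _ _ _ _ 1) => r'; rewrite mul1r distrC.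
  by rewrite (_ : 1 - r - (1 - r') = r' - r) //; ring.
- by rewrite /U subr0 U1' mue0.
- by rewrite /U subrr U0' elle0.
- move=> r z r01 zI E; have [h1 _] := UE r r01.
  have [//|z1] := bd _ ell z ((unit_circleE _).2 h1) ellc zI E.
  by case: (Unot r p1 r01 side); rewrite E z1 elle1.
- move=> r z r01 zI E; have [h1 _] := UE r r01.
  have [//|z1] := bd _ mu z ((unit_circleE _).2 h1) muc zI E.
  by case: (Unot r m1 r01 sg0); rewrite E z1 mue1.
- exact: Vc.
- by rewrite V0 mue1.
- by rewrite V1 elle1.
- move=> r z r01 zI E; have [h1 _] := VE r r01.
  have [z1|//] := bd _ ell z ((unit_circleE _).2 h1) ellc zI E.
  by case: (Vnot r p0 r01 p0neg); rewrite E z1 elle0.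
- move=> r z r01 zI E; have [h1 _] := VE r r01.
  have [z1|//] := bd _ mu z ((unit_circleE _).2 h1) muc zI E.
  by case: (Vnot r m0 r01 m0neg); rewrite E z1 mue0.
- by move=> r r' r01 r01'; have [_ h] := VE r' r01'; exact: Unot.
- exact: Zc.
- by rewrite Z0 elle1.
- by rewrite Z1 elle0.
- move=> r z r01 zI; have [h1 _] := ZE r r01.
  by apply: offc ellc _ h1; apply: inner zI.
- move=> r z r01 zI; have [h1 _] := ZE r r01.
  by apply: offc muc _ h1; apply: inner zI.
- move=> z z' /(inner _ _ sx01 sxI) /incl h1 h2 E; exact: ellI.
- by move=> z w h1 /(inner _ _ ty01 tyI) /incl h2; exact: AB.
Qed.

End MeanderToArcs.

(** * Closure properties of smooth functions *)

Section SmoothCalculus.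
Variable R : realType.
Implicit Types (f g : R -> R).

(** Smoothness cut at a finite order, so that closure properties go by induction on the order. *)
Definition Cn (V : normedModType R) (k : nat) (f : R -> V) : Prop :=
  forall j, (j <= k)%N -> forall x : R, derivable (derive1n j f) x 1.

Lemma CnS (V : normedModType R) k (f : R -> V) :
  Cn k.+1 f <-> (forall x : R, derivable f x 1) /\ Cn k (derive1 f).
Proof.
split=> [H|[H0 H1]].
  split=> [|j jk]; first exact: (H 0%N).
  by move=> x; have := H j.+1 jk x; rewrite derive1Sn.
move=> [|j] jk x; first exact: H0.
by rewrite derive1Sn; exact: H1.
Qed.

Lemma Cn_derivable (V : normedModType R) k (f : R -> V) : Cn k f -> forall x : R, derivable f x 1.
Proof. by move=> H; exact: (H 0%N). Qed.

Lemma CnW (V : normedModType R) k (f : R -> V) : Cn k.+1 f -> Cn k f.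
Proof. by move=> H j jk; apply: H; exact: leqW. Qed.

Lemma smooth_Cn (V : normedModType R) (f : R -> V) : smooth f <-> forall k, Cn k f.
Proof. by split=> [H k j _|H k]; [exact: H|exact: (H k k (leqnn k))]. Qed.

Lemma derive1E_is (V : normedModType R) (f : R -> V) (df : R -> V) :
  (forall x : R, is_derive x 1 f (df x)) -> derive1 f = df.
Proof. by move=> H; apply/funext => x; rewrite derive1E; case: (H x). Qed.

Lemma Cn_is_derive (V : normedModType R) k (f df : R -> V) :
  (forall x : R, is_derive x 1 f (df x)) -> Cn k df -> Cn k.+1 f.
Proof.
move=> H dfk; apply/CnS; split; first by move=> x; case: (H x).
by rewrite (derive1E_is H).
Qed.

Lemma is_derive1P (V : normedModType R) (f : R -> V) :
  (forall x : R, derivable f x 1) -> forall x : R, is_derive x 1 f (derive1 f x).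
Proof. by move=> H x; split; [exact: H|rewrite derive1E]. Qed.

Lemma Cn_cst (V : normedModType R) k (a : V) : Cn k (fun _ : R => a).
Proof.
elim: k a => [|k IH] a.
  by move=> j; rewrite leqn0 => /eqP-> x; exact: derivable_cst.
by apply: (@Cn_is_derive _ _ _ (fun=> 0)) => // x; exact: is_derive_cst.
Qed.

Lemma CnD (V : normedModType R) k (f g : R -> V) : Cn k f -> Cn k g -> Cn k (fun x => f x + g x).
Proof.
elim: k f g => [|k IH] f g Hf Hg.
  move=> j; rewrite leqn0 => /eqP-> x.
  by apply: derivableD; [exact: (Cn_derivable Hf)|exact: (Cn_derivable Hg)].
have [f1 f2] := (CnS _ _).1 Hf; have [g1 g2] := (CnS _ _).1 Hg.
apply: (@Cn_is_derive _ _ _ (fun x => derive1 f x + derive1 g x)); last exact: (IH _ _ f2 g2).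
by move=> x; exact: (is_deriveD (is_derive1P f1 x) (is_derive1P g1 x)).
Qed.

Lemma CnM k f g : Cn k f -> Cn k g -> Cn k (fun x => f x * g x).
Proof.
elim: k f g => [|k IH] f g Hf Hg.
  move=> j; rewrite leqn0 => /eqP-> x.
  by apply: derivableM; [exact: (Cn_derivable Hf)|exact: (Cn_derivable Hg)].
have [f1 f2] := (CnS _ _).1 Hf; have [g1 g2] := (CnS _ _).1 Hg.
apply: (@Cn_is_derive _ _ _ (fun x => f x * derive1 g x + g x * derive1 f x)).
  by move=> x; exact: (is_deriveM (is_derive1P f1 x) (is_derive1P g1 x)).
apply: CnD; apply: IH; [exact: (CnW Hf)|exact: g2|exact: (CnW Hg)|exact: f2].
Qed.

Lemma Cn_sum (V : normedModType R) k n (F : nat -> R -> V) :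
  (forall i, (i < n)%N -> Cn k (F i)) -> Cn k (fun x => \sum_(i < n) F i x).
Proof.
elim: n => [|n IH] H.
  by under eq_fun do rewrite big_ord0; exact: Cn_cst.
under eq_fun do rewrite big_ord_recr /=.
by apply: CnD; [apply: IH => i /leqW; exact: H|exact: H].
Qed.

Lemma is_derive_affine (a b x : R) : is_derive x 1 (fun x : R => a * x + b) a.
Proof.
have := is_deriveD (is_deriveZ a (is_derive_id x (1 : R))) (is_derive_cst b x (1 : R)).
by rewrite addr0 [a *: 1]mulr1.
Qed.

Lemma Cn_affine k f (a b : R) : Cn k f -> Cn k (fun x => f (a * x + b)).
Proof.
have D (h : R -> R) (x : R) : (forall x : R, derivable h x 1) ->
    is_derive x 1 (fun x => h (a * x + b)) (derive1 h (a * x + b) * a).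
  move=> dh.
  have H1 := @is_derive1_comp R h (fun x => a * x + b) x _ _ (is_derive1P dh _) (is_derive_affine a b x).
  exact: H1.
elim: k f => [|k IH] f Hf.
  move=> j; rewrite leqn0 => /eqP-> x.
  by case: (D f x (Cn_derivable Hf)).
have [f1 f2] := (CnS _ _).1 Hf.
apply: (Cn_is_derive (fun x => D f x f1)).
by apply: CnM; [exact: (IH _ f2)|exact: Cn_cst].
Qed.

Lemma CnV k f : (forall x, f x != 0) -> Cn k f -> Cn k (fun x => (f x)^-1).
Proof.
move=> f0; elim: k => [|k IH] Hf.
  move=> j; rewrite leqn0 => /eqP-> x.
  by apply: derivableV => //; exact: (Cn_derivable Hf).
have [f1 f2] := (CnS _ _).1 Hf.
have D (x : R) : is_derive x 1 (fun x => (f x)^-1) ((-1 * derive1 f x) * ((f x)^-1 * (f x)^-1)).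
  have D := is_deriveV (f0 x) (is_derive1P f1 x).
  apply: (is_derive_eq D); rewrite scaleE -exprVn expr2; ring.
apply: (Cn_is_derive D); have If := IH (CnW Hf).
apply: (@CnM k (fun x => -1 * derive1 f x) (fun x => (f x)^-1 * (f x)^-1)).
  by apply: (@CnM k (fun=> -1) (derive1 f)); [exact: Cn_cst|exact: f2].
exact: (CnM If If).
Qed.

Lemma near_near (P : R -> Prop) (x : R) : (\forall y \near x, P y) ->
  \forall y \near x, \forall z \near y, P z.
Proof. by move=> H; apply: near_join. Qed.

Lemma Cn_local (V : normedModType R) k (f : R -> V) :
  (forall x : R, exists2 F : R -> V, Cn k F & \forall y \near x, F y = f y) -> Cn k f.
Proof.
elim: k f => [|k IH] f H.
  move=> j; rewrite leqn0 => /eqP-> x; have [F HF FE] := H x.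
  exact: (near_eq_derivable FE (@Cn_derivable _ _ F HF x)).
apply/CnS; split=> [x|].
  have [F HF FE] := H x; exact: (near_eq_derivable FE (@Cn_derivable _ _ F HF x)).
apply: IH => x; have [F HF FE] := H x; exists (derive1 F).
  exact: ((CnS _ _).1 HF).2.
have := near_near FE; apply: filterS => y yFE.
by rewrite !derive1E; exact: (@near_eq_derive R R V F f y 1 yFE).
Qed.

Lemma Cn_pair k f g : Cn k f -> Cn k g -> Cn k (fun x => (f x, g x) : R * R).
Proof.
elim: k f g => [|k IH] f g Hf Hg.
  move=> j; rewrite leqn0 => /eqP-> x.
  by apply/derivable_pairP; split; [exact: (Cn_derivable Hf)|exact: (Cn_derivable Hg)].
have [f1 f2] := (CnS _ _).1 Hf; have [g1 g2] := (CnS _ _).1 Hg.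
apply: (@Cn_is_derive _ _ _ (fun x => (derive1 f x, derive1 g x))); last exact: (IH _ _ f2 g2).
by move=> x; apply/is_derive_pair; split; [exact: (is_derive1P f1 x)|exact: (is_derive1P g1 x)].
Qed.

End SmoothCalculus.

(** * A smooth step function *)

Section Step.
Variable R : realType.
Implicit Types (f g : R -> R) (x : R).

Lemma is_derive_increment f (x l : R) :
  (forall e : R, 0 < e -> exists2 d : R, 0 < d & forall t, `|t - x| < d ->
     `|f t - f x - (t - x) * l| <= e * `|t - x|) -> is_derive x 1 f l.
Proof.
move=> H; have cv : (fun h : R => h^-1 *: ((f \o shift x) (h *: (1 : R)) - f x)) @ 0^' --> l.
  apply/cvgrPdist_lt => e e0; have [d d0 Hd] := H (e / 2) ltac:(by rewrite divr_gt0).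
  exists d => //= h; rewrite /= sub0r normrN => hd h0.
  have := Hd (h + x); rewrite addrK [h *: 1]mulr1 => /(_ hd) H1.
  have -> : l - h^-1 *: (f (h + x) - f x) = - h^-1 * (f (h + x) - f x - h * l).
    by rewrite scaleE; field.
  rewrite normrM normrN normfV mulrC ltr_pdivrMr ?normr_gt0 //.
  apply: le_lt_trans H1 _; rewrite ltr_pM2r ?normr_gt0 //.
  by move: e0; clear; lra.
by split; [apply/cvg_ex; exists l|apply: cvg_lim].
Qed.

(** The factor [x^-1 ^+ m] makes the family stable under derivation, up to linear combinations. *)
Definition flat (m : nat) x : R := if 0 < x then x^-1 ^+ m * expR (- x^-1) else 0.

Lemma flat_le0 m x : x <= 0 -> flat m x = 0.
Proof. by rewrite /flat ltNge => ->. Qed.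

Lemma flat_gt0 m x : 0 < x -> 0 < flat m x.
Proof. by move=> x0; rewrite /flat x0 mulr_gt0 ?expR_gt0 // exprn_gt0 // invr_gt0. Qed.

Lemma flat_ge0 m x : 0 <= flat m x.
Proof. by case: (ltP 0 x) => [/(flat_gt0 m)/ltW //|/(flat_le0 m)->]. Qed.

(** One term of the exponential series at [x^-1], that of degree [m.+1], suffices. *)
Lemma flat_bound m x : 0 < x -> flat m x <= (m.+1)`!%:R * x.
Proof.
move=> x0; rewrite /flat x0; set y := x^-1; have y0 : 0 < y by rewrite invr_gt0.
have f0 : 0 < (m.+1)`!%:R :> R by rewrite ltr0n fact_gt0.
have h1 : y ^+ m.+1 <= (m.+1)`!%:R * expR y.
  rewrite mulrC -ler_pdivrMr //; apply: le_trans (expR_ge1Dxn m (ltW y0)).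
  by rewrite lerDr.
have -> : y ^+ m * expR (- y) = (y ^+ m.+1 / expR y) * x.
  by rewrite expRN exprS [y ^+ m / _]mulrC; rewrite /y; field; rewrite gt_eqF ?expR_gt0 // gt_eqF.
by rewrite ler_wpM2r ?(ltW x0) // ler_pdivrMr ?expR_gt0.
Qed.

Lemma is_derive_flat m x : is_derive x 1 (flat m) (flat m.+2 x - m%:R * flat m.+1 x).
Proof.
case: (ltgtP x 0) => [x0|x0|->].
- rewrite !flat_le0 ?(ltW x0) // mulr0 subrr.
  apply: (near_eq_is_derive _ (is_derive_cst 0 x (1 : R))).
  near=> y; rewrite flat_le0 //; apply: ltW; near: y.
  exact: lt_nbhsl.
- have iv : is_derive x 1 (fun y : R => y^-1) (- x^-1 ^+ 2).
    have := is_deriveV (lt0r_neq0 x0) (is_derive_id x (1 : R)).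
    by rewrite -exprVn [X in is_derive _ _ _ X]mulr1.
  have E : is_derive x 1 (fun y : R => expR (- y^-1)) (expR (- x^-1) * x^-1 ^+ 2).
    have n : is_derive x 1 (fun y : R => - y^-1) (x^-1 ^+ 2).
      by have := is_deriveN iv; rewrite opprK.
    exact: (@is_derive1_comp R expR (fun y => - y^-1) x _ _ (is_derive_expR _) n).
  have X : is_derive x 1 (fun y : R => y^-1 ^+ m) (m%:R * x^-1 ^+ m.-1 * - x^-1 ^+ 2).
    have := is_deriveX m iv; rewrite scaleE -mulr_natl.
    by congr is_derive; apply/funext => y; rewrite exprfctE.
  have P := is_deriveM X E.
  apply: (@near_eq_is_derive R R R (fun y => y^-1 ^+ m * expR (- y^-1)) (flat m) x 1).
    near=> y; rewrite /flat ifT //; near: y; exact: lt_nbhsr.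
  apply: (is_derive_eq P); rewrite /flat x0 !scaleE.
  set y := x^-1; set E' := expR _; case: m {X P} => [|m]; rewrite ?exprS ?expr0 /=.
    by ring.
  by move: (y ^+ m) => z; ring.
(* At 0: [flat m t] is [flat m.+1 t * t], hence at most a constant times the square of [t]. *)
rewrite !flat_le0 // mulr0 subrr; apply: is_derive_increment => e e0.
have f0 : 0 < (m.+2)`!%:R :> R by rewrite ltr0n fact_gt0.
exists (e / (m.+2)`!%:R); first by rewrite divr_gt0.
move=> t; rewrite subr0 (flat_le0 _ (lexx 0)) mulr0 !subr0 => td.
have [t0|t0] := leP t 0; first by rewrite flat_le0 // normr0 mulr_ge0 // ltW.
rewrite (gtr0_norm (flat_gt0 m t0)) (gtr0_norm t0).
have -> : flat m t = flat m.+1 t * t.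
  by rewrite /flat t0 exprS; field; rewrite gt_eqF.
rewrite ler_wpM2r ?(ltW t0) //; apply: le_trans (flat_bound m.+1 t0) _.
by rewrite mulrC -ler_pdivlMr // ltW //; move: td; rewrite gtr0_norm.
Unshelve. all: by end_near. Qed.

Lemma Cn_flat k m : Cn k (flat m).
Proof.
elim: k m => [|k IH] m.
  by move=> j; rewrite leqn0 => /eqP-> x; case: (is_derive_flat m x).
apply: (Cn_is_derive (is_derive_flat m)).
have h : Cn k (fun x => - m%:R * flat m.+1 x).
  by apply: (@CnM _ k (fun=> - m%:R)); [exact: Cn_cst|exact: IH].
have := CnD (IH m.+2) h; congr Cn; apply/funext => x; by rewrite mulNr.
Qed.

Definition step x : R := flat 0 x / (flat 0 x + flat 0 (1 - x)).

Lemma step_den_gt0 x : 0 < flat 0 x + flat 0 (1 - x).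
Proof.
have [x0|x0] := ltP 0 x; first by rewrite ltr_wpDr ?flat_ge0 // flat_gt0.
by rewrite ltr_wpDl ?flat_ge0 // flat_gt0 //; move: x0; clear; lra.
Qed.

Lemma step_le0 x : x <= 0 -> step x = 0.
Proof. by move=> x0; rewrite /step flat_le0 // mul0r. Qed.

Lemma step_ge1 x : 1 <= x -> step x = 1.
Proof.
move=> x1; rewrite /step [flat 0 (1 - x)]flat_le0 ?subr_le0 // addr0 divff //.
by rewrite gt_eqF // flat_gt0 //; exact: lt_le_trans x1.
Qed.

Lemma Cn_step k : Cn k step.
Proof.
have h1 : Cn k (fun x => flat 0 (1 - x)).
  have := @Cn_affine R k (flat 0) (-1) 1 (@Cn_flat k 0); congr Cn; apply/funext => x.
  by rewrite mulN1r addrC.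
apply: (@CnM _ k (flat 0) (fun x => (flat 0 x + flat 0 (1 - x))^-1)).
  exact: Cn_flat.
apply: CnV; first by move=> x; rewrite gt_eqF // step_den_gt0.
by apply: CnD; [exact: Cn_flat|exact: h1].
Qed.

Lemma smooth_step : smooth step.
Proof. by apply/smooth_Cn; exact: Cn_step. Qed.

Lemma derive1_step_gt0 x : 0 < x < 1 -> 0 < derive1 step x.
Proof.
move=> /andP[x0 x1]; have x1' : 0 < 1 - x by rewrite subr_gt0.
have d1 := is_derive_flat 0 x; rewrite mul0r subr0 in d1.
have d2 : is_derive x 1 (fun x => flat 0 (1 - x)) (- flat 2 (1 - x)).
  have := is_derive_flat 0 (-1 * x + 1); rewrite mul0r subr0 => d.
  have := @is_derive1_comp R (flat 0) (fun y => -1 * y + 1) x _ _ d (is_derive_affine (-1) 1 x).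
  rewrite mulrN1 (_ : -1 * x + 1 = 1 - x); last by rewrite mulN1r addrC.
  congr is_derive; apply/funext => y /=; by rewrite mulN1r addrC.
have nz := lt0r_neq0 (step_den_gt0 x).
have d3 := @is_deriveV R (fun x => flat 0 x + flat 0 (1 - x)) x _ 1 nz (is_deriveD d1 d2).
have d4 := is_deriveM d1 d3.
have -> : derive1 step x = (flat 2 x * flat 0 (1 - x) + flat 0 x * flat 2 (1 - x)) /
   (flat 0 x + flat 0 (1 - x)) ^+ 2.
  rewrite derive1E; have [_ ->] := d4; rewrite !scaleE /=; field; exact: nz.
rewrite divr_gt0 ?exprn_gt0 ?step_den_gt0 // addr_gt0 // mulr_gt0 // flat_gt0 //.
Qed.

Lemma step_lt x y : x < y -> 0 < y -> x < 1 -> step x < step y.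
Proof.
move=> xy y0 x1.
have key u v : 0 <= u -> u < v -> v <= 1 -> step u < step v.
  move=> u0 uv v1; have dS := is_derive1P (Cn_derivable (@Cn_step 0%N)).
  have [|c cuv E] := @MVT R step (derive1 step) u v uv (fun z _ => dS z).
  - apply: continuous_subspaceT => z; apply: differentiable_continuous.
    by apply/derivable1_diffP; case: (dS z).
  - by rewrite -subr_gt0 E mulr_gt0 ?subr_gt0 // derive1_step_gt0; move: cuv; rewrite in_itv /=; move: u0 v1; clear; lra.
have [x0|x0] := leP x 0; have [y1|y1] := leP 1 y.
- by rewrite step_le0 // step_ge1 // ltr01.
- by rewrite step_le0 // -(step_le0 (lexx 0)) key // ltW.
- by rewrite (step_ge1 y1) -(step_ge1 (lexx 1)) key // ltW.
- by rewrite key // ltW.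
Qed.

Lemma step_itv x : 0 <= step x <= 1.
Proof.
rewrite /step divr_ge0 ?flat_ge0 ?(ltW (step_den_gt0 x)) //= ler_pdivrMr ?step_den_gt0 //.
by rewrite mul1r lerDl flat_ge0.
Qed.

End Step.

(** * Smooth staircases and periodic interpolation *)

Section Staircase.
Variable R : realType.
Implicit Types (f g : R -> R) (x t w : R).

(** Rises by 1 on each unit interval, during its first fraction [w], then rests. As it commutes with
    [t + 1], a combination of shifted copies with zero total rise is periodic. *)
Definition stair w t : R := (Num.floor t)%:~R + step ((t - (Num.floor t)%:~R) / w).

Lemma floor_unique (m : int) t : m%:~R <= t < m%:~R + 1 -> Num.floor t = m.
Proof. by move=> H; apply: floor_def; rewrite intrD. Qed.

(** An expression without [floor], valid on both sides of the integer [m], from which smoothness at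
    integers is read. *)
Lemma stair_near w t (m : int) : 0 < w <= 1 -> m%:~R - 1 < t < m%:~R + 1 ->
  stair w t = m%:~R - 1 + step ((t - m%:~R + 1) / w) + step ((t - m%:~R) / w).
Proof.
move=> /andP[w0 w1] /andP[t1 t2]; have [tm|mt] := ltP t m%:~R.
  rewrite /stair (@floor_unique (m - 1)); last by rewrite intrB subrK tm (ltW t1).
  rewrite [step ((t - m%:~R) / w)]step_le0 ?addr0; last first.
    by rewrite ler_pdivrMr // mul0r subr_le0 ltW.
  by rewrite intrB opprB addrA addrAC -addrA.
rewrite /stair (@floor_unique m); last by rewrite mt t2.
rewrite [step ((t - m%:~R + 1) / w)]step_ge1 ?subrK //.
by rewrite ler_pdivlMr // mul1r; move: mt w1; clear; lra.
Qed.

Lemma stair_itv w t : 0 < w <= 1 -> 0 <= t <= 1 -> stair w t = step (t / w).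
Proof.
move=> w01 /andP[t0]; rewrite le_eqVlt => /orP[/eqP->|t1].
  have /andP[w0 w1] := w01.
  rewrite /stair (@floor_unique 1) ?lexx ?ltrDl ?ltr01 //.
  by rewrite subrr mul0r step_le0 // addr0 step_ge1 // ler_pdivlMr // mul1r.
by rewrite /stair (@floor_unique 0) ?t0 ?add0r // subr0.
Qed.

Lemma stairD1 w t : stair w (t + 1) = stair w t + 1.
Proof.
rewrite /stair (@floor_unique (Num.floor t + 1)); last first.
  rewrite intrD lerD2r ltrD2r.
  by have /andP[h1 h2] := floor_itv t; rewrite h1 /=; rewrite intrD in h2.
rewrite intrD; have -> : t + 1 - ((Num.floor t)%:~R + 1) = t - (Num.floor t)%:~R by ring.
by ring.
Qed.

Lemma stair_itv_neg w t : 0 < w <= 1 -> -1 <= t <= 0 -> stair w t = step ((t + 1) / w) - 1.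
Proof.
move=> w01 t01; have := stair_itv (t := t + 1) w01; rewrite stairD1 => <-; first by rewrite addrK.
by move: t01; clear; lra.
Qed.

Lemma Cn_stair k w : 0 < w <= 1 -> Cn k (stair w).
Proof.
move=> w01; apply: Cn_local => x; set m := Num.floor x.
exists (fun t => m%:~R - 1 + step ((t - m%:~R + 1) / w) + step ((t - m%:~R) / w)).
  have h1 : Cn k (fun t => step ((t - m%:~R + 1) / w)).
    have := @Cn_affine R k (@step R) w^-1 ((1 - m%:~R) / w) (@Cn_step R k).
    by congr Cn; apply/funext => t; congr step; ring.
  have h2 : Cn k (fun t => step ((t - m%:~R) / w)).
    have := @Cn_affine R k (@step R) w^-1 (- m%:~R / w) (@Cn_step R k).
    by congr Cn; apply/funext => t; congr step; ring.
  apply: (@CnD R R k (fun t => m%:~R - 1 + step ((t - m%:~R + 1) / w))); last exact: h2.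
  by apply: (@CnD R R k (fun t => m%:~R - 1)); [exact: Cn_cst|exact: h1].
have /andP[x1 x2] := floor_itv x; rewrite intrD -/m in x1 x2.
near=> t; rewrite -stair_near //; apply/andP; split; near: t.
  by apply: lt_nbhsr; apply: lt_le_trans x1; rewrite ltrBlDr ltrDl.
exact: lt_nbhsl.
Unshelve. all: by end_near. Qed.

(* A smooth [N]-periodic function equal to [v j + (v j.+1 - v j) * step ((t - c - j) / w)]
   on [c + j, c + j + 1]. *)
Definition loop_steps N (v : nat -> R) (c w t : R) : R :=
  v 0%N + \sum_(k < N) (v k.+1 - v k) * stair (w / N%:R) ((t - c - k%:R) / N%:R).

Lemma loop_steps_period N v c w t : (0 < N)%N -> v N = v 0%N ->
  loop_steps N v c w (t + N%:R) = loop_steps N v c w t.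
Proof.
move=> N0 vN; rewrite /loop_steps; congr (_ + _).
have N0' : N%:R != 0 :> R by rewrite pnatr_eq0 -lt0n.
have E (k : 'I_N) : (v k.+1 - v k) * stair (w / N%:R) ((t + N%:R - c - k%:R) / N%:R) =
    (v k.+1 - v k) * stair (w / N%:R) ((t - c - k%:R) / N%:R) + (v k.+1 - v k).
  have -> : (t + N%:R - c - k%:R) / N%:R = (t - c - k%:R) / N%:R + 1 by field.
  by rewrite stairD1 mulrDr mulr1.
rewrite (eq_bigr _ (fun k _ => E k)) big_split /=.
rewrite -(big_mkord xpredT (fun k => v k.+1 - v k)) telescope_sumr // vN subrr addr0 //.
Qed.

(** On the [j]-th unit the stairs of smaller index have finished their rise and those of larger
    index have not begun it; the finished ones telescope to [v j - v 0]. *)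
Lemma loop_stepsE N v c w j t : (j < N)%N -> 0 < w <= 1 -> v N = v 0%N ->
  c + j%:R <= t <= c + j%:R + 1 ->
  loop_steps N v c w t = v j + (v j.+1 - v j) * step ((t - c - j%:R) / w).
Proof.
move=> jN /andP[w0 w1] vN /andP[tj tj1]; have N0 : (0 < N)%N by exact: leq_ltn_trans jN.
have N0r : 0 < N%:R :> R by rewrite ltr0n.
have N1r : 1 <= N%:R :> R by rewrite ler1n.
have w01 : 0 < w / N%:R <= 1.
  by rewrite divr_gt0 //= ler_pdivrMr // mul1r (le_trans w1).
have simp x : x / N%:R / (w / N%:R) = x / w.
  by field; rewrite !gt_eqF.
rewrite /loop_steps -(big_mkord xpredT (fun k => (v k.+1 - v k) * stair (w / N%:R) ((t - c - k%:R) / N%:R))).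
rewrite (@big_cat_nat _ _ _ j) //=; last exact: ltnW.
rewrite [X in _ + (_ + X)]big_ltn //.
have -> : \sum_(0 <= k < j) (v k.+1 - v k) * stair (w / N%:R) ((t - c - k%:R) / N%:R) = v j - v 0%N.
  rewrite -[RHS]telescope_sumr //; apply: eq_big_nat => k /andP[_ kj].
  have kj' : k%:R + 1 <= j%:R :> R by rewrite natr1 ler_nat.
  have jN' : j%:R + 1 <= N%:R :> R by rewrite natr1 ler_nat.
  have k0 : 0 <= k%:R :> R by [].
  rewrite stair_itv // ?simp.
    by rewrite step_ge1 ?mulr1 // ler_pdivlMr // mul1r; move: kj' w1 tj; clear; lra.
  apply/andP; split; first by rewrite divr_ge0 ?(ltW N0r) //; move: kj' tj; clear; lra.
  by rewrite ler_pdivrMr // mul1r; move: k0 jN' tj1; clear; lra.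
have -> : \sum_(j.+1 <= k < N) (v k.+1 - v k) * stair (w / N%:R) ((t - c - k%:R) / N%:R) = 0.
  rewrite big_nat_cond big1 // => k /andP[/andP[jk kN] _].
  have jk' : j%:R + 1 <= k%:R :> R by rewrite natr1 ler_nat.
  have kN' : k%:R + 1 <= N%:R :> R by rewrite natr1 ler_nat.
  have j0 : 0 <= j%:R :> R by [].
  rewrite stair_itv_neg //.
    have -> : ((t - c - k%:R) / N%:R + 1) / (w / N%:R) = (t - c - k%:R + N%:R) / w.
      by field; rewrite !gt_eqF.
    rewrite step_ge1 ?subrr ?mulr0 // ler_pdivlMr // mul1r.
    by move: kN' j0 tj w1; clear; lra.
  apply/andP; split; first by rewrite ler_pdivlMr //; move: kN' j0 tj; clear; lra.
  by rewrite ler_pdivrMr // mul0r; move: jk' tj1; clear; lra.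
rewrite stair_itv // ?simp; first by ring.
apply/andP; split; first by rewrite divr_ge0 ?(ltW N0r) //; move: tj; clear; lra.
by rewrite ler_pdivrMr // mul1r; move: tj1 N1r; clear; lra.
Qed.

Lemma Cn_loop_steps k N v c w : (0 < N)%N -> 0 < w <= 1 -> Cn k (loop_steps N v c w).
Proof.
move=> N0 /andP[w0 w1]; have N0r : 0 < N%:R :> R by rewrite ltr0n.
have w01 : 0 < w / N%:R <= 1.
  by rewrite divr_gt0 //= ler_pdivrMr // mul1r (le_trans w1) // ler1n.
apply: (@CnD R R k (fun=> v 0%N)); first exact: Cn_cst.
apply: (@Cn_sum R R k N (fun i t => (v i.+1 - v i) * stair (w / N%:R) ((t - c - i%:R) / N%:R))) => i iN.
apply: (@CnM R k (fun=> v i.+1 - v i)); first exact: Cn_cst.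
have := @Cn_affine R k (stair (w / N%:R)) N%:R^-1 ((- c - i%:R) / N%:R) (@Cn_stair k _ w01).
by congr Cn; apply/funext => t; congr stair; ring.
Qed.

Lemma derive1_loop_steps N v c w j t : (j < N)%N -> 0 < w <= 1 -> v N = v 0%N ->
  c + j%:R < t < c + j%:R + 1 ->
  derive1 (loop_steps N v c w) t = (v j.+1 - v j) * (derive1 (@step R) ((t - c - j%:R) / w) / w).
Proof.
move=> jN w01 vN tI.
have dS := is_derive1P (Cn_derivable (@Cn_step R 0%N)).
have d1 := @is_derive1_comp R (@step R) (fun y => w^-1 * y + (- c - j%:R) / w) t _ _ (dS _)
  (is_derive_affine w^-1 ((- c - j%:R) / w) t).
have d2 := is_deriveM (is_derive_cst (v j.+1 - v j) t (1 : R)) d1.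
have d3 := is_deriveD (is_derive_cst (v j) t (1 : R)) d2.
have d4 : is_derive t 1 (loop_steps N v c w) ((v j.+1 - v j) * (derive1 (@step R) ((t - c - j%:R) / w) / w)).
  apply: (@near_eq_is_derive R R R (fun t => v j + (v j.+1 - v j) * step ((t - c - j%:R) / w)) _ t 1).
    have /andP[t1 t2] := tI.
    near=> y; rewrite (loop_stepsE jN w01 vN) //; apply/andP; split; apply: ltW; near: y.
      exact: lt_nbhsr.
    exact: lt_nbhsl.
  have E (y : R) : w^-1 * y + (- c - j%:R) / w = (y - c - j%:R) / w by ring.
  move: d3; rewrite !scaleE mulr0 addr0 add0r.
  rewrite (_ : w^-1 * t + (- c - j%:R) / w = (t - c - j%:R) / w); last by ring.
  congr (is_derive _ _ _); apply/funext => y; rewrite !fctE /=.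
  by congr (_ + _ * step _); ring.
by rewrite derive1E; case: d4.
Unshelve. all: by end_near. Qed.

End Staircase.

(** * Smoothed rectilinear routes *)

Section RectilinearCurve.
Variable R : realType.
Implicit Types (t s rho : R) (N : nat) (a : nat -> R) (b : nat -> int).

Definition btw (T : realDomainType) (x y z : T) := (y < x < z) || (z < x < y).

(* A closed rectilinear route: its [j]-th vertical side has abscissa [a j] and goes from
   height [b j] to height [b j.+1], its [i]-th horizontal side has height [b i.+1] and goes
   from abscissa [a i] to abscissa [a i.+1]. *)
Record route N a b rho : Prop := Route {
  route_size : (1 < N)%N;
  route_aN : a N = a 0%N;
  route_bN : b N = b 0%N;
  route_bN1 : b N.+1 = b 1%N;
  route_a_inj : forall i j, (0 < i <= N)%N -> (0 < j <= N)%N -> a i = a j -> i = j;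
  route_b_inj : forall i j, (0 < i <= N)%N -> (0 < j <= N)%N -> b i = b j -> i = j;
  route_rho : 0 < rho < 1 / 2;
  route_small : forall j, (j <= N)%N -> `|(b j.+1 - b j)%:~R| * step rho < 1 / 2;
  route_small' : forall j, (j <= N)%N -> `|(b j.+1 - b j)%:~R| * (1 - step (1 - rho)) < 1 / 2
}.

(* The smoothed route: the abscissa moves on [i + 1/2 - rho, i + 1/2 + rho] only, where the
   height stays close to [b i.+1]. *)
Definition routeX N a rho : R -> R := loop_steps N a (1 / 2 - rho) (2 * rho).
Definition routeY N b : R -> R := loop_steps N (fun k => (b k)%:~R) (- (1 / 2)) 1.

(** Horizontal windows are closed and vertical ones open, so that together they partition a period.
    A phase, centred at an integer, is a window on which the height is strictly monotone. *)
Definition horiz rho i t := i%:R + 1 / 2 - rho <= t <= i%:R + 1 / 2 + rho.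
Definition vert rho j t := j%:R - 1 / 2 + rho < t < j%:R + 1 / 2 - rho.
Definition phase j t := j%:R - 1 / 2 <= t <= j%:R + 1 / 2.

Definition crossing a b i j := btw (a j) (a i) (a i.+1) && btw (b i.+1) (b j) (b j.+1).

Lemma route_gt0 N a b rho : route N a b rho -> (0 < N)%N.
Proof. by case=> /ltnW. Qed.

Lemma vert_phase N a b rho j t : route N a b rho -> vert rho j t -> phase j t.
Proof. by case=> _ _ _ _ _ _ + _ _; rewrite /vert /phase; clear; lra. Qed.

Lemma routeX_period N a b rho t : route N a b rho -> routeX N a rho (t + N%:R) = routeX N a rho t.
Proof. by move=> H; apply: loop_steps_period; [exact: route_gt0 H|exact: route_aN H]. Qed.

Lemma routeY_period N a b rho t : route N a b rho -> routeY N b (t + N%:R) = routeY N b t.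
Proof. by move=> H; apply: loop_steps_period; [exact: route_gt0 H|rewrite (route_bN H)]. Qed.

Lemma routeYE N a b rho j t : route N a b rho -> (j <= N)%N -> phase j t ->
  routeY N b t = (b j)%:~R + (b j.+1 - b j)%:~R * step (t - j%:R + 1 / 2).
Proof.
move=> H jN /andP[t1 t2].
have E i s : (i < N)%N -> phase i s ->
    routeY N b s = (b i)%:~R + (b i.+1 - b i)%:~R * step (s - i%:R + 1 / 2).
  move=> iN /andP[s1 s2]; rewrite /routeY (@loop_stepsE _ _ _ _ _ i) ?ltr01 ?lexx //.
  - by rewrite divr1 intrB; congr (_ + _ * step _); ring.
  - by rewrite (route_bN H).
  - by move: s1 s2; clear; lra.
have [jN'|jN'] := ltnP j N; first by apply: E => //; rewrite /phase t1.
have {jN'} jN' : j = N by apply/eqP; rewrite eqn_leq jN.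
(* The vertical side of index [N] is the one of index 0, a period later. *)
subst j; rewrite -[in LHS](subrK N%:R t) (routeY_period _ H) (E 0%N) ?(route_gt0 H) //.
  by rewrite subr0 (route_bN1 H) (route_bN H).
by rewrite /phase; move: t1 t2; clear; lra.
Qed.

Lemma routeXE N a b rho i t : route N a b rho -> (i < N)%N ->
  i%:R + 1 / 2 - rho <= t <= i%:R + 3 / 2 - rho ->
  routeX N a rho t = a i + (a i.+1 - a i) * step ((t - i%:R - 1 / 2 + rho) / (2 * rho)).
Proof.
move=> H iN t12; have /andP[r0 r1] := route_rho H.
rewrite /routeX (@loop_stepsE _ _ _ _ _ i) //.
- by congr (_ + _ * step (_ / _)); ring.
- by move: r0 r1; clear; lra.
- exact: route_aN H.
- by move: t12; clear; lra.
Qed.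

Lemma routeX_vert N a b rho j t : route N a b rho -> (0 < j <= N)%N ->
  j%:R - 1 / 2 + rho <= t <= j%:R + 1 / 2 - rho -> routeX N a rho t = a j.
Proof.
case: j => // j H jN t12; have /andP[r0 r1] := route_rho H.
rewrite -natr1 in t12.
rewrite (@routeXE _ _ _ _ j _ H jN); last by move: r0 r1 t12; clear; lra.
rewrite step_ge1 ?mulr1 1?addrC ?subrK // ler_pdivlMr; last by move: r0; clear; lra.
by move: t12; clear; lra.
Qed.

(** The fields [route_small] and [route_small'] bound the move of the height within time [rho] of a
    corner by 1/2, half the gap between distinct integer heights. *)
Lemma routeY_horiz N a b rho i t : route N a b rho -> (i < N)%N -> horiz rho i t ->
  `|routeY N b t - (b i.+1)%:~R| < 1 / 2.
Proof.
move=> H iN; rewrite /horiz => /andP[t1 t2]; have /andP[r0 r1] := route_rho H.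
have [ti|ti] := leP t (i%:R + 1 / 2).
  rewrite (@routeYE _ _ _ _ i _ H (ltnW iN)); last first.
    by rewrite /phase; move: r0 r1 t1 ti; clear; lra.
  have -> : (b i)%:~R + (b i.+1 - b i)%:~R * step (t - i%:R + 1 / 2) - (b i.+1)%:~R =
    - ((b i.+1 - b i)%:~R * (1 - step (t - i%:R + 1 / 2))) by rewrite intrB; ring.
  rewrite normrN normrM; apply: le_lt_trans (route_small' H (ltnW iN)).
  apply: ler_wpM2l => //; have /andP[_ s1] := step_itv (t - i%:R + 1 / 2).
  rewrite ger0_norm ?subr_ge0 // lerB //.
  have [->//|lt] : 1 - rho = t - i%:R + 1 / 2 \/ 1 - rho < t - i%:R + 1 / 2.
    by move: t1; clear; case: (ltgtP (1 - rho) (t - i%:R + 1 / 2)); [right|lra|left].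
  by apply/ltW/step_lt => //; move: r0 r1 lt; clear; lra.
rewrite (@routeYE _ _ _ _ i.+1 _ H iN); last first.
  by rewrite /phase -natr1; move: r0 r1 t2 ti; clear; lra.
rewrite addrAC subrr add0r normrM; apply: le_lt_trans (route_small H iN).
apply: ler_wpM2l => //; have /andP[s0 _] := step_itv (t - i.+1%:R + 1 / 2).
rewrite ger0_norm //; rewrite -natr1.
have [->//|lt] : t - (i%:R + 1) + 1 / 2 = rho \/ t - (i%:R + 1) + 1 / 2 < rho.
  by move: t2; clear; case: (ltgtP (t - (i%:R + 1) + 1 / 2) rho); [right|lra|left].
by apply/ltW/step_lt => //; move: r0 r1 lt; clear; lra.
Qed.

Lemma route_neq_a N a b rho i : route N a b rho -> (i < N)%N -> a i.+1 - a i != 0.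
Proof.
move=> H iN; rewrite subr_eq0; apply/eqP => E.
have N1 := route_size H.
case: i iN E => [_|i iN] E.
  rewrite -(route_aN H) in E; have := route_a_inj H _ _ E; rewrite (ltnW N1) leqnn /=.
  by move=> /(_ erefl (leqnn N)) E1; rewrite -E1 in N1.
have := route_a_inj H _ _ E; rewrite iN (ltnW iN) /= => /(_ erefl erefl) /eqP.
by rewrite -[X in _ == X]addn0 -addn1 eqn_add2l.
Qed.

Lemma route_neq_b N a b rho j : route N a b rho -> (j <= N)%N -> b j.+1 != b j.
Proof.
move=> H jN; apply/eqP => E; have N1 := route_size H.
case: j jN E => [_|j jN] E.
  rewrite -(route_bN H) in E; have := route_b_inj H _ _ E; rewrite (ltnW N1) leqnn /=.
  by move=> /(_ erefl (leqnn N)) E1; rewrite -E1 in N1.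
have [jN'|jN'] := ltnP j.+1 N; last first.
  have {jN'} jN' : j.+1 = N by apply/eqP; rewrite eqn_leq jN.
  rewrite jN' (route_bN1 H) in E; have := route_b_inj H _ _ E; rewrite (ltnW N1) leqnn /=.
  by move=> /(_ erefl (leqnn N)) E1; rewrite -E1 in N1.
have := route_b_inj H _ _ E; rewrite jN jN' /= => /(_ erefl erefl) /eqP.
by rewrite -[X in _ == X]addn0 -addn1 eqn_add2l.
Qed.

Lemma route_neq_bR N a b rho j : route N a b rho -> (j <= N)%N -> (b j.+1 - b j)%:~R != 0 :> R.
Proof. by move=> H jN; rewrite intr_eq0 subr_eq0 (route_neq_b H jN). Qed.

Lemma step_inj x y : 0 <= x <= 1 -> 0 <= y <= 1 -> step x = step y :> R -> x = y.
Proof.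
wlog xy : x y / x < y => [W|] x01 y01 E.
  case: (ltgtP x y) => // xy; first exact: W.
  by apply/esym; exact: W.
suff : step x < step y by rewrite E ltxx.
by apply: step_lt => //; move: x01 y01 xy; clear; lra.
Qed.

Lemma routeY_inj N a b rho j s t : route N a b rho -> (j <= N)%N -> phase j s -> phase j t ->
  routeY N b s = routeY N b t -> s = t.
Proof.
move=> H jN sj tj; rewrite !(routeYE H jN) // => /addrI.
move=> /(mulfI (route_neq_bR H jN)) /step_inj => E.
have : s - j%:R + 1 / 2 = t - j%:R + 1 / 2.
  by apply: E; [move: sj|move: tj]; rewrite /phase; clear; lra.
by clear; lra.
Qed.

Lemma horiz_arg rho i t : 0 < rho < 1 / 2 -> horiz rho i t ->
  0 <= (t - i%:R - 1 / 2 + rho) / (2 * rho) <= 1.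
Proof.
move=> /andP[r0 _]; rewrite /horiz => /andP[t1 t2]; have r20 : 0 < 2 * rho by move: r0; clear; lra.
by rewrite ler_pdivlMr // ler_pdivrMr //; move: t1 t2; clear; lra.
Qed.

Lemma horiz_wide N a b rho i t : route N a b rho -> horiz rho i t ->
  i%:R + 1 / 2 - rho <= t <= i%:R + 3 / 2 - rho.
Proof. by case=> _ _ _ _ _ _ + _ _; rewrite /horiz; clear; lra. Qed.

Lemma routeX_inj N a b rho i s t : route N a b rho -> (i < N)%N -> horiz rho i s -> horiz rho i t ->
  routeX N a rho s = routeX N a rho t -> s = t.
Proof.
move=> H iN sj tj; rewrite !(routeXE H iN) ?(horiz_wide H) // => /addrI.
move=> /(mulfI (route_neq_a H iN)) /step_inj => /(_ (horiz_arg (route_rho H) sj) (horiz_arg (route_rho H) tj)).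
have /andP[r0 _] := route_rho H.
have r20 : (2 * rho)^-1 != 0 by rewrite invr_neq0 // mulf_neq0 ?gt_eqF.
move=> /(mulIf r20); clear; lra.
Qed.

Lemma fundamental_piece N a b rho t : route N a b rho -> 1 / 2 - rho <= t < N%:R + 1 / 2 - rho ->
  (exists2 i, (i < N)%N & horiz rho i t) \/ (exists2 j, (0 < j <= N)%N & vert rho j t).
Proof.
move=> H /andP[t1 t2]; have /andP[r0 r1] := route_rho H.
have t0 : 0 <= t - (1 / 2 - rho) by rewrite subr_ge0.
pose i := Num.truncn (t - (1 / 2 - rho)).
have [i1 i2] : i%:R <= t - (1 / 2 - rho) /\ t - (1 / 2 - rho) < i%:R + 1 :> R.
  by have /andP[i1 i2] := truncn_itv t0; split; [exact: i1|rewrite natr1; exact: i2].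
move: i i1 i2 => i i1 i2.
have iN : (i < N)%N by have : i%:R < N%:R :> R; [move: t2 i1; clear; lra|rewrite ltr_nat].
have [ti|ti] := leP t (i%:R + 1 / 2 + rho).
  by left; exists i => //; rewrite /horiz ti andbT; move: i1; clear; lra.
right; exists i.+1 => //; rewrite /vert -natr1; move: i2 ti; clear; lra.
Qed.

End RectilinearCurve.

(** * Double points of the smoothed route are crossings of its sides *)

Section RouteCrossings.
Variable R : realType.
Implicit Types (t s rho : R) (N : nat) (a : nat -> R) (b : nat -> int).

Lemma int_le_lt1 (x y : int) : x%:~R < y%:~R + 1 :> R -> x <= y.
Proof. by rewrite -[1]/(1%:~R : R) -intrD ltr_int ltzD1. Qed.

(** Abscissas give weak betweenness at once. Heights do too, since a smoothed height is within 1/2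
    of an integer; strictness comes from the distinctness of abscissas and of heights. *)
Lemma horiz_vert_crossing N a b rho i j s t : route N a b rho -> (i < N)%N -> (0 < j <= N)%N ->
  horiz rho i s -> vert rho j t -> routeX N a rho s = routeX N a rho t ->
  routeY N b s = routeY N b t -> crossing a b i j.
Proof.
move=> H iN jN hs vt EX EY; have /andP[r0 r1] := route_rho H; have /andP[j0 jN'] := jN.
have N0 := route_gt0 H; have N1 := route_size H.
have XT : routeX N a rho t = a j.
  by apply: (routeX_vert H jN); move: vt; rewrite /vert; clear; lra.
have r20 : 2 * rho != 0 by rewrite mulf_neq0 ?gt_eqF.
have h01 := horiz_arg (route_rho H) hs.
have XS := routeXE H iN (horiz_wide H hs).
rewrite EX XT in XS; set u := (s - i%:R - 1 / 2 + rho) / (2 * rho) in XS h01.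
have d0 := route_neq_a H iN.
(* Otherwise [s] is the start of its horizontal window and lies in the phase of the vertical side
   [j], where the height is injective; this contradicts the disjointness of the windows. For [i = 0]
   the side [j] is [N], a period later. *)
have ni : a j != a i.
  apply/eqP => E; move: XS; rewrite E -[LHS]addr0 => /addrI /esym /eqP; rewrite mulf_eq0 (negbTE d0) /=.
  rewrite -(step_le0 (lexx 0)) => /eqP /step_inj; rewrite lexx ler01 => /(_ h01 erefl).
  move=> /eqP; rewrite mulf_eq0 invr_eq0 (negbTE r20) orbF => /eqP sE.
  have [i0|i0] := posnP i.
    have jE : j = N by apply: (route_a_inj H) => //; [rewrite N0 leqnn|rewrite E i0 (route_aN H)].
    subst i j; move: EY; rewrite -(routeY_period s H) => EY.
    have := routeY_inj H (leqnn N) _ (vert_phase H vt) EY.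
    move: vt sE r0 r1; rewrite /vert /phase; clear => vt sE r0 r1 E.
    have := E ltac:(move: sE r0 r1; clear; lra).
    by move: vt sE; clear; lra.
  have jE : j = i by apply: (route_a_inj H) => //; rewrite i0 ltnW.
  subst i; have := routeY_inj H jN' _ (vert_phase H vt) EY.
  move: vt sE r0 r1; rewrite /vert /phase; clear => vt sE r0 r1 E.
  have := E ltac:(move: sE r0 r1; clear; lra).
  by move: vt sE; clear; lra.
have nS : a j != a i.+1.
  apply/eqP => E; move: XS; rewrite E => XS.
  have E2 : (a i.+1 - a i) * step u = a i.+1 - a i.
    by apply: (addrI (a i)); rewrite -XS [RHS]addrC subrK.
  have /eqP : (a i.+1 - a i) * (1 - step u) = 0 by rewrite mulrBr mulr1 E2 subrr.
  rewrite mulf_eq0 (negbTE d0) /= subr_eq0.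
  rewrite -[X in X == _](step_ge1 (lexx 1)) => /eqP /step_inj; rewrite lexx ler01 => /(_ erefl h01) uE.
  have jE : j = i.+1 by apply: (route_a_inj H).
  have sE : s - i%:R - 1 / 2 + rho = 2 * rho by have := congr1 (fun z => z * (2 * rho)) uE; rewrite /u /= divfK // => <-; rewrite mul1r.
  have jr : j%:R = i%:R + 1 :> R by rewrite jE natr1.
  have := routeY_inj H jN' _ (vert_phase H vt) EY.
  move: vt sE r0 r1 jr; rewrite /vert /phase; clear => vt sE r0 r1 jr E.
  have := E ltac:(move: sE r0 r1 jr; clear; lra).
  by move: vt sE jr; clear; lra.
apply/andP; split.
  have /andP[s0 s1] := step_itv u; rewrite /btw !lt_neqAle [a i == a j]eq_sym [a i.+1 == a j]eq_sym ni nS /= XS.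
  have [d0'|d0'] := leP 0 (a i.+1 - a i).
    apply/orP; left; rewrite lerDl mulr_ge0 //= -subr_ge0.
    have -> : a i.+1 - (a i + (a i.+1 - a i) * step u) = (a i.+1 - a i) * (1 - step u) by ring.
    by rewrite mulr_ge0 // subr_ge0.
  apply/orP; right; rewrite gerDl nmulr_rle0 // s0 andbT -subr_le0.
  have -> : a i.+1 - (a i + (a i.+1 - a i) * step u) = (a i.+1 - a i) * (1 - step u) by ring.
  by rewrite nmulr_rle0 // subr_ge0.
have n1 : b i.+1 != b j.
  apply/eqP => /(route_b_inj H) E; case/eqP: nS; rewrite E ?jN //.
have n2 : b i.+1 != b j.+1.
  apply/eqP => E; case/eqP: ni; have [jlt|jge] := ltnP j N.
    by have := route_b_inj H _ _ E; rewrite iN jlt /= => /(_ erefl erefl) [->].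
  have jE : j = N by apply/eqP; rewrite eqn_leq jN'.
  rewrite jE (route_bN1 H) in E; have := route_b_inj H _ _ E; rewrite iN N0 /= => /(_ erefl erefl) [->].
  by rewrite jE (route_aN H).
have := routeY_horiz H iN hs; rewrite EY ltr_norml => /andP[y1 y2].
have YT := routeYE H jN' (vert_phase H vt); set v := step _ in YT.
have /andP[v0 v1] : 0 <= v <= 1 by exact: step_itv.
rewrite /btw !lt_neqAle [b j == b i.+1]eq_sym [b j.+1 == b i.+1]eq_sym n1 n2 /=.
rewrite intrB in YT.
have [bj|bj] := leP (b j) (b j.+1); apply/orP; [left|right].
  have bj' : 0 <= (b j.+1)%:~R - (b j)%:~R :> R by rewrite subr_ge0 ler_int.
  have e1 := mulr_ge0 bj' v0; have e2 : 0 <= ((b j.+1)%:~R - (b j)%:~R) * (1 - v).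
    by rewrite mulr_ge0 // subr_ge0.
  by apply/andP; split; apply: int_le_lt1; move: e1 e2 YT y1 y2; clear; nra.
have bj' : 0 <= (b j)%:~R - (b j.+1)%:~R :> R by rewrite subr_ge0 ler_int ltW.
have e1 := mulr_ge0 bj' v0; have e2 : 0 <= ((b j)%:~R - (b j.+1)%:~R) * (1 - v).
  by rewrite mulr_ge0 // subr_ge0.
by apply/andP; split; apply: int_le_lt1; move: e1 e2 YT y1 y2; clear; nra.
Qed.

(** The two integer heights differ by less than 1, so they are equal and the two sides coincide; on
    one side the abscissa is injective. *)
Lemma horiz_horiz N a b rho i k s t : route N a b rho -> (i < N)%N -> (k < N)%N ->
  horiz rho i s -> horiz rho k t -> routeX N a rho s = routeX N a rho t ->
  routeY N b s = routeY N b t -> s = t.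
Proof.
move=> H iN kN hs ht EX EY.
have := routeY_horiz H iN hs; rewrite EY ltr_norml => /andP[y1 y2].
have := routeY_horiz H kN ht; rewrite ltr_norml => /andP[y3 y4].
have E : b i.+1 = b k.+1.
  by apply/eqP; rewrite eq_le; apply/andP; split; apply: int_le_lt1; move: y1 y2 y3 y4; clear; lra.
have := route_b_inj H _ _ E; rewrite iN kN /= => /(_ erefl erefl) [ik].
by subst k; exact: (routeX_inj H iN hs ht EX).
Qed.

Lemma vert_vert N a b rho i k s t : route N a b rho -> (0 < i <= N)%N -> (0 < k <= N)%N ->
  vert rho i s -> vert rho k t -> routeX N a rho s = routeX N a rho t ->
  routeY N b s = routeY N b t -> s = t.
Proof.
move=> H iN kN hs ht EX EY.
rewrite (routeX_vert (t := s) H iN) ?(routeX_vert (t := t) H kN) in EX; first last.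
- by move: hs ht; rewrite /vert; clear; lra.
- by move: hs ht; rewrite /vert; clear; lra.
have ik := route_a_inj H iN kN EX; subst k.
have /andP[_ iN'] := iN.
exact: (routeY_inj H iN' (vert_phase H hs) (vert_phase H ht) EY).
Qed.

Lemma IVT_btw (h : R -> R) (x y v : R) : x <= y -> (forall t, cts_at h t) ->
  btw v (h x) (h y) -> exists2 c : R, x < c < y & h c = v.
Proof.
move=> xy hc hv.
have [c /andP[c1 c2] hcv] : exists2 c : R, x <= c <= y & h c = v.
  move: hv => /orP[]/andP[v1 v2]; first by apply: IVT_cts => //; rewrite !ltW.
  have [||c cI E] := @IVT_cts R (fun t => - h t) x y (- v) xy.
  - by move=> t _ e /(hc t)[d d0 Hd]; exists d => // s /Hd; rewrite -opprD normrN.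
  - by rewrite !lerN2 !ltW.
  - by exists c => //; exact: oppr_inj.
have nx : x != c by apply: contraTneq hv => ->; rewrite hcv /btw !ltxx andbF.
have ny : c != y by apply: contraTneq hv => <-; rewrite hcv /btw !ltxx andbF.
by exists c => //; rewrite !lt_neqAle nx ny c1 c2.
Qed.

Lemma Cn_routeX k N a b rho : route N a b rho -> Cn k (routeX N a rho).
Proof.
move=> H; apply: Cn_loop_steps; first exact: route_gt0 H.
by have := route_rho H; clear; lra.
Qed.

Lemma Cn_routeY k N a b rho : route N a b rho -> Cn k (@routeY R N b).
Proof. by move=> H; apply: Cn_loop_steps; [exact: route_gt0 H|rewrite ltr01 lexx]. Qed.

Lemma routeX_cts N a b rho t : route N a b rho -> cts_at (routeX N a rho) t.
Proof. by move=> /(@Cn_routeX 0%N)/Cn_derivable H; exact: derivable_cts_at. Qed.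

Lemma routeY_cts N a b rho t : route N a b rho -> cts_at (@routeY R N b) t.
Proof. by move=> /(@Cn_routeY 0%N)/Cn_derivable H; exact: derivable_cts_at. Qed.

Lemma routeX_ends N a b rho i : route N a b rho -> (i < N)%N ->
  routeX N a rho (i%:R + 1 / 2 - rho) = a i /\ routeX N a rho (i%:R + 1 / 2 + rho) = a i.+1.
Proof.
move=> H iN; have /andP[r0 r1] := route_rho H; have r20 : 2 * rho != 0 by rewrite mulf_neq0 ?gt_eqF.
rewrite !(routeXE H iN); last 2 first.
- by move: r0 r1; clear; lra.
- by move: r0 r1; clear; lra.
rewrite step_le0; last by rewrite (_ : _ + rho = 0) ?mul0r //; ring.
rewrite step_ge1; last by rewrite (_ : _ + rho = 2 * rho) ?divff //; ring.
by split; ring.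
Qed.

Lemma horiz_reach N a b rho i v : route N a b rho -> (i < N)%N -> btw v (a i) (a i.+1) ->
  exists2 s, horiz rho i s & routeX N a rho s = v.
Proof.
move=> H iN hv; have [E1 E2] := routeX_ends H iN; have /andP[r0 r1] := route_rho H.
rewrite -E1 -E2 in hv.
have [|s|s /andP[s1 s2] E] := IVT_btw _ _ hv.
- by move: r0; clear; lra.
- exact: routeX_cts H.
- by exists s => //; rewrite /horiz !ltW.
Qed.

Lemma routeY_vert_start N a b rho j : route N a b rho -> (0 < j <= N)%N ->
  `|routeY N b (j%:R - 1 / 2 + rho) - (b j)%:~R| < 1 / 2.
Proof.
case: j => // j H /= jN; have /andP[r0 r1] := route_rho H.
have -> : j.+1%:R - 1 / 2 + rho = j%:R + 1 / 2 + rho :> R by rewrite -natr1; move: r0; clear; lra.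
by apply: (routeY_horiz H jN); rewrite /horiz; move: r0; clear; lra.
Qed.

Lemma routeY_vert_end N a b rho j : route N a b rho -> (0 < j <= N)%N ->
  `|routeY N b (j%:R + 1 / 2 - rho) - (b j.+1)%:~R| < 1 / 2.
Proof.
move=> H /andP[j0 jN]; have /andP[r0 r1] := route_rho H.
have [jlt|jge] := ltnP j N.
  by apply: (routeY_horiz H jlt); rewrite /horiz; move: r0; clear; lra.
have jE : j = N by apply/eqP; rewrite eqn_leq jN.
subst j; rewrite (route_bN1 H) (_ : N%:R + 1 / 2 - rho = 1 / 2 - rho + N%:R); last by ring.
rewrite (routeY_period _ H); apply: (routeY_horiz H j0).
by rewrite /horiz; move: r0; clear; lra.
Qed.

(** At the ends of its window the height is within 1/2 of [b j] and [b j.+1]; an integer strictly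
    between them leaves room for [v], and the intermediate value theorem applies. *)
Lemma vert_reach N a b rho j (v : R) (l : int) : route N a b rho -> (0 < j <= N)%N ->
  btw l (b j) (b j.+1) -> `|v - l%:~R| < 1 / 2 -> exists2 t, vert rho j t & routeY N b t = v.
Proof.
move=> H jN hl; rewrite ltr_norml => /andP[v1 v2]; have /andP[r0 r1] := route_rho H.
have := routeY_vert_start H jN; rewrite ltr_norml => /andP[y1 y2].
have := routeY_vert_end H jN; rewrite ltr_norml => /andP[y3 y4].
have bI (x y : int) : x < y -> x%:~R + 1 <= y%:~R :> R.
  by rewrite -[1]/(1%:~R : R) -intrD ler_int lezD1.
have [|||t tI E] := @IVT_btw (@routeY R N b) (j%:R - 1 / 2 + rho) (j%:R + 1 / 2 - rho) v.
- by move: r0 r1; clear; lra.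
- move=> t; exact: routeY_cts H.
- move: hl => /orP[]/andP[/bI l1 /bI l2]; apply/orP; [left|right]; move: l1 l2 v1 v2 y1 y2 y3 y4; clear; lra.
- by exists t.
Qed.

Lemma crossing_reached N a b rho i j : route N a b rho -> (i < N)%N -> (0 < j <= N)%N ->
  crossing a b i j -> exists s t, [/\ horiz rho i s, vert rho j t,
    routeX N a rho s = routeX N a rho t & routeY N b s = routeY N b t].
Proof.
move=> H iN jN /andP[ca cb]; have [s hs sE] := horiz_reach H iN ca.
have [t ht tE] := vert_reach H jN cb (routeY_horiz H iN hs).
exists s, t; split => //; rewrite sE (routeX_vert H jN) //.
by move: ht; rewrite /vert; clear; lra.
Qed.

End RouteCrossings.

(** * Regularity and double points of route curves *)

Section RouteCurve.
Variable R : realType.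
Implicit Types (t s rho : R) (N : nat) (a : nat -> R) (b : nat -> int).

Lemma derive1_period (V : normedModType R) (f : R -> V) (c : R) : (forall t, f (t + c) = f t) ->
  forall t, derive1 f (t + c) = derive1 f t.
Proof.
move=> fp t; rewrite /derive1.
have -> : (fun h : R => h^-1 *: (f (h + (t + c)) - f (t + c))) = (fun h : R => h^-1 *: (f (h + t) - f t)).
  by apply/funext => h; rewrite addrA !fp.
by [].
Qed.

Lemma derive1_routeX_period N a b rho t : route N a b rho ->
  derive1 (routeX N a rho) (t + N%:R) = derive1 (routeX N a rho) t.
Proof. by move=> H; apply: derive1_period => x; exact: routeX_period H. Qed.

Lemma derive1_routeY_period N a b rho t : route N a b rho ->
  derive1 (@routeY R N b) (t + N%:R) = derive1 (@routeY R N b) t.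
Proof. by move=> H; apply: derive1_period => x; exact: routeY_period H. Qed.

Lemma derive1_routeX_horiz N a b rho i t : route N a b rho -> (i < N)%N ->
  i%:R + 1 / 2 - rho < t < i%:R + 1 / 2 + rho -> derive1 (routeX N a rho) t != 0.
Proof.
move=> H iN /andP[t1 t2]; have /andP[r0 r1] := route_rho H; have r20 : 0 < 2 * rho by rewrite mulr_gt0.
rewrite /routeX (@derive1_loop_steps R _ _ _ _ i) //; first last.
- by move: r1 t1 t2; clear; lra.
- exact: route_aN H.
- by move: r0 r1; clear; lra.
rewrite mulf_neq0 ?(route_neq_a H) // mulf_neq0 ?invr_neq0 ?(gt_eqF r20) //.
rewrite gt_eqF // derive1_step_gt0 // ltr_pdivlMr // ltr_pdivrMr //.
by move: t1 t2; clear; lra.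
Qed.

Lemma derive1_routeX_vert N a b rho j t : route N a b rho -> (0 < j <= N)%N -> vert rho j t ->
  derive1 (routeX N a rho) t = 0.
Proof.
move=> H jN /andP[t1 t2]; rewrite derive1E.
have [_ ->//] : is_derive t 1 (routeX N a rho) 0.
apply: (@near_eq_is_derive R R R (fun=> a j) _ t 1).
near=> s; rewrite (routeX_vert H jN) //; apply/andP; split; apply: ltW; near: s.
  exact: lt_nbhsr.
exact: lt_nbhsl.
Unshelve. all: by end_near. Qed.

Lemma derive1_routeY_phase N a b rho j t : route N a b rho -> (j <= N)%N ->
  j%:R - 1 / 2 < t < j%:R + 1 / 2 -> derive1 (@routeY R N b) t != 0.
Proof.
move=> H jN t12.
have E i s : (i < N)%N -> i%:R - 1 / 2 < s < i%:R + 1 / 2 -> derive1 (@routeY R N b) s != 0.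
  move=> iN s12; rewrite /routeY (@derive1_loop_steps R _ _ _ _ i) ?ltr01 ?lexx //; first last.
  - by move: s12; clear; lra.
  - by rewrite (route_bN H).
  rewrite -intrB mulf_neq0 ?(route_neq_bR H (ltnW iN)) // divr1 gt_eqF // derive1_step_gt0 // !divr1.
  by move: s12; clear; lra.
have [jN'|jN'] := ltnP j N; first exact: E t12.
have {jN'} jN' : j = N by apply/eqP; rewrite eqn_leq jN.
subst j; rewrite -(subrK N%:R t) (derive1_routeY_period _ H); apply: (E 0%N (t - N%:R)); first exact: route_gt0 H.
by move: t12; clear; lra.
Qed.

Lemma route_regular N a b rho t : route N a b rho -> 1 / 2 - rho <= t < N%:R + 1 / 2 - rho ->
  derive1 (routeX N a rho) t != 0 \/ derive1 (@routeY R N b) t != 0.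
Proof.
move=> H tD; have /andP[r0 r1] := route_rho H.
have [[i iN]|[j jN]] := fundamental_piece H tD.
  move=> /andP[t1 t2]; have [ti|ti|->] := ltgtP t (i%:R + 1 / 2).
  - right; apply: (derive1_routeY_phase H (ltnW iN)).
    by move: t1 ti r0 r1; clear; lra.
  - right; apply: (derive1_routeY_phase H iN).
    by rewrite -natr1; move: t2 ti r0 r1; clear; lra.
  - by left; apply: (derive1_routeX_horiz H iN); move: r0; clear; lra.
move=> /andP[t1 t2]; right; have /andP[_ jN'] := jN; apply: (derive1_routeY_phase H jN').
by move: t1 t2 r0; clear; lra.
Qed.

(* Distinct points of the same kind, horizontal or vertical, are never superposed. *)
Lemma route_double N a b rho s t : route N a b rho ->
  1 / 2 - rho <= s < N%:R + 1 / 2 - rho -> 1 / 2 - rho <= t < N%:R + 1 / 2 - rho ->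
  s != t -> routeX N a rho s = routeX N a rho t -> routeY N b s = routeY N b t ->
  exists i j, [/\ (i < N)%N, (0 < j <= N)%N, crossing a b i j &
    horiz rho i s /\ vert rho j t \/ horiz rho i t /\ vert rho j s].
Proof.
move=> H sD tD /eqP st EX EY.
have [[i iN hi]|[j jN vj]] := fundamental_piece H sD; have [[k kN hk]|[l lN vl]] := fundamental_piece H tD.
- by case: st; exact: (horiz_horiz H iN kN hi hk).
- exists i, l; split=> //; last by left.
  exact: (horiz_vert_crossing H iN lN hi vl).
- exists k, j; split=> //; last by right.
  exact: (horiz_vert_crossing H kN jN hk vj).
- by case: st; exact: (vert_vert H jN lN vj vl).
Qed.

(** Of three times, two are of the same kind. *)
Lemma route_triple N a b rho s t u : route N a b rho ->
  1 / 2 - rho <= s < N%:R + 1 / 2 - rho -> 1 / 2 - rho <= t < N%:R + 1 / 2 - rho ->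
  1 / 2 - rho <= u < N%:R + 1 / 2 - rho ->
  routeX N a rho s = routeX N a rho t -> routeY N b s = routeY N b t ->
  routeX N a rho t = routeX N a rho u -> routeY N b t = routeY N b u ->
  [\/ s = t, t = u | s = u].
Proof.
move=> H sD tD uD X1 Y1 X2 Y2.
have X3 := etrans X1 X2; have Y3 := etrans Y1 Y2.
have [[i iN hi]|[j jN vj]] := fundamental_piece H sD; have [[k kN hk]|[l lN vl]] := fundamental_piece H tD.
- by constructor 1; exact: (horiz_horiz H iN kN hi hk).
- have [[m mN hm]|[m mN vm]] := fundamental_piece H uD.
    by constructor 3; exact: (horiz_horiz H iN mN hi hm).
  by constructor 2; exact: (vert_vert H lN mN vl vm).
- have [[m mN hm]|[m mN vm]] := fundamental_piece H uD.
    by constructor 2; exact: (horiz_horiz H kN mN hk hm).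
  by constructor 3; exact: (vert_vert H jN mN vj vm).
- by constructor 1; exact: (vert_vert H jN lN vj vl).
Qed.

Lemma crossing_interior N a b rho i j s t : route N a b rho -> (i < N)%N -> (0 < j <= N)%N ->
  crossing a b i j -> horiz rho i s -> vert rho j t -> routeX N a rho s = routeX N a rho t ->
  i%:R + 1 / 2 - rho < s < i%:R + 1 / 2 + rho.
Proof.
move=> H iN jN /andP[c _] /andP[s1 s2] vt.
rewrite (routeX_vert (t := t) H jN); last by move: vt; rewrite /vert; clear; lra.
have [E1 E2] := routeX_ends H iN => E; rewrite !lt_neqAle s1 s2 !andbT; apply/andP; split.
  apply: contraTneq c => E3; rewrite -E3 E1 in E.
  by rewrite /btw E !ltxx andbF.
apply: contraTneq c => E3; rewrite E3 E2 in E.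
by rewrite /btw E !ltxx andbF.
Qed.

(** The scale and the affine time change serve both the closed curve of period 1 and the arc
    inscribed in the unit disk. *)
Definition route_curve N a b rho (r c d : R) t : R * R :=
  (r * routeX N a rho (c * t + d), r * routeY N b (c * t + d)).

Lemma smooth_route_curve N a b rho r c d : route N a b rho -> smooth (route_curve N a b rho r c d).
Proof.
move=> H; apply/smooth_Cn => k; apply: (@Cn_pair R k (fun t => r * routeX N a rho (c * t + d))
   (fun t => r * routeY N b (c * t + d))).
  apply: (@CnM R k (fun=> r)); first exact: Cn_cst.
  by apply: (@Cn_affine R k (routeX N a rho) c d); exact: Cn_routeX H.
apply: (@CnM R k (fun=> r)); first exact: Cn_cst.
by apply: (@Cn_affine R k (@routeY R N b) c d); exact: Cn_routeY H.
Qed.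

Lemma derive1_route_curve N a b rho r c d t : route N a b rho ->
  derive1 (route_curve N a b rho r c d) t =
  (r * c * derive1 (routeX N a rho) (c * t + d), r * c * derive1 (@routeY R N b) (c * t + d)).
Proof.
move=> H.
have E (f : R -> R) : (forall k, Cn k f) ->
    is_derive t 1 (fun t => r * f (c * t + d)) (r * c * derive1 f (c * t + d)).
  move=> Cf; have D := @is_derive1_comp R f (fun x => c * x + d) t _ _
    (is_derive1P (Cn_derivable (Cf 0%N)) _) (is_derive_affine c d t).
  have D2 := is_deriveM (is_derive_cst r t (1 : R)) D.
  by apply: (is_derive_eq D2); rewrite !scaleE mulr0 addr0 /=; ring.
have EX := E _ (fun k => @Cn_routeX R k _ _ _ _ H); have EY := E _ (fun k => @Cn_routeY R k _ _ _ _ H).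
have D := (is_derive_pair (route_curve N a b rho r c d) t
  (r * c * derive1 (routeX N a rho) (c * t + d), r * c * derive1 (@routeY R N b) (c * t + d))).2 (conj EX EY).
by case: D => _ E0; rewrite derive1E; exact: E0.
Qed.

Lemma det_transverse (u v : R * R) : det u v != 0 -> transverse u v.
Proof.
move=> D w; exists (det w v / det u v), (det u w / det u v).
rewrite /det in D *.
by apply: injective_projections; rewrite /= !scaleE; field; exact: D.
Qed.

Lemma transverseC (u v : R * R) : transverse u v -> transverse v u.
Proof. by move=> H w; have [x [y ->]] := H w; exists y, x; rewrite addrC. Qed.

End RouteCurve.

(** * The closed route is a generic curve *)

Section ClosedRoute.
Variable R : realType.
Implicit Types (t s rho : R) (N : nat) (a : nat -> R) (b : nat -> int).

Lemma periodic_int (T : Type) (g : R -> T) : (forall t, g (t + 1) = g t) ->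
  forall (k : int) t, g (t + k%:~R) = g t.
Proof.
move=> gp; have gn (n : nat) t : g (t + n%:R) = g t.
  by elim: n => [|n IH]; rewrite ?addr0 // -natr1 addrA gp.
move=> [n|n] t; first exact: gn.
by rewrite NegzE mulrNz -[in RHS](subrK n.+1%:R t) gn.
Qed.

Lemma circle_eqC s t : circle_eq s t -> circle_eq t s.
Proof. by move=> [k E]; exists (- k); rewrite mulrNz -E opprB. Qed.

Lemma circle_eq_shift (s t : R) (k l : int) : s + k%:~R = t + l%:~R -> circle_eq s t.
Proof. by move=> E; exists (l - k); rewrite intrB; move: E; clear; lra. Qed.

Definition closed_route N a b rho : R -> R * R := route_curve N a b rho 1 N%:R 0.

Lemma closed_routeE N a b rho t : closed_route N a b rho t =
  (routeX N a rho (N%:R * t), routeY N b (N%:R * t)).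
Proof. by rewrite /closed_route /route_curve !mul1r addr0. Qed.

Lemma closed_route_period N a b rho t : route N a b rho ->
  closed_route N a b rho (t + 1) = closed_route N a b rho t.
Proof. by move=> H; rewrite !closed_routeE mulrDr mulr1 (routeX_period _ H) (routeY_period _ H). Qed.

Definition in_period N rho t := 1 / 2 - rho <= N%:R * t < N%:R + 1 / 2 - rho.

Lemma in_period_rep N a b rho t : route N a b rho -> exists k : int, in_period N rho (t + k%:~R).
Proof.
move=> H; have N0 : 0 < N%:R :> R by rewrite ltr0n (route_gt0 H).
exists (- Num.floor (t - (1 / 2 - rho) / N%:R)).
have /andP[f1 f2] := floor_itv (t - (1 / 2 - rho) / N%:R); rewrite intrD in f2.
move: (Num.floor _) f1 f2 => m f1 f2.
have E : (1 / 2 - rho) / N%:R * N%:R = 1 / 2 - rho by rewrite divfK // gt_eqF.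
move: ((1 / 2 - rho) / N%:R) E f1 f2 => q E f1 f2.
have h1 : 0 <= (t - q - m%:~R) * N%:R by rewrite mulr_ge0 ?subr_ge0 // ltW.
have h2 : 0 < (m%:~R + 1 - (t - q)) * N%:R by rewrite mulr_gt0 ?subr_gt0.
rewrite mulrNz /in_period; apply/andP; split; move: E h1 h2; clear; lra.
Qed.

Lemma closed_routeP N a b rho s t : closed_route N a b rho s = closed_route N a b rho t ->
  routeX N a rho (N%:R * s) = routeX N a rho (N%:R * t) /\
  routeY N b (N%:R * s) = routeY N b (N%:R * t).
Proof. by rewrite !closed_routeE => -[-> ->]. Qed.

Lemma transverse_axis (x1 y1 x2 y2 c : R) : x1 != 0 -> x2 = 0 -> y2 != 0 -> c != 0 ->
  transverse (c * x1, c * y1) (c * x2, c * y2).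
Proof.
move=> x10 -> y20 c0; apply: det_transverse.
by rewrite /det /= mulr0 mulr0 subr0 !mulf_neq0.
Qed.

Lemma pair_scale_neq0 (c x y : R) : c != 0 -> x != 0 \/ y != 0 -> (c * x, c * y) != 0 :> R * R.
Proof.
move=> c0 xy; apply/eqP => -[/eqP + /eqP]; rewrite !mulf_eq0 (negbTE c0) /=.
by case: xy => [/negbTE->|/negbTE-> _].
Qed.

Lemma route_transverse N a b rho i j s t (c : R) : route N a b rho -> (i < N)%N ->
  (0 < j <= N)%N -> crossing a b i j -> horiz rho i s -> vert rho j t ->
  routeX N a rho s = routeX N a rho t -> c != 0 ->
  transverse (c * derive1 (routeX N a rho) s, c * derive1 (@routeY R N b) s)
             (c * derive1 (routeX N a rho) t, c * derive1 (@routeY R N b) t).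
Proof.
move=> H iN jN cr hs vt EX c0; have /andP[_ jN'] := jN; have /andP[r0 r1] := route_rho H.
apply: (transverse_axis _ _ _ _ c0).
- exact: (derive1_routeX_horiz H iN (crossing_interior H iN jN cr hs vt EX)).
- exact: (derive1_routeX_vert H jN vt).
- by apply: (derive1_routeY_phase H jN'); move: vt r0; rewrite /vert; clear; lra.
Qed.

(** Every double point is a crossing of a horizontal with a vertical side. On the latter the
    velocity is vertical, and on the former it has a nonzero horizontal component. *)
Lemma closed_route_generic N a b rho : route N a b rho -> generic_curve (closed_route N a b rho).
Proof.
move=> H; have N0 : 0 < N%:R :> R by rewrite ltr0n (route_gt0 H).
set g := closed_route N a b rho.
have gp := fun t => closed_route_period t H; rewrite -/g in gp.
have gpk := periodic_int gp.
have dgk := periodic_int (derive1_period gp).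
have dgE t : derive1 g t = (N%:R * derive1 (routeX N a rho) (N%:R * t), N%:R * derive1 (@routeY R N b) (N%:R * t)).
  by rewrite /g /closed_route (derive1_route_curve _ _ _ _ H) addr0 mul1r.
split.
- by split; [exact: gp|exact: smooth_route_curve].
- move=> t; have [k tD] := in_period_rep t H; rewrite -(dgk k) dgE.
  by apply: pair_scale_neq0; [rewrite gt_eqF|exact: route_regular H tD].
- move=> s t nst; have [k sD] := in_period_rep s H; have [l tD] := in_period_rep t H.
  rewrite -(gpk k s) -(gpk l t) -(dgk k s) -(dgk l t) => /closed_routeP[EX EY].
  have st : N%:R * (s + k%:~R) != N%:R * (t + l%:~R).
    by apply/eqP => /(mulfI (lt0r_neq0 N0)) /circle_eq_shift.
  have [i [j [iN jN cr [[hs vt]|[ht vs]]]]] := route_double H sD tD st EX EY; rewrite !dgE.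
    by apply: (route_transverse H iN jN cr hs vt EX); rewrite gt_eqF.
  by apply/transverseC/(route_transverse H iN jN cr ht vs) => //; rewrite gt_eqF.
- move=> s t u; have [k sD] := in_period_rep s H; have [l tD] := in_period_rep t H.
  have [m uD] := in_period_rep u H; rewrite -(gpk k s) -(gpk l t) -(gpk m u).
  move=> /closed_routeP[X1 Y1] /closed_routeP[X2 Y2].
  have [] := route_triple H sD tD uD X1 Y1 X2 Y2 => /(mulfI (lt0r_neq0 N0)) /circle_eq_shift E.
  + by constructor 1.
  + by constructor 2.
  + by constructor 3.
(* A double point is the value of [F] at its pair of sides, so there are finitely many; the default
   [(0, 0)] is taken only at pairs without such a time. *)
pose F (ij : 'I_N * 'I_N.+1) := xget (0, 0)
  [set x | exists s, [/\ horiz rho ij.1 s, routeX N a rho s = a ij.2 & x = (routeX N a rho s, routeY N b s)]].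
apply: (@sub_finite_set _ _ (range F)); last exact/finite_image/finite_finset.
move=> x [s [t [nst]]]; have [k sD] := in_period_rep s H; have [l tD] := in_period_rep t H.
rewrite -(gpk k s) -(gpk l t) => gsx gtx.
have /closed_routeP[EX EY] : g (s + k%:~R) = g (t + l%:~R) by rewrite gsx.
have st : N%:R * (s + k%:~R) != N%:R * (t + l%:~R).
  by apply/eqP => /(mulfI (lt0r_neq0 N0)) /circle_eq_shift.
have key i j s' t' : (i < N)%N -> (0 < j <= N)%N -> horiz rho i s' -> vert rho j t' ->
    routeX N a rho s' = routeX N a rho t' -> range F (routeX N a rho s', routeY N b s').
  move=> iN jN hs vt EX'; have /andP[_ jN'] := jN.
  have Xa : routeX N a rho s' = a j.
    by rewrite EX' (routeX_vert H jN) //; move: vt; rewrite /vert; clear; lra.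
  exists (Ordinal iN, Ordinal (jN' : (j < N.+1)%N)) => //; rewrite /F /=.
  case: xgetP => [x' -> [s2 [h2 X2 ->]]|nx].
    by rewrite (routeX_inj H iN h2 hs) // X2.
  by case: (nx (routeX N a rho s', routeY N b s')); exists s'.
have [i [j [iN jN cr [[hs vt]|[ht vs]]]]] := route_double H sD tD st EX EY.
  by rewrite -gsx /g closed_routeE; apply: (key i j _ _ iN jN hs vt).
by rewrite -gtx /g closed_routeE; apply: (key i j _ _ iN jN ht vs).
Qed.

End ClosedRoute.

(** * Circle diffeomorphisms with prescribed values *)

Section DiffeoThroughPoints.
Variable R : realType.
Implicit Types (t s w : R).

Lemma step_le (x y : R) : x <= y -> step x <= step y.
Proof.
rewrite le_eqVlt => /orP[/eqP->//|xy].
have [y0|y0] := leP y 0; first by rewrite !step_le0 // ltW // (lt_le_trans xy).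
have [x1|x1] := leP 1 x; first by rewrite !step_ge1 // ltW // (le_lt_trans x1).
exact/ltW/step_lt.
Qed.

Lemma stair_le w s t : 0 < w -> s <= t -> stair w s <= stair w t.
Proof.
move=> w0 st; have /andP[s1 s2] := floor_itv s; have /andP[t1 t2] := floor_itv t.
rewrite /stair; have := le_floor st; rewrite le_eqVlt => /orP[/eqP E|lt].
  by rewrite E lerD2l; apply: step_le; rewrite ler_pM2r ?invr_gt0 // lerD2r.
have : (Num.floor s + 1)%:~R <= (Num.floor t)%:~R :> R by rewrite ler_int lezD1.
have /andP[_ h1] := step_itv ((s - (Num.floor s)%:~R) / w).
have /andP[h2 _] := step_itv ((t - (Num.floor t)%:~R) / w).
by rewrite intrD; move: h1 h2; clear; lra.
Qed.

(** A linear map of small slope [2 * e] plus stairs of width [1 / M], the [i]-th one rising between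
    the nodes [i] and [i.+1] by what is missing. *)
Lemma circle_diffeo_through M (sigma : nat -> R) : (0 < M)%N ->
  (forall i, (i < M)%N -> sigma i < sigma i.+1) -> sigma M = sigma 0%N + 1 ->
  exists2 h, circle_diffeo h & forall i, (i < M)%N -> h (i%:R / M%:R) = sigma i.
Proof.
move=> M0 sS sM; have M0r : 0 < M%:R :> R by rewrite ltr0n.
have M1r : 1 <= M%:R :> R by rewrite ler1n.
(* Small enough for the remaining rises [c i] to be nonnegative. *)
have [e e0 /allP He] := @lower_bound_pos R [seq (sigma i.+1 - sigma i) * M%:R / 2 | i <- iota 0 M]
  ltac:(by apply/allP => x /mapP[i]; rewrite mem_iota => /andP[_ iM] ->; rewrite divr_gt0 ?mulr_gt0 ?subr_gt0 ?sS).
pose c i := sigma i.+1 - sigma i - 2 * e / M%:R.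
have c0 i : (i < M)%N -> 0 <= c i.
  move=> iM; have iI : i \in iota 0 M by rewrite mem_iota.
  have lt := He _ (map_f (fun i => (sigma i.+1 - sigma i) * M%:R / 2) iI).
  rewrite /c subr_ge0 ler_pdivrMr // ltW //; move: lt; clear; lra.
have c_sum j : (j <= M)%N -> \sum_(i < j) c i = sigma j - sigma 0%N - 2 * e * j%:R / M%:R.
  elim: j => [|j IH] jM; first by rewrite big_ord0 mulr0 mul0r; ring.
  by rewrite big_ord_recr /= IH ?(ltnW jM) // /c -natr1; ring.
pose w : R := M%:R^-1; have w0 : 0 < w by rewrite invr_gt0.
have w01 : 0 < w <= 1 by rewrite w0 invf_le1.
pose S t := \sum_(i < M) c i * stair w (t - i%:R / M%:R).
have Sle s t : s <= t -> S s <= S t.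
  by move=> st; apply: ler_sum => i _; rewrite ler_wpM2l ?c0 // stair_le // lerD2r.
have Cst k (f : R -> R) (v : R) : Cn k f -> Cn k (fun t => v * f t).
  by move=> Cf; apply: (@CnM R k (fun=> v)); [exact: Cn_cst|].
have Cid k : Cn k (id : R -> R).
  elim: k => [|k IH]; first by move=> j; rewrite leqn0 => /eqP-> x; exact: derivable_id.
  by apply: (@Cn_is_derive R _ k id (fun=> 1)) ; exact: Cn_cst.
have CS k : Cn k S.
  apply: (@Cn_sum R R k M (fun i t => c i * stair w (t - i%:R / M%:R))) => i iM; apply: Cst.
  have := @Cn_affine R k (stair w) 1 (- (i%:R / M%:R)) (@Cn_stair R k _ w01).
  by congr Cn; apply/funext => t; rewrite mul1r.
(* Half of the slope makes [F] increasing, hence of nonnegative derivative; the other half bounds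
   the derivative of [h] below by [e]. *)
pose F t := e * t + S t.
have CF k : Cn k F by apply: (@CnD R R k (fun t => e * t) S); [exact: Cst (Cid k)|].
pose h t := sigma 0%N + (e * t + F t).
have Ch k : Cn k h.
  apply: (@CnD R R k (fun=> sigma 0%N)); first exact: Cn_cst.
  by apply: (@CnD R R k (fun t => e * t) F); [exact: Cst (Cid k)|].
exists h; first split.
- exact/smooth_Cn.
- move=> t; rewrite /h /F; suff -> : S (t + 1) = S t + 1 - 2 * e by ring.
  have := c_sum M (leqnn M); rewrite sM mulfK ?gt_eqF // => cs.
  transitivity (S t + \sum_(i < M) c i); last by rewrite cs; ring.
  rewrite /S -big_split; apply: eq_bigr => i _ /=.
  by rewrite addrAC stairD1; ring.
- move=> t; have F0 : 0 <= derive1 F t.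
    apply: (@incr_derive1_ge0 R F setT); last by rewrite interiorT.
      by move=> x _; exact: (Cn_derivable (CF 0%N)).
    by move=> x y _ _ xy; rewrite /F ltr_leD ?Sle ?(ltW xy) // ltr_pM2l.
  have D1 := is_deriveD (is_deriveM (is_derive_cst e t (1 : R)) (is_derive_id t (1 : R)))
    (is_derive1P (Cn_derivable (CF 0%N)) t).
  have D := is_deriveD (is_derive_cst (sigma 0%N) t (1 : R)) D1.
  have [_ E] : is_derive t 1 h (e + derive1 F t).
    by apply: (is_derive_eq D); rewrite !scaleE /=; ring.
  by rewrite derive1E E; move: e0 F0; clear; lra.
move=> j jM; rewrite /h /F; suff -> : S (j%:R / M%:R) = \sum_(i < j) c i.
  by rewrite (c_sum j (ltnW jM)); ring.
rewrite /S -(big_mkord xpredT (fun i => c i * stair w (j%:R / M%:R - i%:R / M%:R))).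
rewrite (@big_cat_nat _ _ _ j) //=; last exact: ltnW.
rewrite [X in _ + X]big_nat_cond [X in _ + X]big1 ?addr0.
  rewrite -[RHS](big_mkord xpredT c); apply: eq_big_nat => i /andP[_ ij].
  rewrite -mulrBl stair_itv //.
    by rewrite step_ge1 ?mulr1 // /w invrK divfK ?gt_eqF // lerBrDr -[1]/(1%:R : R) -natrD ler_nat.
  apply/andP; split; first by rewrite divr_ge0 ?(ltW M0r) // subr_ge0 ler_nat ltnW.
  rewrite ler_pdivrMr // mul1r lerBlDr -natrD ler_nat; move: ij jM; clear; lia.
move=> i /andP[/andP[ji iM] _]; rewrite -mulrBl.
have ji' : j%:R <= i%:R :> R by rewrite ler_nat.
have iM' : i%:R <= M%:R :> R by rewrite ler_nat ltnW.
have j0 : 0 <= j%:R :> R by [].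
have ij0 : -1 <= ((j%:R - i%:R) / M%:R : R) <= 0.
  by rewrite ler_pdivlMr // ler_pdivrMr //; move: ji' iM' j0; clear; lra.
rewrite stair_itv_neg // step_ge1 ?subrr ?mulr0 // /w invrK mulrDl divfK ?gt_eqF // mul1r.
rewrite addrAC lerBrDr -[1]/(1%:R : R) -!natrD ler_nat; move: iM; clear; lia.
Qed.

End DiffeoThroughPoints.

(** * The route drawn from a permutation *)

Section PermutationRoute.
Variable R : realType.
Implicit Types (n k l : nat) (q : nat -> nat).

(* Nested edges have increasing depths, and depths are distinct. *)
Definition depth n q k : nat := (edge_hi q k - edge_lo q k) * n.+2 + k.

(** Even edges are drawn above the line, odd ones below, each at its depth. *)
Definition level n q k : int := if odd k then - (depth n q k)%:Z else (depth n q k)%:Z.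

(** As the edges do not interlace, an end of [l] strictly inside [k] makes [l] strictly shorter than
    [k]; the index, below [n.+2], cannot compensate for one unit of length. *)
Lemma nested_depth n q k l : noncrossing n q -> (k <= n)%N -> (l <= n)%N -> odd k = odd l ->
  (edge_lo q k < edge_lo q l < edge_hi q k)%N || (edge_lo q k < edge_hi q l < edge_hi q k)%N ->
  (depth n q l < depth n q k)%N.
Proof.
move=> NC kn ln od H; have N1 := NC k l kn ln od; have N2 := NC l k ln kn (esym od).
have lk : (edge_lo q k < edge_hi q k)%N by move: H => /orP[]/andP[]; clear; lia.
have ll : (edge_lo q l <= edge_hi q l)%N by rewrite /edge_lo /edge_hi; clear; lia.
have : (edge_hi q l - edge_lo q l < edge_hi q k - edge_lo q k)%N.
  move: H => /orP[]/andP[h1 h2].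
    have : ~~ (edge_hi q k < edge_hi q l)%N by apply/negP => h3; exact: N1.
    by move: h1 h2 lk ll; clear; lia.
  have : ~~ (edge_lo q l < edge_lo q k)%N by apply/negP => h3; apply: N2; split=> //; move: h1; clear; lia.
  by move: h1 h2 lk ll; clear; lia.
rewrite /depth -(leq_pmul2r (ltn0Sn n.+1)) mulSn; move: ln; clear.
move: (_ * _)%N (_ * _)%N => x y; lia.
Qed.

(** Of the two edges ending at [q l], the one of the parity of [k] is nested in [k], hence closer to
    the line, and the other is across the line. The vertical side between them does not reach the
    level of [k]. *)
Lemma edge_not_crossed n q k l : noncrossing n q -> (k <= n)%N -> (0 < l <= n)%N ->
  (edge_lo q k < q l < edge_hi q k)%N -> ~~ btw (level n q k) (level n q l.-1) (level n q l).
Proof.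
case: l => // l NC kn /= ln H.
have [od|od] := eqVneq (odd k) (odd l).
  have := @nested_depth n q k l NC kn (ltnW ln) od.
  have -> : (edge_lo q k < edge_lo q l < edge_hi q k)%N || (edge_lo q k < edge_hi q l < edge_hi q k)%N.
    rewrite /edge_lo /edge_hi in H *; move: H; clear; lia.
  move=> /(_ isT); rewrite /btw /level /= od; case: (odd l) => /=; clear; lia.
have {od} od : odd k = odd l.+1 by rewrite /=; move: od; case: (odd k); case: (odd l).
have := @nested_depth n q k l.+1 NC kn ln od.
have -> : (edge_lo q k < edge_lo q l.+1 < edge_hi q k)%N || (edge_lo q k < edge_hi q l.+1 < edge_hi q k)%N.
  rewrite /edge_lo /edge_hi in H *; move: H; clear; lia.
move=> /(_ isT); rewrite /btw /level /= od /=; case: (odd l) => /=; clear; lia.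
Qed.

Variables (n : nat) (p : 'S_n).

Definition top : nat := (n.+2 ^ 2)%N.

(** With [abscissas], the route runs on the line, at height 0, from -1 to [y + 1], climbs to
    [top + 1], comes back above everything to [x], and descends to the level of edge 0. Then the
    horizontal side [k.+2] draws edge [k], and the vertical side [k.+2] crosses the line at
    [pos p k]. From the end of edge [n], at abscissa [y], it moves vertically to [top] (crossing the
    line, for theta, when [n] is odd), returns to -1 and descends to the line through edge 0; this
    last crossing is the letter 0. *)
Definition heights (j : nat) : int :=
  match j with
  | 0 => top%:Z
  | 1 => 0
  | 2 => top%:Z + 1
  | j'.+3 => if (j' <= n)%N then level n (pos p) j' else if j' == n.+1 then top%:Z else 0
  end.

Definition abscissas (x y : R) (j : nat) : R :=
  match j with
  | 0 => - 1
  | 1 => y + 1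
  | 2 => x
  | j'.+3 => if (j' < n)%N then (pos p j'.+1)%:R else if j' == n then y else - 1
  end.

Lemma edge_lo_lt_hi k : (k <= n)%N -> (edge_lo (pos p) k < edge_hi (pos p) k <= n.+1)%N.
Proof.
move=> kn; have ne : pos p k != pos p k.+1.
  apply/eqP => /pos_inj E; have := E (leqW kn) kn; move/eqP.
  by rewrite -[X in _ == X]addn1 -[X in X == _]addn0 eqn_add2l.
have hi i : (i <= n.+1)%N -> (pos p i <= n.+1)%N.
  case: i => // i; rewrite ltnS leq_eqVlt => /orP[/eqP->|iN]; first by rewrite pos_n.
  by have := @pos_itv n p i.+1 iN; clear; lia.
have h1 := hi _ (leqW kn); have h2 := hi k.+1 kn.
rewrite /edge_lo /edge_hi; move: ne h1 h2; clear; lia.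
Qed.

Lemma depth_itv k : (k <= n)%N -> (n.+2 <= depth n (pos p) k < top)%N.
Proof.
move=> kn; have /andP[h1 h2] := edge_lo_lt_hi kn.
have /andP[g1 g2] : (1 <= edge_hi (pos p) k - edge_lo (pos p) k <= n.+1)%N by move: h1 h2; clear; lia.
have := leq_mul g1 (leqnn n.+2); have := leq_mul g2 (leqnn n.+2).
rewrite /depth /top; move: (_ * _)%N kn => x kn; clear -kn; rewrite mul1n; nia.
Qed.

Lemma depth_inj k l : (k <= n)%N -> (l <= n)%N -> depth n (pos p) k = depth n (pos p) l -> k = l.
Proof.
move=> kn ln /(congr1 (modn^~ n.+2)); rewrite /depth !modnMDl !modn_small //; move: kn ln; clear; lia.
Qed.

Lemma level_inj k l : (k <= n)%N -> (l <= n)%N -> level n (pos p) k = level n (pos p) l -> k = l.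
Proof.
move=> kn ln E; apply: depth_inj => //.
have /andP[h1 _] := depth_itv kn; have /andP[h2 _] := depth_itv ln.
by move: E h1 h2; rewrite /level; case: (odd k); case: (odd l); clear; lia.
Qed.

Lemma level_itv k : (k <= n)%N -> [/\ level n (pos p) k < top%:Z, - top%:Z < level n (pos p) k &
  level n (pos p) k != 0].
Proof.
move=> kn; have /andP[h1 h2] := depth_itv kn; rewrite /level.
by case: (odd k); split; move: h1 h2; clear; lia.
Qed.

Lemma level_opposite k : (k < n)%N -> btw 0 (level n (pos p) k) (level n (pos p) k.+1).
Proof.
move=> kn; have /andP[h1 _] := depth_itv (ltnW kn); have /andP[h2 _] := depth_itv kn.
by rewrite /btw /level /=; case: (odd k) => /=; move: h1 h2; clear; lia.
Qed.

Lemma heights_inj i j : (0 < i <= n + 4)%N -> (0 < j <= n + 4)%N -> heights i = heights j -> i = j.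
Proof.
have h0 : (0 < top)%N by [].
have key k : (k <= n.+1)%N -> heights k.+3 = if k == n.+1 then top%:Z else level n (pos p) k.
  by move=> kn; rewrite /=; have [->|ne] := eqVneq k n.+1; rewrite ?ltnn // ifT // -ltnS ltn_neqAle ne.
wlog ij : i j / (i < j)%N => [W|] iN jN E.
  by case: (ltngtP i j) => // h; [exact: W|apply/esym; exact: W].
case: i ij iN E => [//|[|[|i]]] ij iN; case: j jN ij => [//|[|[|j]]] jN ij //.
- rewrite key; last by move: jN; clear; lia.
  case: eqVneq => [_|ne]; first by rewrite /heights; move: h0; clear; lia.
  by have [|_ _ /eqP] := @level_itv j; [move: jN ne; clear; lia|rewrite /heights => h E; case: h].
- rewrite key; last by move: jN; clear; lia.
  case: eqVneq => [_|ne]; first by rewrite /heights; clear; lia.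
  by have [|h _ _] := @level_itv j; [move: jN ne; clear; lia|rewrite /heights; move: h; clear; lia].
rewrite !key; [|by move: jN; clear; lia|by move: iN; clear; lia].
have [|ine] := eqVneq i n.+1; first by move: ij jN; clear; lia.
case: eqVneq => [_|jne].
  by have [|h _ _] := @level_itv i; [move: iN ine; clear; lia|move=> E; move: h; rewrite E ltxx].
move=> /level_inj E; rewrite E //; [move: iN ine|move: jN jne]; clear; lia.
Qed.

Lemma heights_level k : (k <= n)%N -> heights k.+3 = level n (pos p) k.
Proof. by rewrite /heights => ->. Qed.

Lemma heights_N : heights n.+4 = top%:Z.
Proof. by rewrite /heights ltnn eqxx. Qed.

Lemma heights_N1 : heights n.+4.+1 = 0.
Proof. by rewrite /heights ltnNge leqW //= gtn_eqF. Qed.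

Lemma heights_le k : k != 2 -> heights k <= top%:Z.
Proof.
case: k => [|[|[|k]]] // _; rewrite /heights.
case: ifP => [/level_itv[/ltW]//|_]; by case: ifP.
Qed.

Lemma abscissas_lt (x y : R) i : (i < n)%N -> abscissas x y i.+3 = (pos p i.+1)%:R.
Proof. by move=> h; rewrite /= h. Qed.

Lemma abscissas_n (x y : R) : abscissas x y n.+3 = y.
Proof. by rewrite /= ltnn eqxx. Qed.

Lemma abscissas_N (x y : R) : abscissas x y (n + 4) = -1.
Proof. by rewrite addn4 /= ifF ?ltnNge ?leqnSn // ifF // -[X in _ == X]addn0 -addn1 eqn_add2l. Qed.

Lemma abscissasP (x y : R) k : (k <= n.+1)%N ->
  [/\ (k < n)%N & abscissas x y k.+3 = (pos p k.+1)%:R] \/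
  [/\ k = n & abscissas x y k.+3 = y] \/ [/\ k = n.+1 & abscissas x y k.+3 = -1].
Proof.
case: (ltngtP k n) => [kn _|nk kn|->]; first by left; split => //; exact: abscissas_lt.
  have -> : k = n.+1 by move: nk kn; clear; lia.
  by right; right; split => //; rewrite -(abscissas_N x y) addn4.
by right; left; split => //; exact: abscissas_n.
Qed.

Lemma abscissas_inj (x y : R) i j : x < -1 -> n.+1%:R <= y -> (0 < i <= n + 4)%N -> (0 < j <= n + 4)%N ->
  abscissas x y i = abscissas x y j -> i = j.
Proof.
move=> x1 yn; have n0 : 0 <= n%:R :> R by [].
rewrite -natr1 in yn.
wlog ij : i j / (i < j)%N => [W|] iN jN E.
  by case: (ltngtP i j) => // h; [exact: W|apply/esym; exact: W].
have pI k : (k < n)%N -> 1 <= (pos p k.+1)%:R :> R /\ (pos p k.+1)%:R <= n%:R :> R.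
  by move=> kn; have /andP[h1 h2] := @pos_itv n p k.+1 kn; rewrite ler1n ler_nat.
case: i ij iN E => [//|[|[|i]]] ij iN; case: j jN ij => [//|[|[|j]]] jN ij //.
- by rewrite /= => E; exfalso; move: E x1 yn n0; clear; lra.
- have [[jn ->]|[[_ ->]|[_ ->]]] := @abscissasP x y j ltac:(move: jN; clear; lia).
  + by have [h1 h2] := pI j jn; rewrite /= => E; exfalso; move: yn h2 E; clear; lra.
  + by rewrite /= => E; exfalso; move: E; clear; lra.
  + by rewrite /= => E; exfalso; move: E yn n0; clear; lra.
- have [[jn ->]|[[_ ->]|[_ ->]]] := @abscissasP x y j ltac:(move: jN; clear; lia).
  + by have [h1 h2] := pI j jn; rewrite /= => E; exfalso; move: x1 h1 E; clear; lra.
  + by rewrite /= => E; exfalso; move: E x1 yn n0; clear; lra.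
  + by rewrite /= => E; exfalso; move: E x1; clear; lra.
have [[kn ->]|[[kE ->]|[kE ->]]] := @abscissasP x y i ltac:(move: iN; clear; lia);
  have [[jn ->]|[[jE ->]|[jE ->]]] := @abscissasP x y j ltac:(move: jN; clear; lia).
- by move/eqP; rewrite eqr_nat => /eqP /pos_inj E; rewrite E // leqW.
- by have [h1 h2] := pI i kn => E; exfalso; move: yn h2 E; clear; lra.
- by have [h1 h2] := pI i kn => E; exfalso; move: h1 E; clear; lra.
- by have [h1 h2] := pI j jn => E; exfalso; move: yn h2 E; clear; lra.
- by move: ij; rewrite kE jE ltnn.
- by move=> E; exfalso; move: E yn n0; clear; lra.
- by have [h1 h2] := pI j jn => E; exfalso; move: h1 E; clear; lra.
- by move=> E; exfalso; move: E yn n0; clear; lra.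
- by move: ij; rewrite kE jE ltnn.
Qed.

Lemma pos_btw k : (k < n)%N -> 1 <= (pos p k.+1)%:R :> R /\ (pos p k.+1)%:R <= n%:R :> R.
Proof. by move=> kn; have /andP[h1 h2] := @pos_itv n p k.+1 kn; rewrite ler1n ler_nat. Qed.

(** Replacing the end positions 0 and [n.+1] by [x] and [y] does not change their order relative to
    1, ..., n. *)
Lemma abscissas_edge (x y : R) k l : x < -1 -> n.+1%:R <= y -> (k <= n)%N -> (l < n)%N ->
  btw (pos p l.+1)%:R (abscissas x y k.+2) (abscissas x y k.+3) ->
  (edge_lo (pos p) k < pos p l.+1 < edge_hi (pos p) k)%N.
Proof.
move=> x1 yn kn ln; have [l1 l2] := pos_btw ln; have pn : (pos p l.+1 <= n)%N by rewrite -(ler_nat R).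
have p0 : (0 < pos p l.+1)%N by rewrite -(ltr_nat R) (lt_le_trans _ l1).
have E1 : abscissas x y k.+2 = if k is k'.+1 then (pos p k)%:R else x.
  by case: k kn => // k kn; rewrite (@abscissas_lt x y k).
have [[kn' ->]|[[kE]|[kE _]]] := abscissasP x y (leqW kn); last by move: kn; rewrite kE ltnn.
  rewrite E1 /btw /edge_lo /edge_hi; case: k kn kn' {E1} => [|k] kn kn' /orP[]/andP[].
  - by move=> _; rewrite ltr_nat => h; change (pos p 0) with 0%N; move: p0 h; clear; lia.
  - by move=> _ h; exfalso; move: h x1 l1; clear; lra.
  - by rewrite !ltr_nat; clear; lia.
  - by rewrite !ltr_nat; clear; lia.
move=> ->; have pk : pos p k.+1 = n.+1 by rewrite kE pos_n.
rewrite E1 /btw /edge_lo /edge_hi pk; case: k kE {kn E1 pk} => [|k] kE /orP[]/andP[].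
- by exfalso; move: ln kE; clear; lia.
- by exfalso; move: ln kE; clear; lia.
- by rewrite ltr_nat; move: pn; clear; lia.
- by move=> h; exfalso; rewrite -natr1 in yn; move: h l2 yn; clear; lra.
Qed.

End PermutationRoute.

(** * The crossings of this route are the letters of the word *)

Section PermutationCrossings.
Variable R : realType.

(** [step] is continuous with values 0 at 0 and 1 at 1, and [D] bounds all the height differences;
    so a small [rho] exists. *)
Lemma route_exists N (a : nat -> R) (b : nat -> int) : (1 < N)%N -> a N = a 0%N -> b N = b 0%N ->
  b N.+1 = b 1%N ->
  (forall i j, (0 < i <= N)%N -> (0 < j <= N)%N -> a i = a j -> i = j) ->
  (forall i j, (0 < i <= N)%N -> (0 < j <= N)%N -> b i = b j -> i = j) ->
  exists rho, route N a b rho.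
Proof.
move=> N1 aN bN bN1 ia ib.
pose D : R := 1 + \sum_(j < N.+1) `|(b j.+1 - b j)%:~R|.
have D0 : 0 < D by rewrite ltr_pwDl // sumr_ge0.
have leD j : (j <= N)%N -> `|(b j.+1 - b j)%:~R : R| <= D.
  move=> jN; rewrite /D (bigD1 (Ordinal (jN : (j < N.+1)%N))) //= addrCA lerDl addr_ge0 //.
  by rewrite sumr_ge0.
have sc t : cts_at (@step R) t by apply: derivable_cts_at; exact: (Cn_derivable (@Cn_step R 0%N)).
have e0 : 0 < (2 * D)^-1 by rewrite invr_gt0 mulr_gt0.
have [d d0 Hd] := sc 0 _ e0; have [d' d'0 Hd'] := sc 1 _ e0.
have [rho rho0 /=] := lower_bound_pos (s := [:: d; d'; 1 / 2]) ltac:(by rewrite /= d0 d'0 divr_gt0).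
move=> /and4P[rd rd' rh _]; exists rho.
have [/andP[s0 _] /andP[_ s1]] := (step_itv rho, step_itv (1 - rho)).
have small x j : 0 <= x -> x < (2 * D)^-1 -> (j <= N)%N -> `|(b j.+1 - b j)%:~R : R| * x < 1 / 2.
  move=> x0 xD /leD h; apply: (@le_lt_trans _ _ (D * x)); first by rewrite ler_wpM2r.
  have -> : 1 / 2 = D * (2 * D)^-1 :> R by field; rewrite gt_eqF.
  by rewrite ltr_pM2l.
split=> //; first by rewrite rho0.
  move=> j; apply: small => //; have := Hd rho; rewrite subr0 gtr0_norm // => /(_ rd).
  by rewrite (step_le0 (lexx 0)) subr0 ger0_norm.
move=> j; apply: small; first by rewrite subr_ge0.
have := Hd' (1 - rho); rewrite [1 - rho - 1]addrAC subrr add0r normrN gtr0_norm // => /(_ rd').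
by rewrite (step_ge1 (lexx 1)) distrC ger0_norm // subr_ge0.
Qed.

Variables (n : nat) (p : 'S_n).
Local Notation A := (abscissas p).
Local Notation B := (heights p).

Lemma perm_route_exists (x y : R) : x < -1 -> n.+1%:R <= y -> exists rho, route (n + 4) (A x y) B rho.
Proof.
move=> x1 yn; apply: route_exists.
- by rewrite addn4.
- by rewrite abscissas_N.
- by rewrite addn4 heights_N.
- by rewrite addn4 heights_N1.
- by move=> i j; exact: abscissas_inj.
- by move=> i j; exact: heights_inj.
Qed.

Lemma crossing_cases (x y : R) i j : (0 < n)%N -> noncrossing n (pos p) -> x < -1 -> n.+1%:R <= y ->
  (i < n + 4)%N -> (0 < j <= n + 4)%N -> crossing (A x y) B i j ->
  i = 0%N /\ (exists2 k, (0 < k < half n)%N & j = k.+2) \/ i = 2 /\ j = (n + 4)%N.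
Proof.
move=> n0 NC x1 yn iN jN; have nn : 0 <= n%:R :> R by [].
have yn' := yn; rewrite -natr1 in yn'.
case: i iN => [|[|k]] iN /andP[].
- case: j jN => [|[|[|l]]] // jN.
  have lN : (l <= n.+1)%N by move: jN; clear; lia.
  have [[ln _] _|[[lE _]|[lE]]] := abscissasP p x y lN.
  + by left; split=> //; exists l.+1 => //; rewrite /half; move: ln; case: (odd n); clear; lia.
  + move=> _; rewrite lE -/(heights p n.+3) -/(heights p n.+4) heights_level // heights_N.
    move=> h; left; split => //; exists n.+1; rewrite ?lE // /half.
    move: h; rewrite /btw /level; case: (odd n) => //= _; by rewrite addn1.
  + move=> E; rewrite E /btw /= => /orP[]/andP[h1 h2]; exfalso; move: h1 h2; clear; lra.
(* The horizontal side 1 is at the greatest height, so no vertical side passes strictly through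
   it. *)
- have hT : B 2 = top n + 1 by [].
  move=> _; rewrite hT => h; exfalso.
  have hl m : B m <= top n + 1.
    by have [->//|/(heights_le p)] := eqVneq m 2; move=> h1; move: h1; clear; lia.
  by have := hl j; have := hl j.+1; move: h; rewrite /btw; clear; lia.
have kn1 : (k <= n.+1)%N by move: iN; clear; lia.
(* The side at height [top]: only the vertical sides 1 and 2 pass through this height, and they are
   outside its range of abscissas. *)
case: (leqP k n) => [kn|nk]; last first.
  have -> : k = n.+1 by move: nk kn1; clear; lia.
  move=> ha; have hT : B n.+1.+2.+1 = top n by exact: heights_N.
  rewrite hT => hb; exfalso.
  have j12 : j = 1%N \/ j = 2.
    move: hb; have [->|j2] := eqVneq j 2; first by right.
    have [->|j1] := eqVneq j 1; first by left.
    have h1 := heights_le p j2; have /(heights_le p) h2 : j.+1 != 2 by move: j1; clear; lia.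
    by rewrite /btw; move: h1 h2; clear; lia.
  move: ha; rewrite (_ : A x y n.+1.+2 = y); last exact: abscissas_n.
  have -> : A x y n.+1.+3 = -1 by rewrite -(abscissas_N p x y) addn4.
  by case: j12 => -> /= /orP[]/andP[h1 h2]; move: h1 h2 x1 yn' nn; clear; lra.
rewrite (_ : B k.+2.+1 = level n (pos p) k); last exact: heights_level.
have Eend : -1 <= A x y k.+3 /\ A x y k.+3 <= y.
  have [[ln ->]|[[lE ->]|[lE _]]] := abscissasP p x y kn1.
  - by have [h1 h2] := pos_btw R p ln; split; move: h1 h2 yn'; clear; lra.
  - by split => //; move: yn' nn; clear; lra.
  - by move: kn; rewrite lE ltnn.
have Estart : [/\ x <= A x y k.+2, A x y k.+2 < y & k != 0%N -> -1 <= A x y k.+2].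
  case: (k) kn => [|m] mn; first by split => //=; move: x1 yn' nn; clear; lra.
  rewrite abscissas_lt //; have [h1 h2] := pos_btw R p mn.
  by split => [||_]; move: h1 h2 x1 yn'; clear; lra.
have [E1 E2] := Eend; have [E3 E4 E5] := Estart.
case: j jN => [|[|[|l]]] // jN ha hb.
- by exfalso; move: ha; rewrite (_ : A x y 1 = y + 1) // => /orP[]/andP[h1 h2]; move: h1 h2 E1 E2 E3 E4; clear; lra.
- by exfalso; move: ha; rewrite (_ : A x y 2 = x) // => /orP[]/andP[h1 h2]; move: h1 h2 E1 E2 E3 E4 x1; clear; lra.
have lN : (l <= n.+1)%N by move: jN; clear; lia.
have [[ln lE]|[[_ lE]|[lE E]]] := abscissasP p x y lN.
(* An edge against a vertical side through a letter: this is where [noncrossing] enters. *)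
- exfalso; rewrite lE in ha; have hk := abscissas_edge x1 yn kn ln ha.
  have := @edge_not_crossed n (pos p) k l.+1 NC kn ln hk.
  by rewrite /= -(heights_level p (ltnW ln)) -(heights_level p ln) hb.
- by exfalso; move: ha; rewrite lE => /orP[]/andP[h1 h2]; move: h1 h2 E1 E2 E3 E4 x1; clear; lra.
(* The last vertical side, at abscissa -1, can only meet edge 0, which starts further left at
   [x]. *)
right; rewrite lE addn4; split=> //; have [->//|/E5 h] := eqVneq k 0%N; exfalso.
by move: ha; rewrite E => /orP[]/andP[h1 h2]; move: h1 h2 E1 h; clear; lra.
Qed.

(** Consecutive levels have opposite signs. The case [k = n.+1] occurs for odd [n] only, and then
    level [n] is negative while the side ends at [top]. *)
Lemma crossing_letter (x y : R) k : (0 < n)%N -> x < -1 -> n.+1%:R <= y -> (0 < k < half n)%N ->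
  crossing (A x y) B 0 k.+2.
Proof.
move=> n0 x1 yn; case: k => // k /andP[_ kh]; have nn : 0 <= n%:R :> R by [].
have kn : (k <= n)%N by have := leq_half kh; clear; lia.
have yn' := yn; rewrite -natr1 in yn'.
rewrite /crossing; have B1 : B 1 = 0 by []. 
rewrite B1 -/(k.+3) -/(k.+4) heights_level //.
have [[ln lE]|[[kE lE]|[kE _]]] := abscissasP p x y (leqW kn).
- have [h1 h2] := pos_btw R p ln; rewrite lE heights_level // level_opposite // andbT.
  by apply/orP; left => /=; move: h1 h2 yn'; clear; lra.
- rewrite lE; apply/andP; split; first by apply/orP; left => /=; move: yn' nn; clear; lra.
  have -> : B k.+4 = top n by rewrite kE heights_N.
  have /andP[h1 _] := depth_itv p kn; have t0 : (0 < top n)%N by [].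
  have od : odd k by move: kh; rewrite kE /half; case: (odd n) => //=; clear; lia.
  by rewrite /btw /level od; move: h1 t0; clear; lia.
- by move: kn; rewrite kE ltnn.
Qed.

Lemma crossing_first (x y : R) : (0 < n)%N -> x < -1 -> n.+1%:R <= y -> crossing (A x y) B 2 (n + 4).
Proof.
move=> n0 x1 yn; rewrite /crossing abscissas_N addn4 heights_N heights_N1; apply/andP; split.
  have [h1 _] := pos_btw R p n0; rewrite (@abscissas_lt R n p x y 0) //.
  by apply/orP; left => /=; move: h1 x1; clear; lra.
rewrite heights_level //; have /andP[h1 h2] := depth_itv p (leq0n n).
by rewrite /btw /level /=; move: h1 h2; clear; lia.
Qed.

End PermutationCrossings.

(** * Recognising the diagram of a curve from the times of its double points *)

Section Realization.
Variable R : realType.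

Lemma routeX_le N (a : nat -> R) b rho i s t : route N a b rho -> (i < N)%N -> a i < a i.+1 ->
  horiz rho i s -> horiz rho i t -> s <= t -> routeX N a rho s <= routeX N a rho t.
Proof.
move=> H iN ai hs ht st; have /andP[r0 _] := route_rho H.
rewrite !(routeXE H iN) ?(horiz_wide H) // lerD2l ler_wpM2l ?subr_ge0 ?(ltW ai) // step_le //.
by rewrite ler_pM2r ?invr_gt0 ?mulr_gt0 // !lerD2r.
Qed.

Lemma circle_diffeo_int h (x : R) (k : int) : circle_diffeo h -> h (x + k%:~R) = h x + k%:~R.
Proof.
move=> [_ h1 _]; have := @periodic_int R R (fun t => h t - t) _ k x.
have p1 (t : R) : h (t + 1) - (t + 1) = h t - t by rewrite h1; ring.
by move=> /(_ p1); clear; lra.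
Qed.

Lemma circle_diffeo_circle_eq h (x y : R) : circle_diffeo h -> circle_eq (h x) (h y) <-> circle_eq x y.
Proof.
move=> hd; have inc := circle_diffeo_incr hd; split=> -[k E]; exists k.
  have {E} E : h x = h (y + k%:~R) by rewrite circle_diffeo_int // -E addrC subrK.
  have -> : x = y + k%:~R by case: (ltgtP x (y + k%:~R)) => // /inc; rewrite E ltxx.
  by rewrite addrAC subrr add0r.
by rewrite -(subrK y x) E [k%:~R + y]addrC circle_diffeo_int // addrAC subrr add0r.
Qed.

Lemma circle_eq_refl (x : R) : circle_eq x x.
Proof. by exists 0; rewrite subrr. Qed.

Lemma circle_eq_trans (x y z : R) : circle_eq x y -> circle_eq y z -> circle_eq x z.
Proof. by move=> [k Ek] [l El]; exists (k + l); rewrite intrD -Ek -El; ring. Qed.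

Lemma half_gt1 n : (0 < n)%N -> (1 < half n)%N.
Proof. by rewrite /half; clear; lia. Qed.

(** A circle diffeomorphism brings the equally spaced letters to the times [sg i], after which the
    two diagrams have the same chords. *)
Lemma realizable_of_points n (p : 'S_n) (g : R -> R * R) (sg : nat -> R) (m := half n) : (0 < n)%N ->
  generic_curve g -> (forall i, (i < m.*2)%N -> sg i < sg i.+1) -> sg m.*2 = sg 0%N + 1 ->
  (forall k, (k < m)%N -> g (sg (pos p k)) = g (sg (m + k)%N)) ->
  (forall s t, ~ circle_eq s t -> g s = g t -> exists2 k, (k < m)%N &
     circle_eq s (sg (pos p k)) /\ circle_eq t (sg (m + k)%N) \/
     circle_eq t (sg (pos p k)) /\ circle_eq s (sg (m + k)%N)) ->
  realizable (perm_diagram R p).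
Proof.
move=> n0 gg sS sM K1 K2; exists g => //.
have m20 : (0 < m.*2)%N by have := half_gt1 n0; rewrite -/m; clear; lia.
have [h hd hE] := circle_diffeo_through m20 sS sM; exists h => // s t.
have [[gp _] _ _ _ _] := gg.
have geq x y : circle_eq x y -> g x = g y.
  by move=> [k E]; rewrite -(subrK y x) E [k%:~R + y]addrC (periodic_int gp).
have posm k : (k < m)%N -> (pos p k < m.*2)%N.
  by move=> km; have := pos_lt_half p km; rewrite -/m; clear; lia.
have mkm k : (k < m)%N -> (m + k < m.*2)%N by clear; lia.
have sz : size (perm_word p) = m.*2 by exact: size_perm_word.
have slt i j : (i < j)%N -> (j <= m.*2)%N -> sg i < sg j.
  move=> ij jM; apply: (@incr_lt R m.*2.-1) => //.
have snc i j : (i < m.*2)%N -> (j < m.*2)%N -> i != j -> ~ circle_eq (sg i) (sg j).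
  wlog ij : i j / (i < j)%N => [W|] iM jM ne.
    case: (ltngtP i j) ne => // ij _; first by apply: W => //; rewrite ltn_eqF.
    by move=> /circle_eqC; apply: W => //; rewrite ltn_eqF.
  have h1 := slt _ _ ij (ltnW jM).
  have h2 : sg j < sg 0%N + 1 by rewrite -sM slt.
  have h3 : sg 0%N <= sg i by case: (i) iM => // i' iM; apply/ltW/slt => //; exact: ltnW.
  move=> /circle_eq_near E; have : sg i = sg j.
    by apply: E; rewrite ltr_norml; move: h1 h2 h3; clear; lra.
  by move: h1 => /[swap] ->; rewrite ltxx.
split.
  move=> [[i iz] [[j jz] []]].
  change (i != j -> nth 0%N (perm_word p) i = nth 0%N (perm_word p) j ->
    circle_eq s (i%:R / (size (perm_word p))%:R) -> circle_eq t (j%:R / (size (perm_word p))%:R) ->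
    curve_diagram g (h s) (h t)) => ij E si tj.
  have iM : (i < m.*2)%N by rewrite -sz.
  have jM : (j < m.*2)%N by rewrite -sz.
  rewrite sz in si tj.
  have {si} si : circle_eq (h s) (sg i) by rewrite -(hE _ iM); exact/circle_diffeo_circle_eq.
  have {tj} tj : circle_eq (h t) (sg j) by rewrite -(hE _ jM); exact/circle_diffeo_circle_eq.
  split.
    move=> st; apply: (snc _ _ iM jM ij); apply: circle_eq_trans (circle_eqC si) _.
    exact: circle_eq_trans tj.
  rewrite (geq _ _ si) (geq _ _ tj).
  move/eqP: E => /(perm_word_eq p iM jM ij)[k km [[-> ->]|[-> ->]]]; first exact: K1.
  by rewrite K1.
have fin i j : (i < m.*2)%N -> (j < m.*2)%N -> i != j ->
    nth 0%N (perm_word p) i == nth 0%N (perm_word p) j ->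
    circle_eq (h s) (sg i) -> circle_eq (h t) (sg j) -> perm_diagram R p s t.
  move=> iM jM ij E si tj.
  have iz : (i < size (perm_word p))%N by rewrite sz.
  have jz : (j < size (perm_word p))%N by rewrite sz.
  have si' : circle_eq s (i%:R / (size (perm_word p))%:R).
    by apply/(circle_diffeo_circle_eq _ _ hd); rewrite sz hE.
  have tj' : circle_eq t (j%:R / (size (perm_word p))%:R).
    by apply/(circle_diffeo_circle_eq _ _ hd); rewrite sz hE.
  by exists (Ordinal iz), (Ordinal jz); split => //; exact/eqP.
move=> [nst gst]; have [k km kk] := K2 _ _ nst gst.
have ne : pos p k != (m + k)%N.
  by have := pos_lt_half p km; rewrite -/m; clear; lia.
case: kk => -[h1 h2].
  apply: (fin (pos p k) (m + k)%N) => //; [exact: posm|exact: mkm|].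
  by apply/(perm_word_eq p (posm _ km) (mkm _ km) ne); exists k => //; left.
rewrite eq_sym in ne; apply: (fin (m + k)%N (pos p k)) => //; [exact: mkm|exact: posm|].
by apply/(perm_word_eq p (mkm _ km) (posm _ km) ne); exists k => //; right.
Qed.

End Realization.

(** * Noncrossing permutations are realizable *)

Section RealizationOfNoncrossing.
Variable R : realType.

Lemma noncrossing_realizable n (p : 'S_n) : (0 < n)%N -> noncrossing n (pos p) ->
  realizable (perm_diagram R p).
Proof.
move=> n0 NC; have x1 : - 2 < - 1 :> R by rewrite ltrN2 ltr1n.
have [rho H] := perm_route_exists p x1 (lexx n.+1%:R).
set A := abscissas p (- 2) n.+1%:R in H *; set B := heights p in H *.
set X := routeX (n + 4) A rho; set Y := @routeY R (n + 4) B.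
set N := (n + 4)%N in H X Y *; set m := half n.
have /andP[r0 r1] := route_rho H; have N0 : (0 < N)%N := route_gt0 H.
have N0r : 0 < N%:R :> R by rewrite ltr0n.
have NN : (0 < N <= N)%N by rewrite N0 leqnn.
have m1 : (1 < m)%N by exact: half_gt1.
have mn : (m <= n.+2)%N by rewrite /m /half; case: (odd n); clear; lia.
have N2 : (2 < N)%N by rewrite /N; move: n0; clear; lia.
have kN k : (0 < k < m)%N -> (0 < k.+2 <= N)%N by move: mn; rewrite /N; clear; lia.
have posI k : (0 < k < m)%N -> (0 < pos p k < m)%N.
  move=> /andP[k0 km]; rewrite pos_lt_half // andbT lt0n; apply/eqP => E.
  have := @pos_inj n p k 0 (leq_half km) isT; rewrite E => /(_ erefl) k0'.
  by rewrite k0' in k0.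
have AE k : (0 < k < m)%N -> A k.+2 = (pos p k)%:R.
  case: k => // k /andP[_ km]; have kn : (k <= n.+1)%N by exact: ltnW (leq_half km).
  have [[kn' E]|[[kE E]|[kE _]]] := abscissasP p (- 2 : R) n.+1%:R kn; rewrite /A ?E //.
    by rewrite kE pos_n.
  by exfalso; have := leq_half km; rewrite kE ltnn.
have Hu k : exists s, (0 < k < m)%N -> horiz rho 0 s /\ X s = k%:R.
  have [/andP[k0 km]|_] := boolP (0 < k < m)%N; last by exists 0.
  have [|s hs sE] := @horiz_reach R N A B rho 0 k%:R H N0; last by exists s.
  have k1 : 1 <= k%:R :> R by rewrite ler1n.
  have k2 : k%:R <= n.+1%:R :> R by rewrite ler_nat; move: km mn; clear; lia.
  by apply/orP; left; rewrite /A /=; move: k1 k2; clear; lra.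
have [u {Hu} Hu] := boolp.choice Hu.
have Ht k : exists t, (0 < k < m)%N -> vert rho k.+2 t /\ Y (u (pos p k)) = Y t.
  have [km|_] := boolP (0 < k < m)%N; last by exists 0.
  have [s [t [hs vt EX EY]]] := crossing_reached H N0 (kN k km) (crossing_letter p n0 x1 (lexx _) km).
  exists t => _; split=> //; have [hu uE] := Hu _ (posI k km).
  suff -> : u (pos p k) = s by [].
  apply: (routeX_inj H N0 hu hs); rewrite EX (routeX_vert (t := t) H (kN k km)) -/X ?uE ?AE //.
  by move: vt; rewrite /vert; clear; lra.
have [tt {Ht} Ht] := boolp.choice Ht.
have [s0 [t0 [hs0 vt0 EX0 EY0]]] := crossing_reached H N2 NN (crossing_first p n0 x1 (lexx _)).
(* Times of the letters along the route. First half: the letter 0 on the last vertical side, one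
   period early, then the points of abscissa [k] on the line. Second half: the letter 0 on edge 0,
   then the crossings of the successive vertical sides with the line; [t0] closes the period. *)
pose sigma i : R := if i == 0%N then t0 - N%:R else if (i < m)%N then u i else
  if i == m then s0 else if (i < m.*2)%N then tt (i - m)%N else t0.
have sig0 : sigma 0%N = t0 - N%:R by [].
have sigu i : (0 < i < m)%N -> sigma i = u i.
  by rewrite /sigma => /andP[i0 im]; rewrite gtn_eqF // im.
have sigm : sigma m = s0 by rewrite /sigma gtn_eqF ?ltnn ?eqxx // ltnW.
have sigt k : (0 < k < m)%N -> sigma (m + k)%N = tt k.
  move=> /andP[k0 km]; rewrite /sigma; do 2 (rewrite ifF; last by move: k0; clear; lia).
  by rewrite ifT ?addKn //; move: km; clear; lia.
have sigM : sigma m.*2 = t0 by rewrite /sigma !ifF //; move: m1; clear; lia.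
have uI i : (0 < i < m)%N -> 1 / 2 - rho <= u i <= 1 / 2 + rho.
  by move=> /Hu[]; rewrite /horiz; clear; lra.
have tI k : (0 < k < m)%N -> k%:R + 3 / 2 + rho < tt k < k%:R + 5 / 2 - rho.
  by move=> /Ht[]; rewrite /vert -(addn2 k) natrD; clear; lra.
have s0I : 5 / 2 - rho <= s0 <= 5 / 2 + rho by move: hs0; rewrite /horiz; clear; lra.
have t0I : N%:R - 1 / 2 + rho < t0 < N%:R + 1 / 2 - rho by exact: vt0.
have mN : m%:R + 2 <= N%:R :> R by rewrite -natrD ler_nat /N; move: mn; clear; lia.
have sigS i : (i < m.*2)%N -> sigma i < sigma i.+1.
  move=> iM; have [i0|i0] := posnP i.
    have h1 : (0 < 1 < m)%N by rewrite m1.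
    by rewrite i0 sig0 sigu //; have := uI _ h1; move: t0I; clear; lra.
  have [im|mi] := ltnP i m.
    have im0 : (0 < i < m)%N by rewrite i0.
    rewrite (sigu i im0); have [im'|mi'] := ltnP i.+1 m; last first.
      have -> : i.+1 = m by apply/eqP; rewrite eqn_leq im.
      by rewrite sigm; have := uI _ im0; move: s0I r1; clear; lra.
    have h1 : (0 < i.+1 < m)%N by [].
    have [hi Xi] := Hu _ im0; have [hi' Xi'] := Hu _ h1.
    rewrite (sigu _ h1) ltNge; apply/negP => le.
    have A01 : A 0 < A 1 by rewrite /A /=; have : 0 <= n.+1%:R :> R by []; clear; lra.
    have := routeX_le H N0 A01 hi' hi le; rewrite -/X Xi Xi' ler_nat ltnn //.
  have iE : i = (m + (i - m))%N by rewrite subnKC.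
  move: (i - m)%N iE iM {i0 mi} => k -> iM; have km : (k < m)%N by move: iM; clear; lia.
  rewrite -addnS; have [k0|k0] := posnP k.
    have h1 : (0 < 1 < m)%N by rewrite m1.
    rewrite k0 addn0 sigm sigt //; have := tI _ h1; move: s0I r1; clear; lra.
  have h1 : (0 < k < m)%N by rewrite k0.
  rewrite (sigt k h1); have [km'|mk] := ltnP k.+1 m.
    have h2 : (0 < k.+1 < m)%N by [].
    rewrite (sigt k.+1 h2); have := tI _ h1; have := tI _ h2; rewrite -natr1; move: r0; clear; lra.
  have kE : k.+1 = m by apply/eqP; rewrite eqn_leq mk andbT.
  have kEr : k%:R + 1 = m%:R :> R by rewrite natr1 kE.
  rewrite kE addnn sigM; have := tI _ h1; move: t0I mN kEr r0; clear; lra.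
pose sg i := sigma i / N%:R.
have Nsg i : N%:R * sg i = sigma i by rewrite /sg mulrC divfK ?gt_eqF.
have Nsg_eq x i : N%:R * x = sigma i -> x = sg i.
  by move=> E; apply: (mulfI (lt0r_neq0 N0r)); rewrite Nsg.
apply: (@realizable_of_points R n p (closed_route N A B rho) sg n0).
- exact: closed_route_generic H.
- by move=> i iM; rewrite ltr_pM2r ?invr_gt0 // sigS.
- by rewrite /sg sigM sig0; field; rewrite gt_eqF.
- move=> k km; rewrite !closed_routeE !Nsg -/X -/Y; have [->|k0] := posnP k.
    rewrite addn0 sigm sig0 /X /Y -(routeX_period (t0 - N%:R) H) -(routeY_period (t0 - N%:R) H) subrK.
    by rewrite EX0 EY0.
  have h1 : (0 < k < m)%N by rewrite k0.
  have [vt EY] := Ht _ h1; have [hu EX] := Hu _ (posI _ h1).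
  rewrite (sigt k h1) (sigu _ (posI _ h1)) EY EX /X (routeX_vert H (kN k h1)) ?AE //.
  by move: vt; rewrite /vert; clear; lra.
have key i j (s' t' : R) : (i < N)%N -> (0 < j <= N)%N -> crossing A B i j ->
    horiz rho i (N%:R * s') -> vert rho j (N%:R * t') -> X (N%:R * s') = X (N%:R * t') ->
    Y (N%:R * s') = Y (N%:R * t') -> exists2 k, (k < m)%N &
     circle_eq s' (sg (pos p k)) /\ circle_eq t' (sg (m + k)%N) \/
     circle_eq t' (sg (pos p k)) /\ circle_eq s' (sg (m + k)%N).
  move=> iN jN cr hs vt EX EY; have XA : X (N%:R * t') = A j.
    by apply: (routeX_vert H jN); move: vt; rewrite /vert; clear; lra.
  have [[iE [k kI jE]]|[iE jE]] := crossing_cases n0 NC x1 (lexx _) iN jN cr; subst i j.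
    exists k; [by case/andP: kI|left]; have [hu uE] := Hu _ (posI k kI); have [vt' EY'] := Ht _ kI.
    have sE : N%:R * s' = u (pos p k).
      by apply: (routeX_inj H N0 hs hu); rewrite -/X uE EX XA AE.
    have tE : N%:R * t' = tt k.
      have /andP[_ jN'] := jN; apply: (routeY_inj H jN' (vert_phase H vt) (vert_phase H vt')).
      by rewrite -/Y -EY' -sE EY.
    rewrite (Nsg_eq s' (pos p k)) ?(sigu _ (posI _ kI)) // (Nsg_eq t' (m + k)%N) ?(sigt _ kI) //.
    by split; exact: circle_eq_refl.
  exists 0%N; [exact: ltnW|right]; have sE : N%:R * s' = s0.
    apply: (routeX_inj H N2 hs hs0); rewrite EX0 (routeX_vert (t := t0) H NN) -/X ?EX ?XA //.
    by move: vt0; rewrite /vert; clear; lra.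
  have tE : N%:R * t' = t0.
    apply: (routeY_inj H (leqnn N) (vert_phase H vt) (vert_phase H vt0)).
    by rewrite -EY0 -sE -/Y EY.
  rewrite addn0 (Nsg_eq s' m) ?sigm //; split; last exact: circle_eq_refl.
  exists 1; rewrite /sg sig0 -tE; field; rewrite gt_eqF //.
move=> s t nst; have [k sD] := in_period_rep s H; have [l tD] := in_period_rep t H.
have gp := periodic_int (fun t => closed_route_period t H).
rewrite -(gp k s) -(gp l t) => /closed_routeP[EX EY].
have st : N%:R * (s + k%:~R) != N%:R * (t + l%:~R).
  by apply/eqP => /(mulfI (lt0r_neq0 N0r)) /circle_eq_shift.
have sh x (z : int) y : circle_eq (x + z%:~R) y -> circle_eq x y.
  by move=> [w E]; exists (w - z); rewrite intrB -E; ring.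
have [i [j [iN jN cr [[hs vt]|[ht vs]]]]] := route_double H sD tD st EX EY.
  have [q qm [[h1 h2]|[h1 h2]]] := key i j _ _ iN jN cr hs vt EX EY; exists q => //; [left|right];
    by split; [exact: sh h1|exact: sh h2].
have [q qm [[h1 h2]|[h1 h2]]] := key i j _ _ iN jN cr ht vs (esym EX) (esym EY);
  exists q => //; [right|left]; by split; [exact: sh h1|exact: sh h2].
Qed.

End RealizationOfNoncrossing.

(** * A meander whose line is a diameter *)

Section MeanderOfCurve.
Variable R : realType.

Lemma Cn_id k : Cn k (id : R -> R).
Proof.
elim: k => [|k IH]; first by move=> j; rewrite leqn0 => /eqP-> x; exact: derivable_id.
by apply: (@Cn_is_derive R _ k id (fun=> 1)); exact: Cn_cst.
Qed.

(** It is a graph over the interval of ordinates from -1 to 1. *)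
Lemma right_half_circle_connected : connected [set q : R * R | unit_circle R q /\ 0 < q.1].
Proof.
have -> : [set q : R * R | unit_circle R q /\ 0 < q.1] =
    (fun y : R => (Num.sqrt (1 - y ^+ 2), y)) @` `](-1), 1[.
  apply/seteqP; split=> [[u v] [/= E u0]|q [y /= yI <-]].
    have E' : u ^+ 2 = 1 - v ^+ 2 by rewrite -E addrK.
    exists v; last by rewrite -E' sqrtr_sqr gtr0_norm.
    have u20 : 0 < u ^+ 2 by rewrite exprn_gt0.
    by rewrite /= in_itv /=; apply/andP; move: u20; rewrite E'; clear; nra.
  move: yI; rewrite in_itv /= => /andP[y1 y2].
  have y0 : 0 < 1 - y ^+ 2 by move: y1 y2; clear; nra.
  split=> /=; last by rewrite sqrtr_gt0.
  by rewrite /unit_circle /= sqr_sqrtr ?subrK // ltW.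
apply: connected_continuous_connected.
  by apply/connected_intervalP; exact: interval_is_interval.
apply: continuous_subspaceT => y; apply: (@cvg_pair _ _ _ _ (nbhs (Num.sqrt (1 - y ^+ 2))) (nbhs y)).
  apply: (@continuous_comp _ _ _ (fun y : R => 1 - y ^+ 2) (@Num.sqrt R)); last exact: sqrt_continuous.
  apply: (@cvgB _ R R); first exact: cvg_cst.
  by apply: (@cvgM R R); exact: cvg_id.
exact: cvg_id.
Qed.

Definition diameter (t : R) : R * R := (2 * t - 1, 0).

Lemma smooth_diameter : smooth diameter.
Proof.
apply/smooth_Cn => k; apply: (@Cn_pair R k (fun t => 2 * t + - 1) (fun=> 0)); last exact: Cn_cst.
exact: (@Cn_affine R k id 2 (- 1) (@Cn_id k)).
Qed.

Lemma derive1_diameter (t : R) : derive1 diameter t = (2, 0).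
Proof.
have D := (is_derive_pair diameter t (2, 0)).2
  (conj (is_derive_affine 2 (- 1) t) (is_derive_cst (0 : R) t (1 : R))).
by case: D => _ E; rewrite derive1E; exact: E.
Qed.

Lemma diameter_embedding : proper_embedding diameter.
Proof.
split.
- exact: smooth_diameter.
- by move=> t _; rewrite derive1_diameter; apply/eqP => -[/eqP]; rewrite pnatr_eq0.
- by move=> s t _ _ []; clear; lra.
- by move=> t t01; rewrite /unit_disk /diameter /=; move: t01; clear; nra.
move=> t t01; rewrite /unit_circle /diameter /=; split.
  have -> : (2 * t - 1) ^+ 2 + 0 ^+ 2 = 1 - 4 * (t * (1 - t)) :> R by ring.
  move=> E; have /eqP : t * (1 - t) = 0 by move: E; clear; lra.
  by rewrite mulf_eq0 subr_eq0 => /orP[/eqP|/eqP]; [left|right].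
by case=> ->; ring.
Qed.

(** The line is the horizontal diameter, with the point labelled [i] at abscissa [i.+1%:R / r]. The
    open right half circle contains [mu 1] and [(1, 0)] and avoids [mu 0] and [(-1, 0)], which gives
    the condition on the boundary. *)
Lemma meandric_of_curve n (p : 'S_n) (mu : R -> R * R) (r : R) (z : 'I_n -> R) :
  proper_embedding mu -> (mu 0).1 < 0 -> (mu 0).2 != 0 -> 0 < (mu 1).1 -> (mu 1).2 != 0 ->
  n%:R <= r -> (forall k, 0 <= z k <= 1) -> (forall i j : 'I_n, (i < j)%N -> z i < z j) ->
  (forall k, mu (z k) = ((p k).+1%:R / r, 0)) -> (forall k, (derive1 mu (z k)).2 != 0) ->
  (forall s, 0 <= s <= 1 -> (mu s).2 = 0 -> exists k, s = z k) -> meandric R p.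
Proof.
move=> emu m0x m0y m1x m1y nr z01 zlt zE dz zU.
pose x (i : 'I_n) : R * R := (i.+1%:R / r, 0).
have r0 (i : 'I_n) : 0 < r by apply: lt_le_trans nr; rewrite ltr0n (leq_trans _ (ltn_ord i)).
have xI (i : 'I_n) : 0 < i.+1%:R / r <= 1.
  rewrite divr_gt0 ?(r0 i) ?ltr0n //= ler_pdivrMr ?(r0 i) // mul1r.
  by apply: le_trans nr; rewrite ler_nat.
pose tx (i : 'I_n) : R := (i.+1%:R / r + 1) / 2.
have tx01 i : 0 <= tx i <= 1.
  by rewrite /tx; move: (xI i); move: (_ / r); clear => w; lra.
have txE i : diameter (tx i) = x i.
  by rewrite /diameter /tx /x; congr (_, _); field; rewrite gt_eqF // (r0 i).
have meetE : arcs_meet mu diameter = range x.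
  apply/seteqP; split=> [q [[s /= s01 sq] [t /= t01 tq]]|q [i _ <-]].
    rewrite in_itv /= in s01.
    have [k sk] : exists k, s = z k by apply: zU => //; rewrite sq -tq.
    by exists (p k) => //; rewrite -sq sk zE.
  split; last by exists (tx i); [rewrite /= in_itv; exact: tx01|exact: txE].
  exists (z ((p^-1)%g i)); first by rewrite /= in_itv; exact: z01.
  by rewrite zE permKV.
have [smu dmu imu dkmu cmu] := emu.
have e00 : 0 <= (0 : R) <= 1 by rewrite lexx ler01.
have e11 : 0 <= (1 : R) <= 1 by rewrite lexx ler01.
have cm0 : unit_circle R (mu 0) by apply/cmu => //; left.
have cm1 : unit_circle R (mu 1) by apply/cmu => //; right.
have cp1 : unit_circle R (1, 0) by rewrite /unit_circle /=; ring.
have cp0 : unit_circle R (- 1, 0) by rewrite /unit_circle /=; ring.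
have bnd : [/\ unit_circle R (mu 0), unit_circle R (mu 1), unit_circle R (- 1, 0) & unit_circle R (1, 0)].
  by split.
have dst : uniq [:: mu 0; mu 1; (- 1, 0); (1, 0)].
  rewrite /= !inE !negb_or !andbT; apply/and3P; split; last first.
  - by apply/eqP => -[]; clear; lra.
  - by apply/andP; split; apply: contraNneq m1y => ->.
  apply/and3P; split.
  - by apply: contraTneq m0x => ->; rewrite -leNgt ltW.
  - by apply: contraNneq m0y => ->.
  - by apply: contraNneq m0y => ->.
have cmp : exists2 x, (unit_circle R `\` [set mu 0; (- 1, 0)]) x &
    let C := connected_component (unit_circle R `\` [set mu 0; (- 1, 0)]) x in C (mu 1) /\ C (1, 0).
  have sub : [set q : R * R | unit_circle R q /\ 0 < q.1] `<=` unit_circle R `\` [set mu 0; (- 1, 0)].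
    move=> q [cq q0]; split => // -[] qE; move: q0; rewrite qE.
      by rewrite ltNge ltW.
    by rewrite /= ltNge lerN10.
  have h1 : [set q : R * R | unit_circle R q /\ 0 < q.1] (1, 0) by split => //=; exact: ltr01.
  exists (1, 0); first exact: sub.
  have C := connected_component_max h1 sub right_half_circle_connected.
  by split; apply: C.
have tr s t : 0 <= s <= 1 -> 0 <= t <= 1 -> mu s = diameter t -> transverse (derive1 mu s) (derive1 diameter t).
  move=> s01 t01 E; have [k ->] : exists k, s = z k by apply: zU => //; rewrite E.
  apply: det_transverse; rewrite derive1_diameter /det /= mulr0 sub0r oppr_eq0.
  by apply: mulf_neq0; [exact: dz|rewrite pnatr_eq0].
have ord : (arcs_meet mu diameter #= `I_n)%card.
  pose f (k : nat) : R * R := (k.+1%:R / r, 0).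
  have -> : arcs_meet mu diameter = f @` `I_n.
    rewrite meetE; apply/seteqP; split=> q [i]; first by move=> _ <-; exists i => //=.
    by move=> iI <-; exists (Ordinal (iI : (i < n)%N)).
  apply: inj_card_eq => i j; rewrite !inE /= => iI _ [] E.
  have : (i.+1%:R : R) = j.+1%:R by apply: (mulIf _ E); rewrite invr_eq0 gt_eqF // (r0 (Ordinal iI)).
  by move/eqP; rewrite eqr_nat => /eqP [].
have d0 : diameter 0 = (- 1, 0) by rewrite /diameter; congr (_, _); ring.
have d1 : diameter 1 = (1, 0) by rewrite /diameter; congr (_, _); ring.
exists (Meander bnd dst cmp emu diameter_embedding (conj erefl erefl) (conj d0 d1) tr ord).
exists x, (fun k => x (p k)); split => //=.
  split; first by rewrite meetE.
  exists tx; split=> // i j ij; rewrite /tx ltr_pM2r ?invr_gt0 // ltrD2r.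
  by rewrite ltr_pM2r ?invr_gt0 ?(r0 i) // ltr_nat ltnS.
split.
  rewrite meetE; apply/seteqP; split=> q [i _ <-]; first by exists (p i).
  by exists ((p^-1)%g i) => //; rewrite /= permKV.
by exists z; split.
Qed.

End MeanderOfCurve.

(** * Noncrossing permutations are meandric *)

Section MeanderOfNoncrossing.
Variable R : realType.

(** By symmetry of [step]. At mid-time a horizontal side is then at the middle of its abscissas,
    which lets the ends of the arc be placed exactly. *)
Lemma step_half : step (1 / 2) = 1 / 2 :> R.
Proof.
rewrite /step (_ : 1 - 1 / 2 = 1 / 2); last by field.
have h : 0 < flat 0 (1 / 2) :> R by rewrite flat_gt0 // divr_gt0.
by field; rewrite gt_eqF // addr_gt0.
Qed.

Lemma convex_le (c u v w : R) : u <= c -> v <= c -> 0 <= w <= 1 -> u + (v - u) * w <= c.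
Proof.
move=> uc vc /andP[w0 w1].
have h1 : 0 <= (c - u) * (1 - w) by rewrite mulr_ge0 // subr_ge0.
have h2 : 0 <= (c - v) * w by rewrite mulr_ge0 // subr_ge0.
by move: h1 h2; clear; lra.
Qed.

Lemma convex_ge (c u v w : R) : c <= u -> c <= v -> 0 <= w <= 1 -> c <= u + (v - u) * w.
Proof.
move=> uc vc w01; have := @convex_le (- c) (- u) (- v) w; rewrite !lerN2 => /(_ uc vc w01).
by clear; lra.
Qed.

Lemma sqr_lt_norm (x w : R) : - w < x -> x < w -> x ^+ 2 < w ^+ 2.
Proof.
move=> h1 h2; have : 0 < (w - x) * (w + x).
  by rewrite mulr_gt0 ?subr_gt0 // -ltrBlDl sub0r.
by clear; lra.
Qed.

(** Moving from [u] towards the opposite side, [y] decreases in absolute value as long as it keeps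
    the sign of [u], which its closeness to [u] ensures. *)
Lemma near_end_sqr (u u' v y : R) : 1 <= u \/ u <= -1 -> u' * u <= 0 -> 0 <= v <= 1 ->
  y = u + (u' - u) * v -> `|y - u| < 1 / 2 -> y ^+ 2 <= u ^+ 2.
Proof.
move=> [u1|u1] uu v01 E; rewrite ltr_norml => /andP[y1 y2].
  have u'u : u' <= u by rewrite leNgt; apply/negP => lt; have := mulr_gt0 (lt_trans (lt_le_trans ltr01 u1) lt) (lt_le_trans ltr01 u1); rewrite ltNge uu.
  have yu : y <= u by rewrite E convex_le.
  have : 0 <= (u - y) * (u + y) by rewrite mulr_ge0 ?subr_ge0 //; move: u1 y1; clear; lra.
  by clear; lra.
have u0 : u < 0 by move: u1; clear; lra.
have u'u : u <= u' by rewrite leNgt; apply/negP => lt; have := mulr_gt0 (_ : 0 < - u') (_ : 0 < - u);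
  rewrite !oppr_gt0 mulrNN => /(_ (lt_trans lt u0) u0); rewrite ltNge uu.
have yu : u <= y by rewrite E convex_ge.
have : 0 <= (y - u) * (- u - y) by rewrite mulr_ge0 ?subr_ge0 //; move: u1 y2; clear; lra.
by clear; lra.
Qed.

(** The arc of the route between the times 5/2 and n + 5/2, the midpoints of the horizontal sides
    that carry the edges 0 and [n], crosses the line at the letters only. It is inscribed in a
    circle of radius [R0] and rescaled. *)
Lemma noncrossing_meandric n (p : 'S_n) : (0 < n)%N -> noncrossing n (pos p) -> meandric R p.
Proof.
move=> n0 NC; have n1 : 1 <= n%:R :> R by rewrite ler1n.
have n0r : 0 < n%:R :> R by rewrite ltr0n.
pose T : R := (top n)%:R; have T0 : 0 <= T by [].
pose h k : R := (level n (pos p) k)%:~R.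
have hT k : (k <= n)%N -> - T < h k < T.
  move=> kn; have [l1 l2 _] := level_itv p kn.
  by rewrite /h /T !pmulrn -mulrNz !ltr_int l1 l2.
have h1 k : (k <= n)%N -> 1 <= h k \/ h k <= -1.
  move=> kn; have [_ _ l0] := level_itv p kn.
  rewrite /h; move: (level n (pos p) k) l0 => z z0.
  have [z1|z1] : 1 <= z \/ z <= -1 by move: z0; clear; lia.
    by left; move: z1; rewrite -(ler_int R).
  by right; move: z1; rewrite -(ler_int R) mulrN1z.
(* Large enough for the disk to contain the box of heights up to [T] and abscissas up to [n.+1];
   [w k] is the abscissa of the circle at height [h k]. *)
pose R0 := T + n.+1%:R.
have R00 : 0 < R0 by rewrite ltr_wpDl ?ltr0n.
pose w k := Num.sqrt (R0 ^+ 2 - h k ^+ 2).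
have wE k : (k <= n)%N -> w k ^+ 2 + h k ^+ 2 = R0 ^+ 2 /\ n.+1%:R <= w k.
  move=> kn; have hk := sqr_lt_norm (proj1 (andP (hT k kn))) (proj2 (andP (hT k kn))).
  have e : n.+1%:R ^+ 2 + T ^+ 2 <= R0 ^+ 2.
    have := mulr_ge0 T0 (ler0n R n.+1); rewrite /R0; clear; lra.
  have w2 : w k ^+ 2 = R0 ^+ 2 - h k ^+ 2.
    rewrite sqr_sqrtr //; have := sqr_ge0 (n.+1%:R : R); move: hk e; clear; lra.
  split; first by rewrite w2 subrK.
  rewrite -(@ler_sqr R) ?nnegrE ?sqrtr_ge0 ?ler0n // w2; move: hk e; clear; lra.
have [w0E w0n] := wE 0%N isT; have [w1E w1n] := wE n (leqnn n).
rewrite -natr1 in w0n w1n.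
have pn : (0 < pos p n <= n)%N by apply: pos_itv; rewrite n0 leqnn.
have pn1 : 1 <= (pos p n)%:R :> R by rewrite ler1n; case/andP: pn.
have pnn : (pos p n)%:R <= n%:R :> R by rewrite ler_nat; case/andP: pn.
have [p11 p1n] := pos_btw R p n0.
(* Chosen so that the midpoints of the first and last edges have abscissas [- w 0] and [w n], hence
   lie on the circle. *)
pose x := - 2 * w 0%N - (pos p 1)%:R; pose y := 2 * w n - (pos p n)%:R.
have x1 : x < -1 by rewrite /x; move: w0n p11 n1; clear; lra.
have yn : n.+1%:R <= y by rewrite -natr1 /y; move: w1n pnn; clear; lra.
have [rho H] := perm_route_exists p x1 yn.
set A := abscissas p x y in H *; set B := heights p in H *.
set X := routeX (n + 4) A rho; set Y := @routeY R (n + 4) B.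
set N := (n + 4)%N in H X Y *.
have NE : N%:R = n%:R + 4 :> R by rewrite /N natrD.
have /andP[r0 r1] := route_rho H.
have A2 : A 2 = x by []. 
have A3 : A 3 = (pos p 1)%:R by exact: abscissas_lt.
have nE : n.-1.+1 = n by exact: prednK.
have An2 : A n.+2 = (pos p n)%:R.
  by have := @abscissas_lt R n p x y n.-1; rewrite nE => /(_ (leqnn n)).
have An3 : A n.+3 = y by exact: abscissas_n.
have B3 k : (k <= n)%N -> B k.+3 = level n (pos p) k by exact: heights_level.
have inD (s : R) : 5 / 2 <= s <= n%:R + 5 / 2 -> 1 / 2 - rho <= s < N%:R + 1 / 2 - rho.
  by rewrite NE; move: r0 r1; clear; lra.
have piece (s : R) : 5 / 2 <= s <= n%:R + 5 / 2 ->
    (exists2 i, (i <= n)%N & horiz rho i.+2 s) \/ (exists2 k, (k < n)%N & vert rho k.+3 s).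
  move=> sI; have /andP[s1 s2] := sI; have [[i iN hi]|[j jN vj]] := fundamental_piece H (inD s sI).
    left; move: hi => /andP[i1 i2]; case: i iN i1 i2 => [|[|i]] iN i1 i2.
    - by exfalso; move: i2 s1 r1; clear; lra.
    - by exfalso; move: i2 s1 r1; clear; lra.
    exists i; last by rewrite /horiz i1.
    rewrite leqNgt; apply/negP => ni; have : n%:R + 1 <= i%:R :> R by rewrite natr1 ler_nat.
    by move: i1; rewrite -(addn2 i) natrD; move: s2 r1; clear; lra.
  right; move: vj => /andP[j1 j2]; case: j jN j1 j2 => [|[|[|j]]] jN j1 j2.
  - by exfalso; move: j2 s1 r0; clear; lra.
  - by exfalso; move: j2 s1 r0; clear; lra.
  - by exfalso; move: j2 s1 r0; clear; lra.
  exists j; last by rewrite /vert j1.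
  rewrite ltnNge; apply/negP => nj; have : n%:R <= j%:R :> R by rewrite ler_nat.
  by move: j1; rewrite -(addn3 j) natrD; move: s2 r0; clear; lra.
have phaseP (s : R) : 5 / 2 <= s <= n%:R + 5 / 2 -> exists2 k, (k < n)%N & phase k.+3 s.
  move=> sI; have /andP[s1 s2] := sI; have [[i iN hi]|[k kn vk]] := piece s sI; last first.
    by exists k => //; exact: vert_phase H vk.
  move: hi; rewrite /horiz -(addn2 i) natrD => /andP[i1 i2].
  have [si|si] := leP s (i%:R + 5 / 2).
    case: i iN i1 i2 si => [|i] iN i1 i2 si.
      by exists 0%N => //; rewrite /phase; move: s1 si r0 r1; clear; lra.
    exists i => //; rewrite /phase -(addn2 i.+1) natrD -natr1 in i1 si *; move: i1 si r0 r1; clear; lra.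
  have iltn : (i < n)%N by have : i%:R < n%:R :> R; [move: s2 si; clear; lra|rewrite ltr_nat].
  exists i => //; rewrite /phase -(addn3 i) natrD; move: i2 si r1; clear; lra.
have YE k (s : R) : (k < n)%N -> phase k.+3 s -> exists2 v : R, 0 <= v <= 1 & Y s = h k + (h k.+1 - h k) * v.
  move=> kn ks; exists (step (s - k.+3%:R + 1 / 2)); first exact: step_itv.
  rewrite /Y (routeYE H _ ks); last by rewrite /N; move: kn; clear; lia.
  by rewrite /B heights_level ?(ltnW kn) // heights_level // intrB.
have YT (s : R) : 5 / 2 <= s <= n%:R + 5 / 2 -> - T <= Y s <= T.
  move=> /phaseP[k kn ks]; have [v v01 ->] := YE k s kn ks.
  have /andP[a1 a2] := hT k (ltnW kn); have /andP[a3 a4] := hT k.+1 kn.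
  by rewrite convex_ge ?convex_le ?(ltW a1) ?(ltW a2) ?(ltW a3) ?(ltW a4).
have Ystart : Y (5 / 2) = h 0%N.
  have ph : phase 3 (5 / 2 : R) by rewrite /phase; clear; lra.
  rewrite /Y (routeYE H _ ph) ?step_le0 ?mulr0 ?addr0 ?B3 //; [by clear; lra|by rewrite /N; move: n0; clear; lia].
have Yend : Y (n%:R + 5 / 2) = h n.
  have ph : phase n.+2 (n%:R + 5 / 2 : R) by rewrite /phase -(addn2 n) natrD; clear; lra.
  rewrite /Y (routeYE H _ ph) ?step_ge1 ?mulr1.
  - by rewrite B3 // intrB addrC subrK.
  - by rewrite -(addn2 n) natrD; clear; lra.
  - by rewrite /N; clear; lia.
have half_arg i : (i%:R + 5 / 2 - i.+2%:R - 1 / 2 + rho) / (2 * rho) = 1 / 2.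
  by rewrite -(addn2 i) natrD; field; rewrite gt_eqF.
have Xmid i : (i < n.+1)%N -> X (i%:R + 5 / 2) = (A i.+2 + A i.+3) / 2.
  move=> iN; rewrite /X (@routeXE _ _ _ _ _ i.+2 _ H); last 2 first.
  - by rewrite /N; move: iN; clear; lia.
  - by rewrite -(addn2 i) natrD; move: r0 r1; clear; lra.
  rewrite half_arg step_half; by field.
have X0 : X (5 / 2) = - w 0%N.
  by have := Xmid 0%N isT; rewrite add0r => ->; rewrite A2 A3 /x; field.
have Xn : X (n%:R + 5 / 2) = w n.
  by rewrite Xmid // An2 An3 /y; field.
have hop k : (k < n)%N -> h k * h k.+1 <= 0.
  move=> kn; have : level n (pos p) k * level n (pos p) k.+1 <= 0.
    by have := level_opposite p kn; rewrite /btw; clear; nia.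
  by rewrite -(ler_int R) intrM.
have eR : n.+1%:R ^+ 2 + T ^+ 2 <= R0 ^+ 2.
  by have := mulr_ge0 T0 (ler0n R n.+1); rewrite /R0; clear; lra.
have middle (s : R) : 5 / 2 <= s <= n%:R + 5 / 2 -> 1 <= X s <= n%:R -> X s ^+ 2 + Y s ^+ 2 < R0 ^+ 2.
  move=> sI /andP[x1' xn]; have /andP[y1 y2] := YT s sI.
  have := sqr_lt_norm (x := X s) (w := n.+1%:R); rewrite -natr1 => H1.
  have {H1} H1 := H1 ltac:(move: x1' n1; clear; lra) ltac:(move: xn; clear; lra).
  have : 0 <= (T - Y s) * (T + Y s) by rewrite mulr_ge0 ?subr_ge0 //; move: y1; clear; lra.
  by move: H1 eR; rewrite -natr1; clear; lra.
have inside (s : R) : 5 / 2 < s < n%:R + 5 / 2 -> X s ^+ 2 + Y s ^+ 2 < R0 ^+ 2.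
  move=> /andP[s1 s2]; have sI : 5 / 2 <= s <= n%:R + 5 / 2 by rewrite !ltW.
  have [[i iN hi]|[k kn vk]] := piece s sI; last first.
    apply: middle => //; rewrite /X (routeX_vert (j := k.+3) H) ?/A ?abscissas_lt //.
    - by have [h1' h2'] := pos_btw R p kn; rewrite h1' h2'.
    - by rewrite /N; move: kn; clear; lia.
    - by move: vk; rewrite /vert; clear; lra.
  have iNN : (i.+2 < N)%N by rewrite /N; move: iN; clear; lia.
  have [u u01 XE] : exists2 u : R, 0 <= u <= 1 & X s = A i.+2 + (A i.+3 - A i.+2) * u.
    exists (step ((s - i.+2%:R - 1 / 2 + rho) / (2 * rho))); first exact: step_itv.
    exact: routeXE H iNN (horiz_wide H hi).
  have Yn : `|Y s - h i| < 1 / 2 by have := routeY_horiz H iNN hi; rewrite /B heights_level.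
  (* On the two extreme edges the abscissa is bounded by that of the end point on the circle, and
     the height by [near_end_sqr]; elsewhere [middle] suffices. *)
  have [i0|i0] := posnP i.
    subst i; have A23 : A 2 < A 3 by rewrite A2 A3 /x; move: w0n p11 n1; clear; lra.
    have h52 : horiz rho 2 (5 / 2) by rewrite /horiz; move: r0; clear; lra.
    have Xlt : - w 0%N < X s.
      rewrite -X0 lt_neqAle (routeX_le H iNN A23 h52 hi (ltW s1)) andbT.
      by apply/eqP => /(routeX_inj H iNN h52 hi) E; move: s1; rewrite E ltxx.
    have Xle : X s <= A 3 by rewrite XE convex_le // ltW.
    have A3w : A 3 < w 0%N by rewrite A3; move: p1n w0n; clear; lra.
    have X2 := sqr_lt_norm Xlt (le_lt_trans Xle A3w).
    have ph3 : phase 3 s by move: hi; rewrite /horiz /phase => /andP[_ e2]; move: e2 s1 r1; clear; lra.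
    have [v v01 E] := YE 0%N s n0 ph3.
    have := near_end_sqr (h1 0%N isT) _ v01 E Yn; rewrite mulrC => /(_ (hop 0%N n0)).
    by move: X2 w0E; clear; lra.
  move: iN; rewrite leq_eqVlt => /orP[/eqP ni|iN]; last first.
    have iE : i.-1.+1 = i by rewrite prednK.
    have in' : (i.-1 < n)%N by rewrite iE ltnW.
    have [a1 a2] := pos_btw R p in'; have [b1 b2] := pos_btw R p iN; rewrite iE in a1 a2.
    have Ai : A i.+2 = (pos p i)%:R by have := abscissas_lt p x y in'; rewrite iE.
    have Ai' : A i.+3 = (pos p i.+1)%:R by exact: abscissas_lt.
    by apply: middle => //; rewrite XE Ai Ai' convex_ge ?convex_le.
  subst i; have A23 : A n.+2 < A n.+3 by rewrite An2 An3 /y; move: w1n pnn n1; clear; lra.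
  have h52 : horiz rho n.+2 (n%:R + 5 / 2) by rewrite /horiz -(addn2 n) natrD; move: r0; clear; lra.
  have Xlt : X s < w n.
    rewrite -Xn lt_neqAle (routeX_le H iNN A23 hi h52 (ltW s2)) andbT.
    by apply/eqP => /(routeX_inj H iNN hi h52) E; move: s2; rewrite E ltxx.
  have Xge : A n.+2 <= X s by rewrite XE convex_ge // ltW.
  have wA : - w n < A n.+2 by rewrite An2; move: pn1 w1n n1; clear; lra.
  have X2 := sqr_lt_norm (lt_le_trans wA Xge) Xlt.
  have phn : phase n.-1.+3 s.
    rewrite nE /phase; move: hi; rewrite /horiz -(addn2 n) natrD => /andP[e1 _]; move: e1 s2 r1; clear; lra.
  have [v v01 E] := YE n.-1 s ltac:(by rewrite nE) phn; rewrite nE in E.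
  have v01' : 0 <= 1 - v <= 1 by move: v01; clear; lra.
  have hop' : h n.-1 * h n <= 0 by have := hop n.-1; rewrite nE => /(_ (leqnn n)).
  have E' : Y s = h n + (h n.-1 - h n) * (1 - v) by rewrite E; ring.
  have := near_end_sqr (h1 n (leqnn n)) hop' v01' E' Yn.
  by move: X2 w1E; clear; lra.
pose mu := route_curve N A B rho R0^-1 n%:R (5 / 2).
have muE (t : R) : mu t = (R0^-1 * X (n%:R * t + 5 / 2), R0^-1 * Y (n%:R * t + 5 / 2)) by [].
have tI (t : R) : 0 <= t <= 1 -> 5 / 2 <= n%:R * t + 5 / 2 <= n%:R + 5 / 2.
  move=> /andP[t0 t1]; rewrite lerDr mulr_ge0 ?(ltW n0r) //= lerD2r.
  by rewrite ler_piMr // ltW.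
have R0i : R0^-1 != 0 by rewrite invr_eq0 gt_eqF.
have sqE (t : R) : (mu t).1 ^+ 2 + (mu t).2 ^+ 2 =
    (X (n%:R * t + 5 / 2) ^+ 2 + Y (n%:R * t + 5 / 2) ^+ 2) / R0 ^+ 2.
  by rewrite muE /=; field; rewrite gt_eqF.
have R02 : 0 < R0 ^+ 2 by rewrite exprn_gt0.
have ends (t : R) : t = 0 \/ t = 1 -> X (n%:R * t + 5 / 2) ^+ 2 + Y (n%:R * t + 5 / 2) ^+ 2 = R0 ^+ 2.
  case=> ->; first by rewrite mulr0 add0r X0 Ystart sqrrN.
  by rewrite mulr1 Xn Yend.
have ins (t : R) : 0 <= t <= 1 -> t != 0 -> t != 1 ->
    X (n%:R * t + 5 / 2) ^+ 2 + Y (n%:R * t + 5 / 2) ^+ 2 < R0 ^+ 2.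
  move=> /andP[t0 t1] t0' t1'; apply: inside.
  have {t0 t0'} t0 : 0 < t by rewrite lt_neqAle eq_sym t0'.
  have {t1 t1'} t1 : t < 1 by rewrite lt_neqAle t1'.
  by rewrite ltrDr mulr_gt0 //= ltrD2r gtr_pMr.
have eqs (s t : R) : n%:R * s + 5 / 2 = n%:R * t + 5 / 2 :> R -> s = t.
  by move=> /addIr /(mulfI (lt0r_neq0 n0r)).
have emu : proper_embedding mu.
  split.
  - exact: smooth_route_curve.
  - move=> t t01; rewrite /mu (derive1_route_curve _ _ _ _ H).
    by apply: pair_scale_neq0; [rewrite mulf_neq0 // gt_eqF|exact: route_regular H (inD _ (tI t t01))].
  - move=> s t s01 t01; rewrite !muE => -[/(mulfI R0i) EX /(mulfI R0i) EY].
    apply: eqs; apply/eqP; apply: contrapT => /negP st.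
    have /andP[a1 a2] := tI s s01; have /andP[b1 b2] := tI t t01.
    (* Every crossing of the route involves the horizontal side 0 or the vertical side [N], and both
       are outside the time interval of the arc. *)
    have [i [j [iN jN cr hv]]] := route_double H (inD _ (tI s s01)) (inD _ (tI t t01)) st EX EY.
    have [[iE [k kI jE]]|[iE jE]] := crossing_cases n0 NC x1 yn iN jN cr; subst i j.
      by case: hv => -[/andP[_ e2] _]; move: e2 a1 b1 r1; clear; lra.
    by case: hv => -[_ /andP[e1 _]]; move: e1 a2 b2 r0; rewrite -/N NE; clear; lra.
  - move=> t t01; rewrite /unit_disk /= sqE ler_pdivrMr // mul1r.
    have [t0|t0] := eqVneq t 0; first by rewrite ends //; left.
    have [t1|t1] := eqVneq t 1; first by rewrite ends //; right.
    exact/ltW/ins.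
  move=> t t01; rewrite /unit_circle /= sqE; split=> [E|/ends->]; last by rewrite divff // gt_eqF.
  have [t0|t0] := eqVneq t 0; first by left.
  have [t1|t1] := eqVneq t 1; first by right.
  by have := ins t t01 t0 t1; rewrite -[X in _ < X -> _]mul1r -ltr_pdivrMr // E ltxx.
have Hz k : exists s : R, (k < n)%N -> vert rho k.+3 s /\ Y s = 0.
  have [kn|_] := boolP (k < n)%N; last by exists 0.
  have kN : (0 < k.+3 <= N)%N by rewrite /N; move: kn; clear; lia.
  have cr : btw 0 (B k.+3) (B k.+4) by rewrite /B !heights_level ?(ltnW kn) // level_opposite.
  have [|s vs sE] := vert_reach H kN cr (v := 0); last by exists s.
  by rewrite subrr normr0 divr_gt0.
have [zs {Hz} Hz] := boolp.choice Hz.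
pose z (i : 'I_n) : R := (zs i - 5 / 2) / n%:R.
have zsI k : (k < n)%N -> k%:R + 5 / 2 + rho < zs k < k%:R + 7 / 2 - rho.
  by move=> /Hz[]; rewrite /vert -(addn3 k) natrD; clear; lra.
have nz (i : 'I_n) : n%:R * z i + 5 / 2 = zs i.
  by rewrite /z mulrC divfK ?gt_eqF // subrK.
apply: (@meandric_of_curve R n p mu R0 z emu).
- by rewrite muE mulr0 add0r X0 /= mulrN oppr_lt0 mulr_gt0 ?invr_gt0 //; move: w0n n1; clear; lra.
- rewrite muE mulr0 add0r Ystart /= mulf_neq0 //.
  by have := h1 0%N isT; case: eqVneq => // ->; clear; lra.
- by rewrite muE mulr1 Xn /= mulr_gt0 ?invr_gt0 //; move: w1n n1; clear; lra.
- rewrite muE mulr1 Yend /= mulf_neq0 //.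
  by have := h1 n (leqnn n); case: eqVneq => // ->; clear; lra.
- by rewrite /R0 -natr1; move: T0; clear; lra.
- move=> k; have := zsI k (ltn_ord k) => /andP[e1 e2].
  have k0 : 0 <= k%:R :> R by []; have kn : k%:R + 1 <= n%:R :> R by rewrite natr1 ler_nat.
  rewrite /z ler_pdivlMr // ler_pdivrMr //; move: e1 e2 k0 kn r0; clear; lra.
- move=> i j ij; have := zsI i (ltn_ord i) => /andP[_ e2]; have := zsI j (ltn_ord j) => /andP[e1 _].
  have ij' : i%:R + 1 <= j%:R :> R by rewrite natr1 ler_nat.
  by rewrite /z ltr_pM2r ?invr_gt0 //; move: e1 e2 ij' r0; clear; lra.
- move=> k; have [vk Yk] := Hz k (ltn_ord k); rewrite muE nz Yk mulr0.
  rewrite /X (routeX_vert (j := k.+3) H).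
  + by rewrite /A abscissas_lt // posS mulrC.
  + by rewrite /N; have := ltn_ord k; clear; lia.
  + by move: vk; rewrite /vert; clear; lra.
- move=> k; have [vk Yk] := Hz k (ltn_ord k); rewrite /mu (derive1_route_curve _ _ _ _ H) nz /=.
  apply: mulf_neq0; first by rewrite mulf_neq0 // gt_eqF.
  apply: (derive1_routeY_phase (j := k.+3) H); first by rewrite /N; have := ltn_ord k; clear; lia.
  by move: vk r0; rewrite /vert; clear; lra.
(* On a horizontal side the height is within 1/2 of a nonzero integer; on a vertical side it
   vanishes only once. *)
move=> s s01; rewrite muE /= => /eqP; rewrite mulf_eq0 (negbTE R0i) /= => /eqP Y0.
have [[i iN hi]|[k kn vk]] := piece _ (tI s s01).
  have iNN : (i.+2 < N)%N by rewrite /N; move: iN; clear; lia.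
  have := routeY_horiz H iNN hi; rewrite /B heights_level // -/Y Y0 sub0r normrN ltr_norml => /andP[e1 e2].
  by exfalso; have := h1 i iN; rewrite /h; move: e1 e2; clear; lra.
have [vk' Yk] := Hz k kn; exists (Ordinal kn); apply: eqs; rewrite nz /=.
apply: (routeY_inj (j := k.+3) H _ (vert_phase H vk) (vert_phase H vk')).
  by rewrite /N; move: kn; clear; lia.
by rewrite -/Y Y0 Yk.
Qed.

End MeanderOfNoncrossing.

Theorem theorem4p5 (R : realType) (n : nat) (hn : (1 <= n)%N) (p : 'S_n) :
  realizable (perm_diagram R p) <-> meandric R p.
Proof.
split=> [/(realizable_noncrossing hn)|/(meandric_noncrossing hn)].
  exact: noncrossing_meandric.
exact: noncrossing_realizable.
Qed.
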